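(* Let $(M,g_M,\omega_M,\nabla,\xi,\Lambda)$ be an integral conical affine special Kähler manifold with its canonical central charge and a compatible mutually local variation of BPS structures $\Omega$, and let $(N,g_N,\omega_1,\omega_2,\omega_3)$ be the associated instanton corrected pseudo-hyperkähler manifold. Let $V$ be the $\nabla$-horizontal lift of $J\xi$ to $N$. Then $V$ defines an infinitesimal rotating circle action for $(N,g_N,\omega_1,\omega_2,\omega_3)$; that is, $V$ is a Killing vector field of $g_N$ with $\mathcal L_V(\omega_1+i\omega_2)=i(\omega_1+i\omega_2)$ and $\mathcal L_V\omega_3=0$.
   Context: **CASK manifolds.** An affine special Kähler (ASK) manifold $(M,g_M,\omega_M,\nabla)$ is a pseudo-Kähler manifold, with complex structure $J$ determined by $g_M(J\cdot,\cdot)=\omega_M$, with a flat torsion-free connection $\nabla$ on $TM$ such that $\nabla\omega_M=0$ and $d_\nabla J=0$. A conical ASK (CASK) manifold has in addition a vector field $\xi$ with $\nabla\xi=D\xi=\mathrm{Id}$ ($D$ Levi-Civita) such that $g_M$ is positive definite on $\mathcal D=\mathrm{span}\{\xi,J\xi\}$ and negative definite on $\mathcal D^\perp$. It is integral if equipped with a bundle $\Lambda\subset TM$ of $\nabla$-flat lattices, $\Lambda\otimes\mathbb R=TM$, admitting local Darboux frames $(\widetilde\gamma_i,\gamma^i)$: $\omega_M(\widetilde\gamma_i,\gamma^j)=\delta_i^j$, other pairings zero. $\langle\cdot,\cdot\rangle:=\omega_M|_{\Lambda\times\Lambda}$. The canonical central charge is the section $Z$ of $\Lambda^*\otimes\mathbb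 C$ with $Z_\gamma=2\omega_M(\xi^{1,0},\gamma)$, $\xi^{1,0}=\frac12(\xi-iJ\xi)$. **BPS structures.** A mutually local variation of BPS structures is a function $\Omega:\Lambda\to\mathbb Z$, $\mathrm{Supp}(\Omega)=\{\Omega\ne0\}$, with: (i) $\Omega(-\gamma)=\Omega(\gamma)$; (ii) $\langle\gamma,\gamma'\rangle=0$ for $\gamma,\gamma'\in\mathrm{Supp}(\Omega)$ over the same point; (iii) the Kontsevich–Soibelman wall-crossing formula, which in the mutually local case means $\Omega(\gamma)$ is locally constant for local flat sections $\gamma$; (iv) for compact $K\subset M$ and covariantly constant norm on $\Lambda|_K\otimes\mathbb R$ there is $C>0$ with $|Z_\gamma|>C|\gamma|$ for $\gamma\in\Lambda|_K\cap\mathrm{Supp}(\Omega)$; (v) for each $R>0$, $\sum_{\gamma\in\Lambda_p}|\Omega(\gamma)|e^{-R|Z_\gamma|}$ converges normally on compact subsets of $M$. **Hyperkähler structure.** $N:=T^*M/\Lambda^*$ with projection $\pi:N\to M$; $\theta_\gamma([\alpha])=2\pi\alpha(\gamma)$ mod $2\pi$. Pullbacks are omitted. $\langle dA\wedge dB\rangle:=dA_{\widetilde\gamma_i}\wedge dB_{\gamma^i}-dA_{\gamma^i}\wedge dB_{\widetilde\gamma_i}$ in local Darboux frames. With $K_0,K_1$ modified Bessel functions of the second kind, $$V_\gamma^{\mathrm{inst}}=\frac1{2\pi}\sum_{n>0}e^{in\theta_\gamma}K_0(2\pi n|Z_\gamma|),\quad A_\gamma^{\mathrm{inst}}=-\frac1{4\pi}\sum_{n>0}e^{in\theta_\gamma}|Z_\gamma|K_1(2\pi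 n|Z_\gamma|)\Big(\frac{dZ_\gamma}{Z_\gamma}-\frac{d\overline Z_\gamma}{\overline Z_\gamma}\Big),$$ $$\omega_1+i\omega_2=-\frac1{2\pi}\langle dZ\wedge d\theta\rangle+\sum_\gamma\Big(\Omega(\gamma)dZ_\gamma\wedge A_\gamma^{\mathrm{inst}}+\frac{i\Omega(\gamma)}{2\pi}V_\gamma^{\mathrm{inst}}d\theta_\gamma\wedge dZ_\gamma\Big),$$ $$\omega_3=\frac14\langle dZ\wedge d\overline Z\rangle-\frac1{8\pi^2}\langle d\theta\wedge d\theta\rangle+\sum_\gamma\Big(\frac{i\Omega(\gamma)}2V_\gamma^{\mathrm{inst}}dZ_\gamma\wedge d\overline Z_\gamma+\frac{\Omega(\gamma)}{2\pi}d\theta_\gamma\wedge A_\gamma^{\mathrm{inst}}\Big)$$ ($\omega_1,\omega_2$ real; sums over $\gamma\in\mathrm{Supp}(\Omega)$ in the fibre). $\Omega$ is compatible if $T=\pi^*g_M+\sum_\gamma\Omega(\gamma)V_\gamma^{\mathrm{inst}}\pi^*|dZ_\gamma|^2$ is non-degenerate on $TN/\ker d\pi$; then $\omega_\alpha=g_N(I_\alpha\cdot,\cdot)$ are the Kähler forms of a pseudo-hyperkähler structure $(g_N,I_1,I_2,I_3)$, $I_\alpha=-\omega_\beta^{-1}\circ\omega_\gamma$ for $(\alpha,\beta,\gamma)$ cyclic, $g_N=-\omega_\alpha(I_\alpha\cdot,\cdot)$. **The lift $V$.** If $q^i$ are $\nabla$-affine special coordinates on $M$ and $(\pi^*q^i,p_i)$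 the corresponding coordinates on $T^*M$, then $V(\pi^*q^i)=\pi^*(J\xi(q^i))$, $V(p_i)=0$; this is coordinate independent and descends to $N$. Equivalently $d\pi(V)=J\xi$ and $d\theta_\gamma(V)=0$ for flat local sections $\gamma$ of $\Lambda$. *)

(* Defs.v *)
From mathcomp Require Import all_boot all_order all_algebra.
From mathcomp Require Import all_classical all_reals all_analysis.
From mathcomp Require Import complex.

Set Implicit Arguments.
Unset Strict Implicit.
Unset Printing Implicit Defensive.
Import Order.TTheory GRing.Theory Num.Theory.
Import numFieldNormedType.Exports.

Local Open Scope classical_set_scope.
Local Open Scope ring_scope.
Local Open Scope complex_scope.

Local Notation Re := complex.Re.
Local Notation Im := complex.Im.
Local Notation normc := ComplexField.Normc.normc.
(* 'i and ^* could also be read as the generic operations of numClosedFieldType *)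
Local Notation ii := (Complex 0 1).

(* C^oo on the open set A: all iterated directional derivatives of f are
   (Frechet) differentiable at every point of A. *)
Definition smooth_on (R : realType) (E F : normedModType R)
    (A : set E) (f : E -> F) : Prop :=
  forall (s : seq E) (x : E), A x ->
    differentiable (foldr (fun v h => 'D_v h) f s) x.

(* A smooth manifold of dimension m given by an atlas of charts
   phi i : dom i -> 'rV[R]_m with inverses psi i. *)
Record manifold (R : realType) (m : nat) := Manifold {
  carrier :> topologicalType;
  idx : Type;
  dom : idx -> set carrier;
  phi : idx -> carrier -> 'rV[R]_m;
  psi : idx -> 'rV[R]_m -> carrier;
  mfd_hausdorff : hausdorff_space carrier;
  mfd_second_countable : @second_countable carrier;
  dom_open : forall i, open (dom i);
  dom_cover : \bigcup_i dom i = [set: carrier];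
  img_open : forall i, open (phi i @` dom i);
  phiK : forall i p, dom i p -> psi i (phi i p) = p;
  phi_continuous : forall i p, dom i p -> {for p, continuous (phi i)};
  psi_continuous : forall i x, (phi i @` dom i) x -> {for x, continuous (psi i)};
  trans_smooth : forall i j,
    smooth_on (phi i @` (dom i `&` dom j)) (phi j \o psi i)
}.

(* Tensor fields and connections on M are families of local expressions
   indexed by the charts i, subject to the usual transformation rules.  The
   local expressions only matter on img M i; tangent vectors at a point are row
   vectors of components, and matrices act on them from the right. *)
Section Fields.
Variables (R : realType) (m : nat) (M : manifold R m).
Notation E := 'rV[R]_m.

Definition img (i : idx M) : set E := phi i @` dom i.
Definition ov (i j : idx M) : set E := phi i @` (dom i `&` dom j).
Definition tr (i j : idx M) : E -> E := phi j \o psi i.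
Definition dtr (i j : idx M) (x u : E) : E := 'D_u (tr i j) x.

Definition vfield := idx M -> E -> E.
Definition form2 := idx M -> E -> 'M[R]_m.
Definition endo := idx M -> E -> 'M[R]_m.
(* Christoffel symbols: the row vector u *m G i a x is the covariant derivative
   of the constant field u in the direction of the a-th coordinate field. *)
Definition connection := idx M -> 'I_m -> E -> 'M[R]_m.

Definition ev2 (B : 'M[R]_m) (u v : E) : R := (u *m B *m v^T) 0 0.
Definition chr (G : connection) (i : idx M) (x u v : E) : E :=
  \sum_(a < m) u 0 a *: (v *m G i a x).

(* nabla_u X at x, for a vector field X in the chart i *)
Definition cov (G : connection) (i : idx M) (x u : E) (X : E -> E) : E :=
  'D_u X x + chr G i x u (X x).

Definition is_vfield (X : vfield) : Prop :=
  (forall i, smooth_on (img i) (X i)) /\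
  forall i j x, ov i j x -> X j (tr i j x) = dtr i j x (X i x).

Definition is_form2 (B : form2) : Prop :=
  (forall i, smooth_on (img i) (B i)) /\
  forall i j x u v, ov i j x ->
    ev2 (B j (tr i j x)) (dtr i j x u) (dtr i j x v) = ev2 (B i x) u v.

Definition is_endo (J : endo) : Prop :=
  (forall i, smooth_on (img i) (J i)) /\
  forall i j x u, ov i j x ->
    dtr i j x u *m J j (tr i j x) = dtr i j x (u *m J i x).

Definition is_connection (G : connection) : Prop :=
  (forall i a, smooth_on (img i) (G i a)) /\
  forall i j x u v, ov i j x ->
    'D_u (fun y => dtr i j y v) x
      + chr G j (tr i j x) (dtr i j x u) (dtr i j x v)
    = dtr i j x (chr G i x u v).

(* In the following, constant vector fields (which commute) suffice to test
   tensorial identities. *)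
Definition torsion_free (G : connection) : Prop :=
  forall i x u v, img i x -> chr G i x u v = chr G i x v u.

Definition flat (G : connection) : Prop :=
  forall i x u v w, img i x ->
    cov G i x u (fun y => cov G i y v (cst w))
    = cov G i x v (fun y => cov G i y u (cst w)).

Definition parallel_form2 (G : connection) (B : form2) : Prop :=
  forall i x u v w, img i x ->
    'D_u (fun y => ev2 (B i y) v w) x
    = ev2 (B i x) (chr G i x u v) w + ev2 (B i x) v (chr G i x u w).

Definition parallel_endo (G : connection) (J : endo) : Prop :=
  forall i x u v, img i x ->
    cov G i x u (fun y => v *m J i y) = chr G i x u v *m J i x.

(* d_nabla J = 0, for J viewed as a TM-valued 1-form *)
Definition dnabla_closed (G : connection) (J : endo) : Prop :=
  forall i x u v, img i x ->
    cov G i x u (fun y => v *m J i y) = cov G i x v (fun y => u *m J i y).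

Definition levi_civita (g : form2) (D : connection) : Prop :=
  [/\ is_connection D, torsion_free D & parallel_form2 D g].

(* nabla X = Id *)
Definition cov_id (G : connection) (X : vfield) : Prop :=
  forall i x u, img i x -> cov G i x u (X i) = u.

Definition flat_section (G : connection) (i : idx M) (W : set E) (s : E -> E) :
    Prop :=
  smooth_on W s /\ forall x u, W x -> cov G i x u s = 0.

Definition pseudo_riemannian (g : form2) : Prop :=
  [/\ is_form2 g,
      forall i x u v, img i x -> ev2 (g i x) u v = ev2 (g i x) v u
    & forall i x, img i x -> g i x \in unitmx].

Definition pseudo_kahler (g om : form2) (J : endo) (D : connection) : Prop :=
  [/\ pseudo_riemannian g, is_form2 om /\ is_endo J,
      forall i x, img i x ->
        [/\ forall u : E, u *m J i x *m J i x = - u,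
            forall u v, ev2 (g i x) (u *m J i x) (v *m J i x) = ev2 (g i x) u v
          & forall u v, ev2 (g i x) (u *m J i x) v = ev2 (om i x) u v],
      levi_civita g D & parallel_endo D J].

Definition ask (g om : form2) (J : endo) (D nab : connection) : Prop :=
  [/\ pseudo_kahler g om J D,
      [/\ is_connection nab, flat nab & torsion_free nab],
      parallel_form2 nab om & dnabla_closed nab J].

Definition cask (g om : form2) (J : endo) (D nab : connection) (xi : vfield) :
    Prop :=
  [/\ ask g om J D nab, is_vfield xi, cov_id nab xi /\ cov_id D xi,
      forall i x (a b : R), img i x ->
        let u := a *: xi i x + b *: (xi i x *m J i x) in
        u != 0 -> 0 < ev2 (g i x) u u
    & forall i x u, img i x ->
        ev2 (g i x) u (xi i x) = 0 -> ev2 (g i x) u (xi i x *m J i x) = 0 ->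
        u != 0 -> ev2 (g i x) u u < 0].

End Fields.

(* The modified Bessel function of the second kind, by its integral
   representation K_nu(x) = int_0^oo exp(- x cosh t) cosh (nu t) dt, x > 0. *)
Definition rcosh (R : realType) (t : R) : R := (expR t + expR (- t)) / 2.
Definition besselK (R : realType) (nu : nat) (x : R) : R :=
  Rintegral (@lebesgue_measure R) `[0, +oo[
    (fun t => expR (- x * rcosh t) * rcosh (nu%:R * t)).

(* The sum of an absolutely summable family of real (resp. complex) numbers,
   and the sum of a convergent complex series. *)
Definition rsum (R : realType) (I : choiceType) (S : set I) (f : I -> R) : R :=
  fine (\esum_(k in S) (EFin \o f)^\+ k - \esum_(k in S) (EFin \o f)^\- k)%E.
Definition csum (R : realType) (I : choiceType) (S : set I) (f : I -> R[i]) :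
    R[i] :=
  rsum S (fun k => Re (f k)) +i* rsum S (fun k => Im (f k)).
Definition cseries (R : realType) (f : nat -> R[i]) : R[i] :=
  limn (series (fun k => Re (f k))) +i* limn (series (fun k => Im (f k))).

Definition cexpi (R : realType) (t : R) : R[i] := cos t +i* sin t.

Definition wedge (R : realType) (E : Type) (a b : E -> R[i]) (u v : E) : R[i] :=
  a u * b v - a v * b u.

Definition cdiff (R : realType) (E : normedModType R) (f : E -> R[i]) (z u : E) :
    R[i] :=
  'D_u (fun y => Re (f y)) z +i* 'D_u (fun y => Im (f y)) z.

(* L_V B exists and equals B' at z, for a covariant 2-tensor B on an open subset of a vector
   space: for constant fields u and w, [V, u] = - D_u V. *)
Definition is_lie (R : realType) (E : normedModType R) (V : E -> E)
    (B : E -> E -> E -> R) (z : E) (B' : E -> E -> R) : Prop :=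
  differentiable V z /\
  forall u w,
    differentiable (fun y => B y u w) z /\
    'D_(V z) (fun y => B y u w) z + B z ('D_u V z) w + B z u ('D_w V z) = B' u w.

Definition is_clie (R : realType) (E : normedModType R) (V : E -> E)
    (B : E -> E -> E -> R[i]) (z : E) (B' : E -> E -> R[i]) : Prop :=
  is_lie V (fun y u w => Re (B y u w)) z (fun u w => Re (B' u w)) /\
  is_lie V (fun y u w => Im (B y u w)) z (fun u w => Im (B' u w)).

Section Integral.
(* M has complex dimension n *)
Variables (R : realType) (n : nat) (M : manifold R (n + n)).
Notation E := 'rV[R]_(n + n).
Variables (g om : form2 M) (J : endo M) (nab : connection M) (xi : vfield M).
(* Lam i x is the lattice of the tangent space at x; Om is only relevant there *)
Variables (Lam : idx M -> E -> set E) (Om : idx M -> E -> E -> int).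

(* the local section of Lambda with coefficients k in a local frame (a, b) *)
Definition lsec (a b : 'I_n -> E -> E) (k : 'rV[int]_(n + n)) (x : E) : E :=
  \sum_(r < n) (k 0 (lshift n r))%:~R *: a r x
  + \sum_(r < n) (k 0 (rshift n r))%:~R *: b r x.
Definition ka (r : 'I_n) : 'rV[int]_(n + n) := delta_mx 0 (lshift n r).
Definition kb (r : 'I_n) : 'rV[int]_(n + n) := delta_mx 0 (rshift n r).

(* (a, b) = (gamma~_r, gamma^r) is a Darboux frame of Lambda over the open
   subset W of the chart i.  The pairings make it a frame of TM as well. *)
Record darboux_frame (i : idx M) (W : set E) (a b : 'I_n -> E -> E) : Prop := {
  df_open : open W;
  df_sub : W `<=` img i;
  df_flata : forall r, flat_section nab i W (a r);
  df_flatb : forall r, flat_section nab i W (b r);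
  df_ab : forall r s x, W x -> ev2 (om i x) (a r x) (b s x) = (r == s)%:R;
  df_aa : forall r s x, W x -> ev2 (om i x) (a r x) (a s x) = 0;
  df_bb : forall r s x, W x -> ev2 (om i x) (b r x) (b s x) = 0;
  df_gen : forall x, W x -> Lam i x = range (fun k => lsec a b k x)
}.

Definition integral_structure : Prop :=
  (forall i j x, ov i j x -> Lam j (tr i j x) = dtr i j x @` Lam i x) /\
  (forall i x, img i x -> exists W a b, W x /\ darboux_frame i W a b).

(* Z_v = 2 om(xi^{1,0}, v), with om extended complex linearly and
   xi^{1,0} = (xi - i J xi) / 2 *)
Definition central_charge (i : idx M) (x v : E) : R[i] :=
  2 * (2^-1 * ((ev2 (om i x) (xi i x) v)%:C
               - ii * (ev2 (om i x) (xi i x *m J i x) v)%:C)).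

Definition is_norm (N : E -> R) : Prop :=
  [/\ forall v, 0 <= N v, forall v, N v = 0 -> v = 0,
      forall (c : R) v, N (c *: v) = `|c| * N v
    & forall v w, N (v + w) <= N v + N w].

(* a covariantly constant norm on the restriction of Lambda (x) R = TM to K *)
Definition parallel_norm (K : set M) (N : idx M -> E -> E -> R) : Prop :=
  [/\ forall i x, img i x -> K (psi i x) -> is_norm (N i x),
      forall i j x v, ov i j x -> K (psi i x) ->
        N j (tr i j x) (dtr i j x v) = N i x v
    & forall i W s, open W -> W `<=` img i -> flat_section nab i W s ->
        forall x, W x -> K (psi i x) ->
          \forall y \near x, K (psi i y) -> N i y (s y) = N i x (s x)].

Record bps_structure : Prop := {
  bps_chart : forall i j x v, ov i j x -> Lam i x v ->
    Om j (tr i j x) (dtr i j x v) = Om i x v;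
  bps_even : forall i x v, img i x -> Lam i x v -> Om i x (- v) = Om i x v;
  bps_local : forall i x v w, img i x -> Lam i x v -> Lam i x w ->
    Om i x v != 0 -> Om i x w != 0 -> ev2 (om i x) v w = 0;
  bps_wall : forall i W s, open W -> W `<=` img i -> flat_section nab i W s ->
    (forall x, W x -> Lam i x (s x)) ->
    forall x, W x -> \forall y \near x, Om i y (s y) = Om i x (s x);
  bps_support : forall (K : set M) N, compact K -> parallel_norm K N ->
    exists2 C : R, 0 < C & forall i x v, img i x -> K (psi i x) ->
      Lam i x v -> Om i x v != 0 -> C * N i x v < normc (central_charge i x v);
  (* normal convergence, where the terms of the sum over the lattice Lam i x are
     the functions of x given by its flat local sections *)
  bps_convergence : forall i W a b, darboux_frame i W a b ->
    forall K : set E, compact K -> K `<=` W -> forall r : R, 0 < r ->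
    (\esum_(k in [set: 'rV[int]_(n + n)]) ereal_sup
       [set (`|(Om i x (lsec a b k x))%:~R|
             * expR (- r * normc (central_charge i x (lsec a b k x))))%:E
       | x in K] < +oo)%E
}.

(* N = T*M / Lambda^* is the quotient of T*M by translations by the local
   sections of Lambda^*, so that T*M -> N is a covering and local coordinates of T*M are local
   coordinates of N.  Over the chart i they are z = row_mx x p, where p are the
   components of a covector; theta lifts to the real valued function
   2 pi p(gamma).  Tensor fields on N are written in these coordinates.  Sums
   over the fibre of Lambda are sums over the coefficients k with respect to a
   Darboux frame (a, b), so that dZ k and dtheta k are the differentials of the
   functions given by a flat local section. *)
Notation TE := 'rV[R]_((n + n) + (n + n)).
Definition base (z : TE) : E := lsubmx z.
Definition fibre (z : TE) : E := rsubmx z.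

(* The nabla-horizontal lift of J xi: a covector field p is parallel along u iff
   (D_u p)(v) = p (chr u v), so that V has no p-component in affine charts. *)
Definition hlift (i : idx M) (z : TE) : TE :=
  let x := base z in
  let v := xi i x *m J i x in
  row_mx v (\row_c (chr nab i x v (delta_mx 0 c) *m (fibre z)^T) 0 0).

Section Frame.
Variables (i : idx M) (a b : 'I_n -> E -> E).
Implicit Types (k : 'rV[int]_(n + n)) (z u w : TE).

Definition Z k z : R[i] := central_charge i (base z) (lsec a b k (base z)).
Definition theta k z : R := 2 * pi * (lsec a b k (base z) *m (fibre z)^T) 0 0.
Definition OmC k z : R[i] := (Om i (base z) (lsec a b k (base z)))%:~R.
Definition supp z : set 'rV[int]_(n + n) :=
  [set k | Om i (base z) (lsec a b k (base z)) != 0].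

Definition dZ k z : TE -> R[i] := cdiff (Z k) z.
Definition dZbar k z : TE -> R[i] := fun u => conjc (dZ k z u).
Definition dtheta k z : TE -> R[i] := fun u => ('D_u (theta k) z)%:C.

Definition bracket (A B : 'rV[int]_(n + n) -> TE -> R[i]) u w : R[i] :=
  \sum_(r < n) (wedge (A (ka r)) (B (kb r)) u w - wedge (A (kb r)) (B (ka r)) u w).

(* in the two series below, the index l stands for n = l + 1 > 0 *)
Definition Vinst k z : R[i] :=
  ((2 * pi)^-1)%:C *
  cseries (fun l => cexpi (l.+1%:R * theta k z)
                    * (besselK 0 (2 * pi * l.+1%:R * normc (Z k z)))%:C).

Definition Ainst k z : TE -> R[i] := fun u =>
  - ((4 * pi)^-1)%:C *
  cseries (fun l => cexpi (l.+1%:R * theta k z)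
                    * (normc (Z k z)
                       * besselK 1 (2 * pi * l.+1%:R * normc (Z k z)))%:C
                    * (dZ k z u / Z k z - dZbar k z u / conjc (Z k z))).

(* omega_1 + i omega_2 *)
Definition varpi z u w : R[i] :=
  - ((2 * pi)^-1)%:C * bracket (dZ^~ z) (dtheta^~ z) u w
  + csum (supp z) (fun k =>
      OmC k z * wedge (dZ k z) (Ainst k z) u w
      + ii * OmC k z / (2 * pi)%:C * Vinst k z * wedge (dtheta k z) (dZ k z) u w).

Definition omega3_formula z u w : R[i] :=
  (4^-1)%:C * bracket (dZ^~ z) (dZbar^~ z) u w
  - ((8 * pi ^+ 2)^-1)%:C * bracket (dtheta^~ z) (dtheta^~ z) u w
  + csum (supp z) (fun k =>
      ii * OmC k z / 2 * Vinst k z * wedge (dZ k z) (dZbar k z) u w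
      + OmC k z / (2 * pi)%:C * wedge (dtheta k z) (Ainst k z) u w).

Definition omega1 z u w : R := Re (varpi z u w).
Definition omega2 z u w : R := Im (varpi z u w).
(* omega3_formula is real, the terms of k and - k being conjugate to each other *)
Definition omega3 z u w : R := Re (omega3_formula z u w).

(* T is real for the same reason; |dZ|^2 (u, w) = Re (dZ u * conj (dZ w)) *)
Definition Tform z u w : R :=
  ev2 (g i (base z)) (base u) (base w)
  + Re (csum (supp z) (fun k =>
      OmC k z * Vinst k z * (Re (dZ k z u * dZbar k z w))%:C)).

Definition gram (B : TE -> TE -> R) : 'M[R]_((n + n) + (n + n)) :=
  \matrix_(r, s) B (delta_mx 0 r) (delta_mx 0 s).

(* I_3 = - omega_1^{-1} o omega_2, i.e. omega_1 (I_3 u, .) = - omega_2 (u, .),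
   and g_N = - omega_3 (I_3 ., .) *)
Definition I3 z u : TE := - (u *m gram (omega2 z) *m invmx (gram (omega1 z))).
Definition gN z u w : R := - omega3 z (I3 z u) w.

End Frame.

Definition compatible : Prop :=
  forall i W a b, darboux_frame i W a b -> forall z, W (base z) ->
    forall u, base u != 0 -> exists w, Tform i a b z u w != 0.

Definition infinitesimal_rotating_action : Prop :=
  forall i W a b, darboux_frame i W a b -> forall z, W (base z) ->
    [/\ is_lie (hlift i) (gN i a b) z (fun _ _ => 0),
        is_clie (hlift i) (varpi i a b) z (fun u w => ii * varpi i a b z u w)
      & is_lie (hlift i) (omega3 i a b) z (fun _ _ => 0)].

End Integral.

(* Main.v *)
From HB Require Import structures.
Require Import Defs.
From mathcomp Require Import all_boot all_order all_algebra.
From mathcomp Require Import all_classical all_reals all_analysis.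
From mathcomp Require Import complex ring lra.

Set Implicit Arguments.
Unset Strict Implicit.
Unset Printing Implicit Defensive.
Import Order.TTheory GRing.Theory Num.Theory.
Import numFieldNormedType.Exports.

(** The field V rotates all central charges at once and fixes all angles, and
the forms omega_1, omega_2 and omega_3 are built from these functions.

Weights.  From nabla xi = D xi = Id and the vanishing of both torsions, nabla and
D agree in the direction of xi, so that nabla_xi J = D_xi J = 0 (nabla_xi_J).
Then d_nabla J = 0 yields nabla (J xi) = J (Jxi_der).  As om is parallel and the
sections gamma are flat, dZ_gamma (u) = om (u, gamma) - i om (J u, gamma).  Hence
dZ_gamma (V) = i Z_gamma, and dtheta_gamma (V) = 0 because V is horizontal.
Cartan's formula for closed 1-forms (closed_form_lie) turns this into
L_V dZ_gamma = i dZ_gamma and L_V dtheta_gamma = 0.  So |Z_gamma|, with the Bessel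
factors, and dZ_gamma / Z_gamma have weight 0; each summand of
omega_1 + i omega_2 has weight i, and each summand of omega_3 has weight 0
(fam2_terms).

Sums.  The Lie derivative may be taken term by term.  On the support
|Z_gamma| >= c |gamma|, and K_0, K_1 decay exponentially together with their
Lipschitz constants (besselK_bound).  Near a point of N the summands and their
Lipschitz constants are thus bounded by a multiple of |Omega| exp (- s |gamma|),
which is summable by the convergence axiom, and sm_der applies.  The
wall-crossing axiom freezes Omega on a ball that does not depend on gamma
(Om_locally_constant).  This gives varpi_clie and omega3_lie.

The metric.  g_N = - omega_3 (I_3 ., .) involves the inverse of omega_1, which has
to be shown to exist.  On the vertical vectors, parametrized by tangent vectors v
of M, the real part of (omega_1 + i omega_2) (u, v) is - (g + Q) (J u, v), with Q
the part of the instanton correction that sums the products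
Omega Re Vinst om (u, gamma) om (v, gamma) (vp_vertv).  If (g + Q) (u, .) = 0, then
pairing with an active gamma and mutual locality give om (J u, gamma) = 0; hence
dZ_gamma (u) is real, T (u, .) = (g + Q) (u, .) = 0, and compatibility forces
u = 0 (gQ_nondeg).  This makes omega_1 non-degenerate (omega1_nondeg).  As
omega_1 + i omega_2 has no component of type (0, 2) with respect to any lift of J
(vp_type), and I_3 is such a lift, I_3 squares to - 1 (I3_square).
Finally L_V omega_1 = - omega_2, L_V omega_2 = omega_1 and I_3 ^ 2 = - 1 imply
L_V I_3 = 0 by a computation with matrices (deriv_twist), and so L_V g_N = 0. *)

Local Open Scope classical_set_scope.
Local Open Scope ring_scope.
Local Open Scope complex_scope.

Local Notation Re := complex.Re.
Local Notation Im := complex.Im.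
Local Notation normc := ComplexField.Normc.normc.
Local Notation ii := (Complex 0 1).

(** * Directional derivatives with prescribed values *)
Section Derivatives.
Variable R : realType.
Implicit Types V W U : normedModType R.

(** Differentiability together with all the values of the differential: the
form in which Lie derivatives are computed. *)
Definition is_der V W (f : V -> W) (x : V) (df : V -> W) : Prop :=
  differentiable f x /\ forall v, 'D_v f x = df v.

Lemma is_der_diff V W (f : V -> W) x df : is_der f x df -> 'd f x = df :> (V -> W).
Proof. by case=> fx fE; apply/funext => v; rewrite -fE deriveE. Qed.

Lemma is_diff_der V W (f : V -> W) x df : is_diff x f df -> is_der f x df.
Proof. by move=> fx; split=> // v; rewrite deriveE // diff_val. Qed.

Lemma is_der_is_diff V W (f : V -> W) x df : is_der f x df -> is_diff x f df.
Proof. by move=> fx; apply: DiffDef; [case: fx | exact: is_der_diff]. Qed.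

Lemma differentiable_der V W (f : V -> W) x :
  differentiable f x -> is_der f x (fun v => 'D_v f x).
Proof. by []. Qed.

Lemma is_der_unique V W (f : V -> W) x df dg :
  is_der f x df -> is_der f x dg -> df = dg.
Proof. by move=> [_ hf] [_ hg]; apply/funext => v; rewrite -hf -hg. Qed.

Lemma is_der_eqd V W (f : V -> W) x df dg :
  is_der f x df -> (forall v, df v = dg v) -> is_der f x dg.
Proof. by move=> [h1 h2] e; split=> // v; rewrite h2. Qed.

Lemma is_der_linear V W (f : V -> W) x df : is_der f x df ->
  [/\ forall u v, df (u + v) = df u + df v, forall (c : R) u, df (c *: u) = c *: df u
    & exists2 L : R, 0 < L & forall u, `|df u| <= L * `|u|].
Proof.
move=> fx; rewrite -(is_der_diff fx); split=> [u v|c u|].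
- by rewrite linearD.
- by rewrite linearZ.
- by apply: linear_lipschitz; apply: diff_continuous; case: fx.
Qed.

Lemma is_der_eps V W (f : V -> W) x df :
  (forall u v, df (u + v) = df u + df v) ->
  (forall (c : R) u, df (c *: u) = c *: df u) ->
  (exists L : R, forall u, `|df u| <= L * `|u|) ->
  (forall e : R, 0 < e ->
     \forall h \near (0 : V), `|f (h + x) - f x - df h| <= e * `|h|) ->
  is_der f x df.
Proof.
move=> dfD dfZ [L dfL] feps.
have dflin : linear df by move=> c u v; rewrite dfD dfZ.
pose dfM := GRing.isLinear.Build _ _ _ _ _ dflin.
pose dfl : {linear V -> W} := HB.pack df dfM.
have dfc : continuous dfl.
  apply: (@bounded_linear_continuous R V W dfl).
  apply/linear_boundedP; near=> r => u.
  apply: le_trans (dfL u) _; rewrite ler_wpM2r //.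
have fE : f \o shift x = cst (f x) + dfl +o_ 0 id.
  apply/eqaddoP => e e0; move: (feps e e0); apply: filterS => h.
  by rewrite /= opprD addrA.
have dE : 'd f x = dfl :> (V -> W) by apply: diff_unique.
have dd : differentiable f x by apply/diff_locallyP; rewrite dE.
by split=> // v; rewrite deriveE // dE.
Unshelve. all: by end_near. Qed.

Lemma differentiable_eps V W (f : V -> W) x df : is_der f x df ->
  forall e : R, 0 < e ->
     \forall h \near (0 : V), `|f (h + x) - f x - df h| <= e * `|h|.
Proof.
move=> fx e e0; have := diff_locally (proj1 fx); rewrite (is_der_diff fx).
move=> /eqaddoP /(_ e e0); apply: filterS => h.
by rewrite /= opprD addrA.
Qed.

Lemma is_der_near V W (f g : V -> W) x df :
  (\forall y \near x, f y = g y) -> is_der f x df -> is_der g x df.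
Proof.
move=> fg fx; have [dfD dfZ [L _ dfL]] := is_der_linear fx.
apply: is_der_eps => //; first by exists L.
move=> e e0; have := differentiable_eps fx e0.
have : \forall h \near (0 : V), f (h + x) = g (h + x).
  by move: fg; rewrite (near_shift 0 x) subr0.
apply: filterS2 => h -> //.
by rewrite (nbhs_singleton fg).
Qed.

Lemma is_der_cst V W (a : W) (x : V) : is_der (fun _ => a) x (fun _ => 0).
Proof. exact: (@is_diff_der _ _ (cst a) x 0). Qed.

Lemma is_derD V W (f g : V -> W) x df dg : is_der f x df -> is_der g x dg ->
  is_der (fun z => f z + g z) x (fun v => df v + dg v).
Proof.
move=> /is_der_is_diff fx /is_der_is_diff gx.
exact: (@is_diff_der _ _ (f + g) x (df + dg)).
Qed.

Lemma is_derN V W (f : V -> W) x df : is_der f x df ->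
  is_der (fun z => - f z) x (fun v => - df v).
Proof.
by move=> /is_der_is_diff fx; exact: (@is_diff_der _ _ (- f) x (- df)).
Qed.

Lemma is_derB V W (f g : V -> W) x df dg : is_der f x df -> is_der g x dg ->
  is_der (fun z => f z - g z) x (fun v => df v - dg v).
Proof. by move=> fx gx; apply: is_derD => //; apply: is_derN. Qed.

Lemma is_derZ V W (c : R) (f : V -> W) x df : is_der f x df ->
  is_der (fun z => c *: f z) x (fun v => c *: df v).
Proof.
by move=> /is_der_is_diff fx; exact: (@is_diff_der _ _ (c *: f) x (c *: df)).
Qed.

Lemma is_derM V (f g : V -> R) x df dg : is_der f x df -> is_der g x dg ->
  is_der (fun z => f z * g z) x (fun v => df v * g x + f x * dg v).
Proof.
move=> /is_der_is_diff fx /is_der_is_diff gx.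
apply: is_der_eqd; first exact: (@is_diff_der _ _ (f * g) x (f x *: dg + g x *: df)).
move=> v; rewrite [RHS]addrC [df v * _]mulrC.
by [].
Qed.

Lemma is_der_sum V W (I : eqType) (s : seq I) (f : I -> V -> W) x df :
  (forall i, i \in s -> is_der (f i) x (df i)) ->
  is_der (fun z => \sum_(i <- s) f i z) x (fun v => \sum_(i <- s) df i v).
Proof.
elim: s => [_|i s IH h].
  apply: (is_der_near (f := fun _ => 0)); first by near=> y; rewrite big_nil.
  by apply: is_der_eqd; [exact: is_der_cst | move=> v; rewrite big_nil].
apply: (is_der_near (f := fun z => f i z + \sum_(j <- s) f j z)).
  by near=> y; rewrite big_cons.
by apply: is_der_eqd; [apply: is_derD (h i _) (IH _) | move=> v; rewrite big_cons] => //;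
  [rewrite mem_head | move=> j js; apply: h; rewrite in_cons js orbT].
Unshelve. all: by end_near. Qed.

Lemma is_der_comp U V W (g : V -> W) (f : U -> V) x df dg :
  is_der f x df -> is_der g (f x) dg ->
  is_der (fun z => g (f z)) x (fun v => dg (df v)).
Proof.
move=> /is_der_is_diff fx /is_der_is_diff gx.
exact: (@is_diff_der _ _ (g \o f) x (dg \o df)).
Qed.

Lemma is_der_lin V W (f : V -> W) (L : R) x :
  (forall u v, f (u + v) = f u + f v) -> (forall (c : R) u, f (c *: u) = c *: f u) ->
  (forall u, `|f u| <= L * `|u|) -> is_der f x f.
Proof.
move=> fD fZ fL; apply: is_der_eps => //; first by exists L.
move=> e e0; near=> h.
by rewrite fD addrK subrr normr0 mulr_ge0 // ltW.
Unshelve. all: by end_near. Qed.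

Lemma mx_entry_norm m n (A : 'M[R]_(m, n)) i j : `|A i j| <= `|A|.
Proof. rewrite [leRHS]/Num.Def.normr/= mx_normrE; exact: (le_bigmax _ _ (i, j)). Qed.

Lemma is_der_entry V m n (f : V -> 'M[R]_(m, n)) x df i j :
  is_der f x df -> is_der (fun z => f z i j) x (fun v => df v i j).
Proof.
move=> fx; apply: (is_der_comp (g := fun A : 'M[R]_(m, n) => A i j)
  (dg := fun A : 'M[R]_(m, n) => A i j) fx).
apply: (@is_der_lin _ _ _ 1) => [u v|c u|u]; rewrite ?mxE // mul1r.
exact: mx_entry_norm.
Qed.

(** A matrix is the sum of its entries times the elementary matrices, so
entrywise differentiability suffices. *)
Lemma is_der_mx V m n (f : V -> 'M[R]_(m, n)) x (df : V -> 'M[R]_(m, n)) :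
  (forall i j, is_der (fun z => f z i j) x (fun v => df v i j)) -> is_der f x df.
Proof.
move=> h.
apply: (is_der_near (f := fun z => \sum_i \sum_j f z i j *: delta_mx i j)).
  by near=> y; rewrite -matrix_sum_delta.
apply: (@is_der_eqd _ _ _ _ (fun v => \sum_i \sum_j df v i j *: delta_mx i j)).
  apply: is_der_sum => i _; apply: is_der_sum => j _.
  have /is_der_is_diff hij := h i j.
  apply: is_diff_der; apply: DiffDef; first exact: differentiableZl.
  by rewrite diffZl // diff_val.
by move=> v; rewrite -matrix_sum_delta.
Unshelve. all: by end_near. Qed.

Lemma is_der_mul V m n p (f : V -> 'M[R]_(m, n)) (g : V -> 'M[R]_(n, p)) x df dg :
  is_der f x df -> is_der g x dg ->
  is_der (fun z => f z *m g z) x (fun v => df v *m g x + f x *m dg v).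
Proof.
move=> fx gx; apply: is_der_mx => i j.
apply: (is_der_near (f := fun z => \sum_k f z i k * g z k j)).
  by near=> y; rewrite mxE.
apply: is_der_eqd.
  apply: is_der_sum => k _; exact: is_derM (is_der_entry i k fx) (is_der_entry k j gx).
by move=> v; rewrite !mxE -big_split.
Unshelve. all: by end_near. Qed.

Lemma is_der_trmx V m n (f : V -> 'M[R]_(m, n)) x df :
  is_der f x df -> is_der (fun z => (f z)^T) x (fun v => (df v)^T).
Proof.
move=> fx; apply: is_der_mx => i j.
apply: (is_der_near (f := fun z => f z j i)); first by near=> y; rewrite mxE.
by apply: is_der_eqd; [exact: (is_der_entry j i fx) | move=> v; rewrite mxE].
Unshelve. all: by end_near. Qed.

Lemma is_derV V (f : V -> R) x df : is_der f x df -> f x != 0 ->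
  is_der (fun z => (f z)^-1) x (fun v => - (f x)^-2 * df v).
Proof.
move=> [fx fE] fn; apply: is_diff_der; apply: DiffDef.
  exact: differentiableV.
by rewrite diffV //; apply/funext => v /=; rewrite -fE deriveE.
Qed.

Lemma is_der_lip V W (f : V -> W) x df : is_der f x df ->
  exists2 C : R, 0 < C & \forall z \near x, `|f z - f x| <= C * `|z - x|.
Proof.
move=> fx; have [_ _ [L L0 dfL]] := is_der_linear fx.
exists (1 + L); first by rewrite addr_gt0.
rewrite (near_shift 0 x) subr0.
apply: filterS (differentiable_eps fx ltr01) => h /=.
rewrite mul1r addrK => hh.
rewrite -[f _ - _](subrK (df h)) mulrDl mul1r.
by apply: le_trans (ler_normD _ _) _; rewrite lerD.
Qed.

End Derivatives.
(** * Summation functionals and termwise differentiation *)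
Section Summation.
Variable R : realType.

Lemma ler_eps_add (a b : R) : (forall e, 0 < e -> a <= b + e) -> a <= b.
Proof. by move=> h; apply/ler_addgt0Pr => e e0; exact: h. Qed.

Lemma eqr_eps (a b : R) (c : R) : (forall e, 0 < e -> `|a - b| <= c * e) -> a = b.
Proof.
move=> h; apply/eqP; rewrite -subr_eq0 -normr_le0; apply: ler_eps_add => e e0.
rewrite add0r; have c0 : 0 <= c by have := h 1 ltr01; rewrite mulr1; apply: le_trans.
have c1 : 0 < c + 1 by rewrite ltr_wpDl.
apply: le_trans (h (e / (c + 1)) _) _; first by rewrite divr_gt0.
by rewrite mulrA ler_pdivrMr // mulrDr mulr1 mulrC lerDl ltW.
Qed.

Section Functional.
Variables (I : choiceType) (S : set I).
Implicit Types (sm : (I -> R) -> R) (m f g : I -> R).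

(** The two infinite sums at stake, over the natural numbers and over a subset
of the lattice, are only used through this property: uniformly over the families
bounded by C m, the sum is approximated by one finite partial sum.  All limit
arguments are thereby made once for both. *)
Definition summing sm m : Prop :=
  (forall i, S i -> 0 <= m i) /\
  forall C e : R, 0 < e -> exists2 F : seq I, (forall i, i \in F -> S i) &
    forall f, (forall i, S i -> `|f i| <= C * m i) ->
      `|sm f - \sum_(i <- F) f i| <= e.

Variables (sm : (I -> R) -> R) (m : I -> R).
Hypothesis smP : summing sm m.

Definition dominated f : Prop := exists C : R, forall i, S i -> `|f i| <= C * m i.

Lemma dominated_lin a b f g : dominated f -> dominated g ->
  dominated (fun i => a * f i + b * g i).
Proof.
move=> [C1 h1] [C2 h2]; exists (`|a| * C1 + `|b| * C2) => i Si.
rewrite mulrDl -!mulrA; apply: le_trans (ler_normD _ _) _.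
by rewrite !normrM lerD // ler_wpM2l // ?h1 // h2.
Qed.

(** The three families f, h and their combination share a finite set F on which
their sums are nearly attained, and finite sums are linear. *)
Lemma sm_lin a b f g : dominated f -> dominated g ->
  sm (fun i => a * f i + b * g i) = a * sm f + b * sm g.
Proof.
move=> [C1 h1] [C2 h2]; have [m0 sm0] := smP.
set h := fun i => _.
have [C3 h3] : dominated h by apply: dominated_lin; [exists C1 | exists C2].
pose C := Num.max C1 (Num.max C2 C3).
have domC f' C' : C' <= C -> (forall i, S i -> `|f' i| <= C' * m i) ->
    forall i, S i -> `|f' i| <= C * m i.
  by move=> CC hf i Si; apply: le_trans (hf i Si) _; rewrite ler_wpM2r // m0.
apply: (@eqr_eps _ _ (1 + `|a| + `|b|)) => e e0.
have [F FS FE] := sm0 C e e0.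
have e1 := FE f (domC f C1 _ h1).
have e2 := FE g (domC g C2 _ h2).
have e3 := FE h (domC h C3 _ h3).
have -> : sm h - (a * sm f + b * sm g) = (sm h - \sum_(i <- F) h i)
     - a * (sm f - \sum_(i <- F) f i) - b * (sm g - \sum_(i <- F) g i).
  have -> : \sum_(i <- F) h i = a * \sum_(i <- F) f i + b * \sum_(i <- F) g i.
    by rewrite !mulr_sumr -big_split.
  by ring.
apply: le_trans (ler_normB _ _) _; rewrite mulrDl normrM lerD //; last first.
  by rewrite ler_wpM2l // e2 // /C !le_max lexx orbT.
apply: le_trans (ler_normB _ _) _; rewrite mulrDl normrM mul1r lerD //.
  by rewrite e3 // /C !le_max lexx !orbT.
by rewrite ler_wpM2l // e1 // /C !le_max lexx.
Qed.

Lemma sm_ext f g : dominated f -> (forall i, S i -> f i = g i) -> sm f = sm g.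
Proof.
move=> [C hC] fg; have [m0 sm0] := smP.
apply: (@eqr_eps _ _ 2) => e e0; have [F FS FE] := sm0 C e e0.
have hf := FE f hC.
have fgE : \sum_(i <- F) f i = \sum_(i <- F) g i.
  by rewrite big_seq [RHS]big_seq; apply: eq_bigr => i iF; rewrite fg //; exact: FS.
have hg : `|sm g - \sum_(i <- F) f i| <= e.
  by rewrite fgE FE // => i Si; rewrite -fg // hC.
rewrite (_ : sm f - sm g = (sm f - \sum_(i <- F) f i) - (sm g - \sum_(i <- F) f i)).
  by apply: le_trans (ler_normB _ _) _; rewrite mulr_natl mulr2n lerD.
by ring.
Qed.

Lemma sm_bound C f : (forall i, S i -> `|f i| <= C * m i) -> `|sm f| <= C * sm m.
Proof.
move=> hC; have [m0 sm0] := smP; apply: ler_eps_add => e e0.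
have C1 : 0 < `|C| + 1 by rewrite ltr_wpDl.
pose e' := e / 2 / (`|C| + 1).
have e'0 : 0 < e' by rewrite !divr_gt0.
have [F FS FE] := sm0 (Num.max C 1) e' e'0.
have hle f' C' : C' <= Num.max C 1 -> (forall i, S i -> `|f' i| <= C' * m i) ->
    `|sm f' - \sum_(i <- F) f' i| <= e'.
  by move=> CC hf; apply: FE => i Si; apply: le_trans (hf i Si) _; rewrite ler_wpM2r // m0.
have e1 := hle f C (ltac:(by rewrite le_max lexx)) hC.
have e2 : `|sm m - \sum_(i <- F) m i| <= e'.
  apply: (hle m 1); first by rewrite le_max lexx orbT.
  by move=> i Si; rewrite mul1r ger0_norm // m0.
have e3 : `|\sum_(i <- F) f i| <= C * \sum_(i <- F) m i.
  rewrite mulr_sumr; apply: le_trans (ler_norm_sum _ _ _) _.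
  by rewrite big_seq [leRHS]big_seq; apply: ler_sum => i iF; apply/hC/FS.
have e4 : C * \sum_(i <- F) m i <= C * sm m + `|C| * e'.
  rewrite -lerBlDl -mulrBr; apply: le_trans (ler_norm _) _.
  by rewrite normrM distrC ler_wpM2l.
rewrite -(subrK (\sum_(i <- F) f i) (sm f)); apply: le_trans (ler_normD _ _) _.
apply: le_trans (lerD e1 (le_trans e3 e4)) _.
have e5 : (`|C| + 1) * e' = e / 2 by rewrite mulrC divfK // gt_eqF.
by move: e5 e0; rewrite mulrDl mul1r; lra.
Qed.

End Functional.
End Summation.

Section SumDer.
Variable R : realType.
Implicit Types V : normedModType R.

(** A Lipschitz estimate at x along t v, as t tends to 0, passes to the
differential. *)
Lemma is_der_bound V (f : V -> R) x df (L : R) : is_der f x df -> 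
  (\forall z \near x, `|f z - f x| <= L * `|z - x|) ->
  forall v, `|df v| <= L * `|v|.
Proof.
move=> fx fL v; have [_ dfZ _] := is_der_linear fx.
have [->|v0] := eqVneq v 0.
  by have := dfZ 0 0; rewrite !scale0r => ->; rewrite !normr0 mulr0.
have hv : forall e : R, 0 < e -> `|df v| <= (L + e) * `|v|.
  move=> e e0.
  have nf : \forall h \near (0 : V), `|df h| <= (L + e) * `|h|.
    move: fL; rewrite (near_shift 0 x) subr0 => fL.
    apply: filterS2 fL (differentiable_eps fx e0) => h /=; rewrite addrK => h1 h2.
    rewrite -[df h](subKr (f (h + x) - f x)) mulrDl.
    by apply: le_trans (ler_normB _ _) _; rewrite lerD.
  have : \forall t \near (0 : R), `|df (t *: v)| <= (L + e) * `|t *: v|.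
    have cv : (fun t : R => t *: v) t @[t --> (0 : R)] --> (0 : V).
      by rewrite -[X in _ --> X](scale0r v); apply: scalel_continuous.
    exact: (cv _ nf).
  move=> /nbhs_ballP [d /= d0 dP].
  have := dP (d / 2); rewrite /ball /= sub0r normrN gtr0_norm ?divr_gt0 //.
  rewrite ltr_pdivrMr // mulr_natr mulr2n ltrDl d0 => /(_ isT).
  have d2 : 0 < `|d / 2| by rewrite normr_gt0 gt_eqF // divr_gt0.
  by rewrite dfZ !(normrZ (d / 2)) mulrCA ler_pM2l.
apply: ler_eps_add => e e0.
apply: le_trans (hv (e / `|v|) _) _; first by rewrite divr_gt0 // normr_gt0.
by rewrite mulrDl divfK // normr_eq0.
Qed.

Section Ctl.
Variables (V : normedModType R) (x : V).

(** Differentiable families whose values, and whose Lipschitz constants at x,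
are bounded by a constant times the weights m, on one neighbourhood of x for all
indices.  The Lipschitz form is closed under products and compositions, and
gives termwise differentiation without second derivatives. *)
Definition ctl (I : Type) (S : set I) (m : I -> R) (f : I -> V -> R) (df : I -> V -> R) :=
  exists C : R, [/\ 0 <= C,
    forall i, S i -> is_der (f i) x (df i),
    forall i, S i -> `|f i x| <= C * m i &
    \forall z \near x, forall i, S i -> `|f i z - f i x| <= C * m i * `|z - x|].

Lemma ctl_der I (S : set I) m f df : ctl S m f df ->
  exists2 C : R, 0 <= C & forall i v, S i -> `|df i v| <= C * m i * `|v|.
Proof.
move=> [C [C0 h1 h2 h3]]; exists C => // i v Si.
by apply: (is_der_bound (h1 i Si)); apply: filterS h3 => z /(_ i Si).
Qed.

(** The error term of the sum splits into that of a finite partial sum, which is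
o(h), and the sum of the quotients by |h| outside of it.  The latter are bounded
by the weights uniformly in h, hence small by the choice of the finite set. *)
Lemma sm_der (I : choiceType) (S : set I) sm m f df : summing S sm m -> ctl S m f df ->
  is_der (fun z => sm (f^~ z)) x (fun v => sm (df^~ v)).
Proof.
move=> smP fC; have [m0 sm0] := smP; have [C [C0 h1 h2 h3]] := fC.
have [D D0 hD] := ctl_der fC.
have domd v : dominated S m (df^~ v).
  exists (D * `|v|) => i Si; apply: le_trans (hD i v Si) _.
  by rewrite -!mulrA ler_wpM2l // mulrC.
have domf z : (forall i, S i -> `|f i z - f i x| <= C * m i * `|z - x|) ->
    dominated S m (f^~ z).
  move=> hz; exists (C * `|z - x| + C) => i Si; rewrite -[f i z](subrK (f i x)).
  apply: le_trans (ler_normD _ _) _; rewrite mulrDl; apply: lerD; last exact: h2.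
  by apply: le_trans (hz i Si) _; rewrite -!mulrA ler_wpM2l // mulrC.
have domx : dominated S m (f^~ x) by exists C => i Si; exact: h2.
apply: is_der_eps.
- move=> u v; rewrite -[sm (df^~ u)]mul1r -[sm (df^~ v)]mul1r -(sm_lin smP) //.
  apply: (sm_ext smP); first exact: domd.
  by move=> i Si; have [-> _ _] := is_der_linear (h1 i Si); rewrite !mul1r.
- move=> c u; rewrite -[RHS]addr0 -[X in _ = _ + X](mul0r (sm (df^~ u))).
  rewrite -(sm_lin smP) //; apply: (sm_ext smP); first exact: domd.
  by move=> i Si; have [_ -> _] := is_der_linear (h1 i Si); rewrite mul0r addr0.
- exists (D * sm m) => u; rewrite mulrAC; apply: (sm_bound smP) => i Si.
  by rewrite mulrAC; exact: hD.
- move=> e e0; have e2 : 0 < e / 2 by rewrite divr_gt0.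
  have [F FS FE] := sm0 (C + D) (e / 2) e2.
  have dF : is_der (fun z => \sum_(i <- F) f i z) x (fun v => \sum_(i <- F) df i v).
    by apply: is_der_sum => i iF; apply/h1/FS.
  have nF := differentiable_eps dF e2.
  move: h3; rewrite (near_shift 0 x) subr0 => h3.
  apply: filterS2 nF h3 => h /= hF hx.
  have [->|h0] := eqVneq h 0.
    rewrite normr0 mulr0 add0r subrr sub0r normrN.
    rewrite (sm_ext smP (g := fun i => 0 * f i x + 0 * f i x)); last first.
    - move=> i Si; have [_ dZ _] := is_der_linear (h1 i Si).
      by have := dZ 0 0; rewrite !scale0r => ->; rewrite !mul0r addr0.
    - exact: domd.
    by rewrite (sm_lin smP) // !mul0r addr0 normr0.
  have nh : 0 < `|h| by rewrite normr_gt0.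
  have rE : sm (f^~ (h + x)) - sm (f^~ x) - sm (df^~ h) = 
      sm (fun i => f i (h + x) - f i x - df i h).
    transitivity (1 * sm (fun i => 1 * f i (h + x) + (-1) * f i x) + (-1) * sm (df^~ h)).
      rewrite (sm_lin smP) //; first by ring.
      exact: domf.
    rewrite -(sm_lin smP) //; last by apply: dominated_lin => //; apply: domf.
    congr (sm _); apply/funext => i; ring.
  have hb i : S i -> `|f i (h + x) - f i x - df i h| <= (C + D) * m i * `|h|.
    move=> Si; apply: le_trans (ler_normB _ _) _; rewrite mulrDl mulrDl; apply: lerD.
      by have := hx i Si; rewrite addrK.
    exact: hD.
  have := FE (fun i => `|h|^-1 * (f i (h + x) - f i x - df i h)
                     + 0 * (f i (h + x) - f i x - df i h)).
  rewrite (sm_lin smP); first last.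
  - by exists ((C + D) * `|h|) => i Si; rewrite mulrAC; apply: hb.
  - by exists ((C + D) * `|h|) => i Si; rewrite mulrAC; apply: hb.
  rewrite big_split /= -!mulr_sumr !mul0r !addr0 -mulrBr => hh.
  have {}hh : `|sm (fun i => f i (h + x) - f i x - df i h)
       - \sum_(i <- F) (f i (h + x) - f i x - df i h)| <= e / 2 * `|h|.
    have : forall i, S i -> `| `|h|^-1 * (f i (h + x) - f i x - df i h)
        + 0 * (f i (h + x) - f i x - df i h)| <= (C + D) * m i.
      move=> i Si; rewrite mul0r addr0 normrM normfV normr_id ler_pdivrMl // mulrC.
      exact: hb.
    move=> /hh; rewrite normrM normfV normr_id ler_pdivrMl //.
    by rewrite mulrC.
  rewrite rE -[X in `|X|](subrK (\sum_(i <- F) (f i (h + x) - f i x - df i h))).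
  apply: le_trans (ler_normD _ _) _.
  rewrite [X in X * _](splitr e) mulrDl lerD //.
  by rewrite !sumrB.
Qed.

Section Algebra.
Variables (I : Type) (S : set I).
Implicit Types (m : I -> R) (f df : I -> V -> R).

Lemma ctl_near m f g df : (\forall z \near x, forall i, S i -> f i z = g i z) ->
  ctl S m f df -> ctl S m g df.
Proof.
move=> fg [C [C0 h1 h2 h3]]; exists C; have fgx := nbhs_singleton fg.
split=> // [i Si|i Si|].
- apply: is_der_near (h1 i Si); by apply: filterS fg => z /(_ i Si).
- by rewrite -fgx // h2.
- by apply: filterS2 fg h3 => z hz hz' i Si; rewrite -hz // -fgx // hz'.
Qed.

Lemma ctl_eqd m f df dg : ctl S m f df -> (forall i v, S i -> df i v = dg i v) ->
  ctl S m f dg.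
Proof.
move=> [C [C0 h1 h2 h3]] dfg; exists C; split=> // i Si.
by apply: is_der_eqd (h1 i Si) _ => v; rewrite dfg.
Qed.

Lemma ctl_le m m' f df (c : R) : 0 <= c -> (forall i, S i -> m i <= c * m' i) ->
  ctl S m f df -> ctl S m' f df.
Proof.
move=> c0 mm [C [C0 h1 h2 h3]]; exists (C * c); split=> //.
- by rewrite mulr_ge0.
- by move=> i Si; apply: le_trans (h2 i Si) _; rewrite -mulrA ler_wpM2l // mm.
- apply: filterS h3 => z hz i Si; apply: le_trans (hz i Si) _.
  by rewrite ler_wpM2r // -mulrA ler_wpM2l // mm.
Qed.

Lemma ctlD m f g df dg : (forall i, S i -> 0 <= m i) ->
  ctl S m f df -> ctl S m g dg ->
  ctl S m (fun i z => f i z + g i z) (fun i v => df i v + dg i v).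
Proof.
move=> m0 [C [C0 h1 h2 h3]] [D [D0 k1 k2 k3]]; exists (C + D); split.
- by rewrite addr_ge0.
- by move=> i Si; apply: is_derD; [apply: h1 | apply: k1].
- move=> i Si; apply: le_trans (ler_normD _ _) _; rewrite mulrDl.
  by apply: lerD; [apply: h2 | apply: k2].
- apply: filterS2 h3 k3 => z hz kz i Si; rewrite opprD addrACA.
  apply: le_trans (ler_normD _ _) _; rewrite !mulrDl.
  by apply: lerD; [apply: hz | apply: kz].
Qed.

Lemma ctlN m f df : ctl S m f df -> ctl S m (fun i z => - f i z) (fun i v => - df i v).
Proof.
move=> [C [C0 h1 h2 h3]]; exists C; split=> //.
- by move=> i Si; apply: is_derN; apply: h1.
- by move=> i Si; rewrite normrN h2.
- by apply: filterS h3 => z hz i Si; rewrite -opprD normrN hz.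
Qed.

Lemma ctlB m f g df dg : (forall i, S i -> 0 <= m i) ->
  ctl S m f df -> ctl S m g dg ->
  ctl S m (fun i z => f i z - g i z) (fun i v => df i v - dg i v).
Proof. by move=> m0 hf hg; apply: ctlD => //; apply: ctlN. Qed.

(** The product of the two increments is quadratic in |z - x|; it is absorbed on
the unit ball, where |z - x| ^ 2 <= |z - x|. *)
Lemma ctlM m m' f g df dg : (forall i, S i -> 0 <= m i) -> (forall i, S i -> 0 <= m' i) ->
  ctl S m f df -> ctl S m' g dg ->
  ctl S (fun i => m i * m' i) (fun i z => f i z * g i z)
    (fun i v => df i v * g i x + f i x * dg i v).
Proof.
move=> m0 m0' [C [C0 h1 h2 h3]] [D [D0 k1 k2 k3]]; exists (3 * (C * D)); split.
- by rewrite mulr_ge0 // mulr_ge0.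
- by move=> i Si; apply: is_derM; [apply: h1 | apply: k1].
- move=> i Si; rewrite normrM.
  apply: (@le_trans _ _ ((C * m i) * (D * m' i))).
    by apply: ler_pM; rewrite // ?h2 ?k2.
  have : 0 <= C * m i * (D * m' i) by rewrite !mulr_ge0 // ?m0 ?m0'.
  by nra.
- have near1 : \forall z \near x, `|z - x| <= 1.
    apply: filterS (nbhsx_ballx x 1 ltr01) => z; rewrite -ball_normE /= distrC.
    exact: ltW.
  apply: filterS3 near1 h3 k3 => z z1 hz kz i Si.
  have -> : f i z * g i z - f i x * g i x =
     f i x * (g i z - g i x) + (f i z - f i x) * (g i x)
     + (f i z - f i x) * (g i z - g i x) by ring.
  have Cm : 0 <= C * m i by rewrite mulr_ge0 // m0.
  have Dm : 0 <= D * m' i by rewrite mulr_ge0 // m0'.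
  have n0 := normr_ge0 (z - x).
  have a1 := h2 i Si; have a2 := k2 i Si; have a3 := hz i Si; have a4 := kz i Si.
  apply: (@le_trans _ _ (3 * ((C * m i) * (D * m' i) * `|z - x|))); last first.
    by rewrite le_eqVlt; apply/orP; left; apply/eqP; ring.
  have b1 : `|f i x * (g i z - g i x)| <= (C * m i) * ((D * m' i) * `|z - x|).
    by rewrite normrM ler_pM.
  have b2 : `|(f i z - f i x) * g i x| <= (C * m i * `|z - x|) * (D * m' i).
    by rewrite normrM ler_pM.
  have b3 : `|(f i z - f i x) * (g i z - g i x)|
      <= (C * m i * `|z - x|) * (D * m' i).
    rewrite normrM ler_pM //; apply: le_trans a4 _.
    by rewrite -[leRHS]mulr1 ler_wpM2l.
  apply: le_trans (ler_normD _ _) _.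
  apply: le_trans (lerD (ler_normD _ _) (lexx _)) _.
  by rewrite mulrA in b1 *; lra.
Qed.

Lemma ctl_cst (f df : V -> R) : is_der f x df ->
  ctl S (fun _ => 1) (fun _ => f) (fun _ => df).
Proof.
move=> fx; have [C C0 hC] := is_der_lip fx; exists (C + `|f x|); split=> //.
- by rewrite addr_ge0 // ltW.
- by move=> i Si; rewrite mulr1 lerDr ltW.
- apply: filterS hC => z hz i Si; apply: le_trans hz _; rewrite mulr1.
  by rewrite ler_wpM2r // lerDl.
Qed.

Lemma ctl_scalar m (a : I -> R) : (forall i, S i -> `|a i| <= m i) ->
  ctl S m (fun i _ => a i) (fun _ _ => 0).
Proof.
move=> am; exists 1; split=> //.
- by move=> i Si; exact: is_der_cst.
- by move=> i Si; rewrite mul1r am.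
- near=> z => i Si; rewrite subrr normr0 mulr_ge0 //; rewrite mul1r.
  by apply: le_trans (am i Si).
Unshelve. all: by end_near. Qed.

Lemma ctl_sum m (J : eqType) (s : seq J) (f df : J -> I -> V -> R) :
  (forall i, S i -> 0 <= m i) -> (forall j, j \in s -> ctl S m (f j) (df j)) ->
  ctl S m (fun i z => \sum_(j <- s) f j i z) (fun i v => \sum_(j <- s) df j i v).
Proof.
move=> m0; elim: s => [_|j s IH h].
  apply: (ctl_near (f := fun _ _ => 0)); first by near=> z => i Si; rewrite big_nil.
  apply: ctl_eqd; first by apply: ctl_scalar => i Si; rewrite normr0 m0.
  by move=> i v Si; rewrite big_nil.
apply: (ctl_near (f := fun i z => f j i z + \sum_(k <- s) f k i z)).
  by near=> z => i Si; rewrite big_cons.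
apply: ctl_eqd.
  apply: ctlD => //; first by apply: h; rewrite mem_head.
  by apply: IH => k ks; apply: h; rewrite in_cons ks orbT.
by move=> i v Si; rewrite big_cons.
Unshelve. all: by end_near. Qed.

End Algebra.

(** For a double family with product weights, the inner sum is again a
controlled family: it serves to pass from the series over n > 0 to the sum over
the lattice. *)
Lemma ctl_inner (I : Type) (S : set I) (L : choiceType) (T : set L) sm (m : I -> R) q f df :
  summing T sm q -> (forall i, S i -> 0 <= m i) ->
  ctl (S `*` T) (fun p => m p.1 * q p.2) f df ->
  ctl S m (fun i z => sm (fun l => f (i, l) z)) (fun i v => sm (fun l => df (i, l) v)).
Proof.
move=> smP m0 [C [C0 h1 h2 h3]].
have dom i : S i -> dominated T q (fun l => f (i, l) x).
  by move=> Si; exists (C * m i) => l Tl; rewrite -mulrA; apply: (h2 (i, l)).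
have dom' z : (forall p, (S `*` T) p -> `|f p z - f p x| <= C * (m p.1 * q p.2) * `|z - x|) ->
    forall i, S i -> dominated T q (fun l => f (i, l) z).
  move=> hz i Si; exists (C * m i * `|z - x| + C * m i) => l Tl.
  rewrite -[f _ z](subrK (f (i, l) x)).
  apply: le_trans (ler_normD _ _) _; rewrite mulrDl; apply: lerD.
    rewrite (_ : _ * q l = C * (m i * q l) * `|z - x|); first exact: (hz (i, l)).
    by ring.
  by rewrite -mulrA; exact: (h2 (i, l)).
have sq0 : 0 <= sm q.
  have := sm_bound smP (C := 1) (f := q); rewrite mul1r => h.
  apply: le_trans (normr_ge0 _) (h _).
  by move=> l Tl; rewrite mul1r ger0_norm // (proj1 smP).
exists (C * sm q); split.
- by rewrite mulr_ge0.
- move=> i Si; apply: (@sm_der L T sm q (fun l => f (i, l)) (fun l => df (i, l)) smP).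
  exists (C * m i); split.
  + by rewrite mulr_ge0 // m0.
  + by move=> l Tl; apply: (h1 (i, l)).
  + by move=> l Tl; rewrite -mulrA; apply: (h2 (i, l)).
  + by apply: filterS h3 => z hz l Tl; rewrite -(mulrA C); apply: (hz (i, l)).
- move=> i Si; rewrite mulrAC; apply: (sm_bound smP) => l Tl.
  by rewrite -mulrA; apply: (h2 (i, l)).
- apply: filterS h3 => z hz i Si.
  rewrite -[sm (fun l => f (i, l) z)]mul1r -[X in _ - X]mul1r -mulNr.
  rewrite -(sm_lin smP); [|exact: dom'|exact: dom].
  rewrite (_ : C * sm q * _ * _ = C * m i * `|z - x| * sm q); last by ring.
  apply: (sm_bound smP) => l Tl.
  rewrite mul1r mulN1r; apply: le_trans (hz (i, l) _) _ => //=.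
  by rewrite le_eqVlt; apply/orP; left; apply/eqP; ring.
Qed.

End Ctl.
End SumDer.

(** * Series and sums over a countable support *)
Section Instances.
Variable R : realType.

Lemma summing_series (q : nat -> R) : (forall n, 0 <= q n) -> cvgn (series q) ->
  summing setT (fun f => limn (series f)) q.
Proof.
move=> q0 qc; split=> // C e e0.
pose C' : R := `|C| + 1; have C'0 : 0 < C' by rewrite ltr_wpDl.
have /cvgrPdist_le /(_ (e / C')) := qc.
rewrite divr_gt0 // => /(_ isT) [N _ hN].
exists (iota 0 N) => // f hf.
have hf' n : `|f n| <= C' * q n.
  apply: le_trans (hf n I) _; rewrite ler_wpM2r // /C'.
  by apply: le_trans (ler_norm _) _; rewrite lerDl.
have fc : cvgn (series f).
  apply: normed_cvg; apply: (series_le_cvg _ _ hf') => // [n|].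
    by rewrite mulr_ge0 // ltW.
  exact: (is_cvg_seriesZ (k := C') qc).
have -> : \sum_(i <- iota 0 N) f i = series f N.
  by rewrite /series /= /index_iota subn0.
have qN : limn (series q) - series q N <= e / C'.
  by apply: le_trans (ler_norm _) _; exact: (hN N (leqnn N)).
have hd n : (N <= n)%N -> `|series f n - series f N| <= e.
  move=> Nn; rewrite sub_series_geq //.
  apply: le_trans (ler_norm_sum _ _ _) _.
  apply: (@le_trans _ _ (C' * \sum_(N <= k < n) q k)).
    by rewrite mulr_sumr; apply: ler_sum.
  rewrite -sub_series_geq // mulrC -ler_pdivlMr //.
  apply: le_trans qN; rewrite lerD2r; apply: nondecreasing_cvgn_le => //.
  by apply: nondecreasing_series.
have hc : (fun n => series f n - series f N) @ \oo --> limn (series f) - series f N.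
  by apply: cvgB => //; exact: cvg_cst.
have hcn : (fun n => `|series f n - series f N|) @ \oo --> `|limn (series f) - series f N|.
  exact: cvg_norm hc.
rewrite -(cvg_lim _ hcn) //.
apply: limr_le; first by apply/cvg_ex; eexists; exact: hcn.
by exists N.
Qed.

Section Esum.
Variables (I : choiceType) (S : set I).

Lemma esum_natmul_lty (m : I -> R) (N : nat) : (forall i, S i -> 0 <= m i) ->
  (\esum_(i in S) (m i)%:E < +oo)%E -> (\esum_(i in S) (N%:R * m i)%:E < +oo)%E.
Proof.
move=> m0 mf; elim: N => [|N IH].
  by rewrite esum1 // => i Si; rewrite mul0r.
rewrite (eq_esum (b := fun i => ((N%:R * m i)%:E + (m i)%:E)%E)); last first.
  by move=> i Si; rewrite -EFinD -natr1 mulrDl mul1r.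
rewrite esumD; first by apply: lte_add_pinfty.
- by move=> i Si; rewrite lee_fin mulr_ge0 // m0.
- by move=> i Si; rewrite lee_fin m0.
Qed.

Lemma esum_scale_lty (m : I -> R) (C : R) : (forall i, S i -> 0 <= m i) ->
  (\esum_(i in S) (m i)%:E < +oo)%E -> (\esum_(i in S) (C * m i)%:E < +oo)%E.
Proof.
move=> m0 mf; pose N := (Num.truncn `|C|).+1.
apply: le_lt_trans (esum_natmul_lty N m0 mf).
apply: le_esum => i Si; rewrite lee_fin ler_wpM2r // ?m0 //.
apply: le_trans (ler_norm _) _; apply: ltW; rewrite /N.
exact: truncnS_gt.
Qed.

(** A finite set catching the sum of m up to e does so for every family
between 0 and m, because the tail is monotone. *)
Lemma esum_tail (m : I -> R) : (forall i, S i -> 0 <= m i) ->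
  (\esum_(i in S) (m i)%:E < +oo)%E -> forall e : R, 0 < e ->
  exists2 F : seq I, (forall i, i \in F -> S i) & 
   forall g : I -> R, (forall i, S i -> 0 <= g i <= m i) ->
    (\esum_(i in S) (g i)%:E \is a fin_num)%E /\
    `|fine (\esum_(i in S) (g i)%:E)%E - \sum_(i <- F) g i| <= e.
Proof.
move=> m0 mf e e0.
have fin g : (forall i, S i -> 0 <= g i <= m i) -> (\esum_(i in S) (g i)%:E \is a fin_num)%E.
  move=> hg; rewrite ge0_fin_numE; last first.
    by apply: esum_ge0 => i Si; rewrite lee_fin; have /andP[] := hg i Si.
  apply: le_lt_trans mf; apply: le_esum => i Si.
  by rewrite lee_fin; have /andP[] := hg i Si.
have mm i : S i -> 0 <= m i <= m i by move=> Si; rewrite m0 /=.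
have [_ [X [Xf XS] <-]] := ub_ereal_sup_adherent e0 (fin m mm).
rewrite -/(esum S (EFin \o m)) => hX.
exists (finmap.enum_fset (fset_set X)) => [i|g hg].
  by move=> iX; apply: XS; move: iX; rewrite in_fset_set // inE.
split; first exact: fin.
have key h : (forall i, S i -> 0 <= h i <= m i) ->
    (\esum_(i in S) (h i)%:E = (\sum_(i <- finmap.enum_fset (fset_set X)) h i)%:E
     + \esum_(i in S `&` ~` X) (h i)%:E)%E.
  move=> hh; have h0 i : S i -> (0 <= (h i)%:E)%E.
    by move=> Si; rewrite lee_fin; have /andP[] := hh i Si.
  rewrite (esumID X) // (setIidr XS); congr (_ + _)%E.
  rewrite esum_fset //; first by rewrite fsbig_finite // sumEFin.
  by move=> i; rewrite inE => /XS; exact: h0.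
have tail : (\esum_(i in S `&` ~` X) (m i)%:E <= e%:E)%E.
  move: hX; rewrite fsbig_finite //= sumEFin.
  have := key m mm; have := fin m mm.
  rewrite /comp; set T := esum _ _; set P := \sum_(i <- _) _.
  set U := esum (S `&` ~` X) _ => Tf TE.
  rewrite TE; case: U TE => [u||] TE.
  - by rewrite -!EFinD lte_fin lee_fin; lra.
  - by move: Tf; rewrite TE.
  - by move: Tf; rewrite TE.
rewrite (key g hg).
set P := \sum_(i <- _) _; set U := esum (S `&` ~` X) _.
have U0 : (0 <= U)%E.
  by apply: esum_ge0 => i [Si _]; rewrite lee_fin; have /andP[] := hg i Si.
have Ue : (U <= e%:E)%E.
  apply: le_trans tail; apply: le_esum => i [Si _].
  by rewrite lee_fin; have /andP[] := hg i Si.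
case: U U0 Ue => [u||] //=; rewrite !lee_fin => u0 ue.
by rewrite addrC addrK ger0_norm.
Qed.

(** The positive and the negative part of f are both bounded by the same
summable family, and each is treated by esum_tail. *)
Lemma summing_rsum (m : I -> R) : (forall i, S i -> 0 <= m i) ->
  (\esum_(i in S) (m i)%:E < +oo)%E -> summing S (@rsum R I S) m.
Proof.
move=> m0 mf; split=> // C e e0.
have C0 i : S i -> 0 <= `|C| * m i by move=> Si; rewrite mulr_ge0 // m0.
have e2 : 0 < e / 2 by rewrite divr_gt0.
have [F FS FE] := esum_tail C0 (esum_scale_lty `|C| m0 mf) e2.
exists F => // f hf.
have hf' i : S i -> `|f i| <= `|C| * m i.
  by move=> Si; apply: le_trans (hf i Si) _; rewrite ler_wpM2r ?m0 // ler_norm.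
pose fp i := Num.max (f i) 0; pose fn i := Num.max (- f i) 0.
have fpE : (EFin \o f)^\+%E = EFin \o fp.
  by apply/funext => i; rewrite funeposE /= /fp EFin_max.
have fnE : (EFin \o f)^\-%E = EFin \o fn.
  by apply/funext => i; rewrite funenegE /= /fn EFin_max EFinN.
have [pf pE] : _ /\ _ := FE fp (ltac:(move=> i Si; rewrite /fp le_max lexx orbT /= ge_max C0 // andbT;
   exact: le_trans (ler_norm _) (hf' i Si))).
have [nf nE] : _ /\ _ := FE fn (ltac:(move=> i Si; rewrite /fn le_max lexx orbT /= ge_max C0 // andbT;
   apply: le_trans (ler_norm _) _; rewrite normrN; exact: (hf' i Si))).
have -> : rsum S f = fine (\esum_(i in S) (fp i)%:E)%E - fine (\esum_(i in S) (fn i)%:E)%E.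
  by rewrite -fineB // /rsum fpE fnE.
have -> : \sum_(i <- F) f i = \sum_(i <- F) fp i - \sum_(i <- F) fn i.
  rewrite -sumrB; apply: eq_bigr => i _; rewrite /fp /fn.
  by case: (leP (f i) 0) => h; [rewrite max_l; lra | rewrite max_r; lra].
rewrite opprD opprK addrACA [e]splitr.
rewrite [X in `|_ + X|](_ : _ = - (fine (\esum_(i in S) (fn i)%:E)%E - \sum_(i <- F) fn i)); last by ring.
by apply: le_trans (ler_normB _ _) _; rewrite lerD.
Qed.

End Esum.
End Instances.

(** * Bounds and differentiability of the Bessel functions *)
Section Bessel.
Variable R : realType.
Implicit Types (s t x y e m : R) (nu : nat).
Local Notation mu := (@lebesgue_measure R).
Local Notation half_line := (`[0%R, +oo[%classic : set R).

Lemma rcosh_ge1 t : 1 <= rcosh t.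
Proof.
rewrite /rcosh ler_pdivlMr // mul1r expRN.
have e0 := expR_gt0 t; rewrite -subr_ge0.
have -> : expR t + (expR t)^-1 - 2 = (expR t - 1) ^+ 2 / expR t.
  by field; rewrite gt_eqF.
by rewrite divr_ge0 ?sqr_ge0 // ltW.
Qed.

Lemma rcosh_gt0 t : 0 < rcosh t.
Proof. exact: lt_le_trans (rcosh_ge1 t). Qed.

Lemma rcosh_ge_expR t : expR t / 2 <= rcosh t.
Proof. by rewrite /rcosh ler_pM2r ?invr_gt0 // lerDl expR_ge0. Qed.

Lemma rcosh_le nu t : (nu <= 1)%N -> rcosh (nu%:R * t) <= rcosh t.
Proof.
case: nu => [|[|//]] _; last by rewrite mul1r.
rewrite mul0r; apply: le_trans (rcosh_ge1 t).
by rewrite /rcosh oppr0 expR0 divff.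
Qed.

Lemma measurable_rcosh : measurable_fun [set: R] (@rcosh R).
Proof.
apply: measurable_realfun.measurable_funM => //; apply: measurable_realfun.measurable_funD => //.
exact: measurableT_comp.
Qed.

(** 3 ^ 3 comes from expRN_cube, and 2 ^ 4 = 2 ^ 3 * 2 from halving e and from
cosh t >= exp t / 2. *)
Definition decay_cst e : R := 3 ^+ 3 * 2 ^+ 4 / e ^+ 3.

Lemma decay_cst_ge0 e : 0 < e -> 0 <= decay_cst e.
Proof. by move=> e0; rewrite divr_ge0 ?mulr_ge0 ?exprn_ge0 // ltW. Qed.

(** The cube of s / 3 <= exp (s / 3).  A cube is needed to absorb the factor
cosh ^ 2 and keep one power of cosh for the convergence of the integral. *)
Lemma expRN_cube s : 0 < s -> expR (- s) <= 3 ^+ 3 / s ^+ 3.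
Proof.
move=> s0; have s3 : 0 < s / 3 by rewrite divr_gt0.
have -> : - s = 3%:R * (- (s / 3)) by rewrite mulrN mulrC divfK // lt0r_neq0.
rewrite expRM_natl expRN exprVn ler_pdivlMr ?exprn_gt0 // mulrC ler_pdivrMr ?exprn_gt0 ?expR_gt0 //.
have h : s / 3 <= expR (s / 3) by apply: le_trans (expR_ge1Dx _); rewrite lerDr.
have : (s / 3) ^+ 3 <= expR (s / 3) ^+ 3 by rewrite lerXn2r // nnegrE ltW // expR_gt0.
by rewrite expr_div_n ler_pdivrMr ?exprn_gt0 // mulrC.
Qed.

Lemma expR_rcosh_le e t : 0 < e -> 
  expR (- (e / 2) * rcosh t) * rcosh t ^+ 2 <= decay_cst e * expR (- t).
Proof.
move=> e0; have c0 := rcosh_gt0 t; set c := rcosh t in c0 *.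
have ec : 0 < e / 2 * c by rewrite mulr_gt0 // divr_gt0.
have h1 : expR (- (e / 2) * c) * c ^+ 2 <= 3 ^+ 3 / (e / 2 * c) ^+ 3 * c ^+ 2.
  by rewrite ler_pM2r ?exprn_gt0 // mulNr; exact: expRN_cube.
apply: le_trans h1 _.
have -> : 3 ^+ 3 / (e / 2 * c) ^+ 3 * c ^+ 2 = decay_cst e * (2 * c)^-1.
  by rewrite /decay_cst; field; rewrite !gt_eqF.
rewrite ler_wpM2l ?decay_cst_ge0 //; rewrite expRN lef_pV2 ?posrE ?expR_gt0 //; last exact: mulr_gt0.
by have := rcosh_ge_expR t; rewrite -/c; lra.
Qed.

(** One half of the exponent, with cosh t >= 1, gives the decay in m, and the
other half gives the integrability in t, uniformly for m >= e. *)
Lemma expR_rcosh_decay e m t : 0 < e -> e <= m ->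
  expR (- m * rcosh t) * rcosh t ^+ 2 <= expR (- m / 2) * (decay_cst e * expR (- t)).
Proof.
move=> e0 em; have c1 := rcosh_ge1 t; set c := rcosh t in c1 *.
have c2 : 0 < c ^+ 2 by rewrite exprn_gt0 // (lt_le_trans ltr01).
apply: (@le_trans _ _ (expR (- m / 2) * (expR (- (e / 2) * c) * c ^+ 2))).
  by rewrite mulrA ler_pM2r // -expRD ler_expR; nra.
by rewrite ler_pM2l ?expR_gt0 //; exact: expR_rcosh_le.
Qed.

Lemma integrable_expRN : mu.-integrable half_line (EFin \o (fun t => expR (- t))).
Proof.
have h := @integrable_exponential_pdf R 1 ltr01.
apply: (@eq_integrable _ _ _ mu half_line (measurable_itv _) (EFin \o exponential_pdf 1)).
- move=> t; rewrite inE /= in_itv /= andbT => t0.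
  by rewrite exponential_pdfE // mul1r mulN1r.
- by apply: integrableS h.
Qed.

Definition bessel_kernel nu x t : R := expR (- x * rcosh t) * rcosh (nu%:R * t).

Lemma measurable_bessel_kernel nu x : measurable_fun half_line (bessel_kernel nu x).
Proof.
apply: measurable_funTS; apply: measurable_realfun.measurable_funM.
  apply: measurableT_comp => //; apply: measurable_realfun.measurable_funM => //.
  exact: measurable_rcosh.
by apply: measurableT_comp; [exact: measurable_rcosh | apply: measurable_realfun.measurable_funM].
Qed.

Lemma bessel_kernel_ge0 nu x t : 0 <= bessel_kernel nu x t.
Proof. by rewrite mulr_ge0 ?expR_ge0 // ltW // rcosh_gt0. Qed.

Lemma bessel_kernel_le nu e m t : (nu <= 1)%N -> 0 < e -> e <= m ->
  bessel_kernel nu m t * rcosh t <= expR (- m / 2) * (decay_cst e * expR (- t)).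
Proof.
move=> n1 e0 em; apply: le_trans (expR_rcosh_decay t e0 em).
rewrite -mulrA ler_pM2l ?expR_gt0 // expr2 ler_pM2r ?rcosh_gt0 //.
exact: rcosh_le.
Qed.

Lemma bessel_kernel_le' nu e m t : (nu <= 1)%N -> 0 < e -> e <= m ->
  bessel_kernel nu m t <= expR (- m / 2) * (decay_cst e * expR (- t)).
Proof.
move=> n1 e0 em; apply: le_trans (bessel_kernel_le t n1 e0 em).
by rewrite ler_peMr ?bessel_kernel_ge0 // rcosh_ge1.
Qed.

Lemma integrable_majorant (c : R) :
  mu.-integrable half_line (EFin \o (fun t => c * expR (- t))).
Proof.
have h : mu.-integrable half_line (fun t => c%:E * (EFin \o (fun t => expR (- t)%R)) t)%E.
  by apply: integrableZl => //; exact: integrable_expRN.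
by apply: eq_integrable h => // t _; rewrite /= EFinM.
Qed.

Lemma integrable_bessel nu x : (nu <= 1)%N -> 0 < x ->
  mu.-integrable half_line (EFin \o bessel_kernel nu x).
Proof.
move=> n1 x0.
apply: (le_integrable _ _ _ (integrable_majorant (expR (- x / 2) * (decay_cst x)))).
- exact: measurable_itv.
- by apply/measurable_realfun.measurable_EFinP; exact: measurable_bessel_kernel.
- move=> t _ /=; rewrite lee_fin !ger0_norm ?bessel_kernel_ge0 //.
    by rewrite -(mulrA (expR (- x / 2))); exact: bessel_kernel_le'.
  by rewrite mulr_ge0 ?expR_ge0 // mulr_ge0 ?expR_ge0 // decay_cst_ge0.
Qed.

Lemma besselKE nu x : besselK nu x = \int[mu]_(t in half_line) bessel_kernel nu x t.
Proof. by []. Qed.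

(** The difference of the kernels at x <= y is the kernel at x times
1 - exp (- (y - x) cosh t) <= (y - x) cosh t; this extra cosh t is why
expR_rcosh_decay has a square. *)
Lemma besselK_bound nu e : (nu <= 1)%N -> 0 < e -> exists2 D : R, 0 <= D &
  (forall x, e <= x -> `|besselK nu x| <= D * expR (- x / 2)) /\
  (forall m x y, e <= m -> m <= x -> m <= y ->
     `|besselK nu x - besselK nu y| <= D * expR (- m / 2) * `|x - y|).
Proof.
move=> n1 e0; pose A := decay_cst e; pose I0 := \int[mu]_(t in half_line) expR (- t).
have A0 : 0 <= A by exact: decay_cst_ge0.
have I00 : 0 <= I0 by apply: Rintegral_ge0 => t _; exact: expR_ge0.
have key (f : R -> R) (c : R) : mu.-integrable half_line (EFin \o f) ->
    (forall t, `|f t| <= c * expR (- t)) -> `|\int[mu]_(t in half_line) f t| <= c * I0.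
  move=> fi fc; apply: le_trans (le_normr_Rintegral _ fi) _; first exact: measurable_itv.
  rewrite -RintegralZl //; last exact: integrable_expRN.
  apply: le_Rintegral => //; last exact: integrable_majorant.
  exact: integrable_norm.
exists (A * I0); first by rewrite mulr_ge0.
split=> [x ex|m x y em mx my].
  rewrite besselKE mulrAC; apply: key; first by apply: integrable_bessel => //; lra.
  move=> t; rewrite ger0_norm ?bessel_kernel_ge0 //.
  by rewrite [A * _]mulrC -(mulrA (expR (- x / 2))); exact: bessel_kernel_le'.
wlog xy : x y mx my / x <= y.
  move=> H; have [xy|/ltW yx] := leP x y; first exact: H.
  by rewrite distrC [`|x - y|]distrC; exact: H.
have ix : mu.-integrable half_line (EFin \o bessel_kernel nu x).
  by apply: integrable_bessel => //; lra.
have iy : mu.-integrable half_line (EFin \o bessel_kernel nu y).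
  by apply: integrable_bessel => //; lra.
rewrite !besselKE -RintegralB //.
have -> : A * I0 * expR (- m / 2) * `|x - y| = (`|x - y| * (expR (- m / 2) * A)) * I0.
  by ring.
apply: key => [|t].
  rewrite (_ : _ \o _ = (fun t => (EFin \o bessel_kernel nu x) t - (EFin \o bessel_kernel nu y) t)%E) //.
  exact: integrableB.
have c1 := rcosh_ge1 t.
have -> : bessel_kernel nu x t - bessel_kernel nu y t
    = bessel_kernel nu x t * (1 - expR (- (y - x) * rcosh t)).
  rewrite /bessel_kernel mulrBr mulr1; congr (_ - _).
  rewrite mulrAC -expRD; congr (expR _ * _); ring.
have h1 : 1 - expR (- (y - x) * rcosh t) <= (y - x) * rcosh t.
  by have := expR_ge1Dx (- (y - x) * rcosh t); lra.
have h2 : 0 <= 1 - expR (- (y - x) * rcosh t).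
  by rewrite subr_ge0 -expR0 ler_expR; nra.
rewrite normrM (ger0_norm h2) (ger0_norm (bessel_kernel_ge0 _ _ _)).
rewrite (distrC x y) (ger0_norm (_ : 0 <= y - x)) ?subr_ge0 //.
apply: (@le_trans _ _ ((y - x) * (bessel_kernel nu m t * rcosh t))).
  rewrite [leRHS]mulrCA; apply: ler_pM => //; first exact: bessel_kernel_ge0.
  by rewrite ler_pM2r ?rcosh_gt0 // ler_expR; nra.
rewrite -(mulrA (y - x)) ler_wpM2l ?subr_ge0 //.
by rewrite -[expR _ * A * _]mulrA; exact: bessel_kernel_le.
Qed.

(** Differentiation under the integral sign on ]x / 2, x + 1[, where the
kernel at x / 2 times cosh t dominates the derivative. *)
Lemma differentiable_besselK nu x : (nu <= 1)%N -> 0 < x -> differentiable (@besselK R nu) x.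
Proof.
move=> n1 x0; apply/derivable1_diffP.
pose G t := decay_cst (x / 2) * expR (- t).
have x2 : 0 < x / 2 by rewrite divr_gt0.
have hder y t : is_derive y 1 (bessel_kernel nu ^~ t) (- rcosh t * bessel_kernel nu y t).
  rewrite /bessel_kernel; apply: is_derive_eq.
  by rewrite /GRing.scale /=; ring.
apply: (@derivable_under_integral R _ _ mu (bessel_kernel nu) half_line _ x (x / 2) (x + 1) _ _ _ G).
- exact: measurable_itv.
- by rewrite /= in_itv /=; lra.
- by move=> y; rewrite /= in_itv /= => /andP[y1 y2]; apply: integrable_bessel => //; lra.
- by move=> y t _ _; have [] := hder y t.
- by move=> t; rewrite mulr_ge0 ?expR_ge0 ?decay_cst_ge0.
- exact: integrable_majorant.
- move=> y t; rewrite /= in_itv /= => /andP[y1 y2] _.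
  rewrite partial1of2E; have [_ ->] := hder y t.
  rewrite normrM normrN !ger0_norm ?bessel_kernel_ge0 //; last by rewrite ltW // rcosh_gt0.
  have hy : expR (- y / 2) <= 1 by rewrite -[leRHS]expR0 ler_expR; lra.
  have hG : 0 <= G t.
    by rewrite /G mulr_ge0 ?expR_ge0 ?decay_cst_ge0.
  rewrite [X in X <= _]mulrC; apply: le_trans (bessel_kernel_le t n1 x2 (ltW y1)) _.
  rewrite -/(G t); rewrite ler_piMl //.
Qed.

End Bessel.

(** * Special geometry in a chart *)
Section Geometry.
Variables (R : realType) (m : nat) (M : manifold R m).
Notation E := 'rV[R]_m.
Variables (g om : form2 M) (J : endo M) (D nab : connection M) (xi : vfield M).

(** The connection form evaluated on u, making chr a matrix product. *)
Definition chrM (G : connection M) i (x u : E) : 'M[R]_m := \sum_(a < m) u 0 a *: G i a x.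

Lemma chrE (G : connection M) i x u v : chr G i x u v = v *m chrM G i x u.
Proof.
rewrite /chr /chrM mulmx_sumr; apply: eq_bigr => a _; exact: scalemxAr.
Qed.

Lemma chrM_add (G : connection M) i x u v : chrM G i x (u + v) = chrM G i x u + chrM G i x v.
Proof. by rewrite -big_split; apply: eq_bigr => a _; rewrite mxE scalerDl. Qed.

Lemma chrM_scale (G : connection M) i x (c : R) u : chrM G i x (c *: u) = c *: chrM G i x u.
Proof. by rewrite scaler_sumr; apply: eq_bigr => a _; rewrite mxE scalerA. Qed.

Lemma ev2Dl (B : 'M[R]_m) u v w : ev2 B (u + v) w = ev2 B u w + ev2 B v w.
Proof. by rewrite /ev2 !mulmxDl mxE. Qed.
Lemma ev2Zl (B : 'M[R]_m) (c : R) u w : ev2 B (c *: u) w = c * ev2 B u w.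
Proof. by rewrite /ev2 -!scalemxAl mxE. Qed.
Lemma ev2Nl (B : 'M[R]_m) u w : ev2 B (- u) w = - ev2 B u w.
Proof. by rewrite -scaleN1r ev2Zl mulN1r. Qed.
Lemma ev2Dr (B : 'M[R]_m) u v w : ev2 B w (u + v) = ev2 B w u + ev2 B w v.
Proof. by rewrite /ev2 linearD /= mulmxDr mxE. Qed.
Lemma ev2Zr (B : 'M[R]_m) (c : R) u w : ev2 B w (c *: u) = c * ev2 B w u.
Proof. by rewrite /ev2 linearZ /= -scalemxAr mxE. Qed.
Lemma ev2Nr (B : 'M[R]_m) u w : ev2 B w (- u) = - ev2 B w u.
Proof. by rewrite -scaleN1r ev2Zr mulN1r. Qed.
Lemma ev20l (B : 'M[R]_m) w : ev2 B 0 w = 0.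
Proof. by rewrite -(scale0r 0) ev2Zl mul0r. Qed.
Lemma ev20r (B : 'M[R]_m) w : ev2 B w 0 = 0.
Proof. by rewrite -(scale0r 0) ev2Zr mul0r. Qed.

Lemma ev2_suml (B : 'M[R]_m) (I : finType) (c : I -> R) (h : I -> E) w :
  ev2 B (\sum_r c r *: h r) w = \sum_r c r * ev2 B (h r) w.
Proof.
apply: (big_ind2 (fun p q => ev2 B p w = q)) => [|p p' q q' <- <-|r _].
- exact: ev20l.
- exact: ev2Dl.
- exact: ev2Zl.
Qed.

Lemma ev2_sumr (B : 'M[R]_m) (I : finType) (c : I -> R) (h : I -> E) w :
  ev2 B w (\sum_r c r *: h r) = \sum_r c r * ev2 B w (h r).
Proof.
apply: (big_ind2 (fun p q => ev2 B w p = q)) => [|p p' q q' <- <-|r _].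
- exact: ev20r.
- exact: ev2Dr.
- exact: ev2Zr.
Qed.

Lemma smooth_on_der (F : normedModType R) (A : set E) (f : E -> F) x :
  smooth_on A f -> A x -> is_der f x (fun u => 'D_u f x).
Proof. by move=> fs Ax; apply: differentiable_der; exact: (fs [::]). Qed.

Lemma is_der_ev2 (V : normedModType R) (B : V -> 'M[R]_m) (X Y : V -> E) x dB dX dY :
  is_der B x dB -> is_der X x dX -> is_der Y x dY ->
  is_der (fun z => ev2 (B z) (X z) (Y z)) x
    (fun v => ev2 (B x) (dX v) (Y x) + ev2 (dB v) (X x) (Y x) + ev2 (B x) (X x) (dY v)).
Proof.
move=> hB hX hY.
have h := is_der_entry 0 0 (is_der_mul (is_der_mul hX hB) (is_der_trmx hY)).
apply: is_der_eqd h _ => v.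
by rewrite /ev2 mulmxDl !mxE.
Qed.

Lemma parallel_der om' i x (X Y : E -> E) dX dY :
  is_form2 om' -> parallel_form2 nab om' -> img i x ->
  is_der X x dX -> is_der Y x dY ->
  is_der (fun y => ev2 (om' i y) (X y) (Y y)) x
    (fun u => ev2 (om' i x) (dX u + chr nab i x u (X x)) (Y x)
            + ev2 (om' i x) (X x) (dY u + chr nab i x u (Y x))).
Proof.
move=> [oms _] omp ix hX hY; have hom := smooth_on_der (oms i) ix.
apply: is_der_eqd (is_der_ev2 hom hX hY) _ => u.
have := omp i x u (X x) (Y x) ix.
have [_ ->] := is_der_ev2 hom (is_der_cst (X x) x) (is_der_cst (Y x) x).
rewrite ev20l ev20r add0r addr0 => ->.
by rewrite ev2Dl ev2Dr; ring.
Qed.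

Hypothesis hM : cask g om J D nab xi.

Lemma cask_form : is_form2 om. Proof. by case: hM => -[[_ []]]. Qed.
Lemma cask_endo : is_endo J. Proof. by case: hM => -[[_ []]]. Qed.
Lemma cask_parallel : parallel_form2 nab om. Proof. by case: hM => -[]. Qed.
Lemma cask_dnablaJ : dnabla_closed nab J. Proof. by case: hM => -[]. Qed.
Lemma cask_connection : is_connection nab. Proof. by case: hM => -[_ []]. Qed.
Lemma cask_flat : flat nab. Proof. by case: hM => -[_ []]. Qed.
Lemma cask_torsion : torsion_free nab. Proof. by case: hM => -[_ []]. Qed.
Lemma cask_torsionD : torsion_free D. Proof. by case: hM => -[[_ _ _ []]]. Qed.
Lemma cask_DJ : parallel_endo D J. Proof. by case: hM => -[[]]. Qed.
Lemma cask_vfield : is_vfield xi. Proof. by case: hM. Qed.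
Lemma cask_nabla_xi : cov_id nab xi. Proof. by case: hM => _ _ []. Qed.
Lemma cask_D_xi : cov_id D xi. Proof. by case: hM => _ _ []. Qed.
Lemma cask_JJ i x (u : E) : img i x -> u *m J i x *m J i x = - u.
Proof. by case: hM => -[[_ _ h _ _]] _ _ _ _ _ _ _ ix; case: (h i x ix). Qed.
Lemma cask_gJ i x (u v : E) : img i x -> ev2 (g i x) (u *m J i x) v = ev2 (om i x) u v.
Proof. by case: hM => -[[_ _ h _ _]] _ _ _ _ _ _ _ ix; case: (h i x ix). Qed.
Lemma cask_gsym i x (u v : E) : img i x -> ev2 (g i x) u v = ev2 (g i x) v u.
Proof. by case: hM => -[[[_ h _] _ _ _ _]] _ _ _ _ _ _ _ ix; exact: h. Qed.
Lemma cask_gunit i x : img i x -> g i x \in unitmx.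
Proof. by case: hM => -[[[_ _ h] _ _ _ _]] _ _ _ _ _ _ _ ix; exact: h. Qed.

Lemma xi_der i x : img i x ->
  is_der (xi i) x (fun u => u - chr nab i x u (xi i x)).
Proof.
move=> ix; apply: is_der_eqd (smooth_on_der (cask_vfield.1 i) ix) _ => u.
by apply/eqP; rewrite eq_sym subr_eq; apply/eqP; rewrite -[in LHS](cask_nabla_xi u ix).
Qed.

(** Both connections are torsion-free and both send xi to the identity. *)
Lemma chr_xi i x u : img i x -> chr D i x (xi i x) u = chr nab i x (xi i x) u.
Proof.
move=> ix; rewrite cask_torsionD // cask_torsion //.
have h1 := cask_nabla_xi u ix; have h2 := cask_D_xi u ix.
by apply: (@addrI _ ('D_u (xi i) x)); rewrite -/(cov D i x u (xi i)) h2 -[LHS]h1.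
Qed.

(** D and nabla agree in the direction of xi by chr_xi, and D J = 0. *)
Lemma nabla_xi_J i x u : img i x ->
  cov nab i x (xi i x) (fun y => u *m J i y) = chr nab i x (xi i x) u *m J i x.
Proof.
by move=> ix; have := cask_DJ (xi i x) u ix; rewrite /cov !chr_xi.
Qed.

Lemma Jconst_der i x (v : E) : img i x ->
  is_der (fun y => v *m J i y) x
    (fun u => cov nab i x u (fun y => v *m J i y) - chr nab i x u (v *m J i x)).
Proof.
move=> ix.
have h := is_der_mul (is_der_cst v x) (smooth_on_der (cask_endo.1 i) ix).
by apply: is_der_eqd (differentiable_der h.1) _ => u; rewrite /cov addrK.
Qed.

(** nabla_u (J xi) = (nabla_u J) xi + J u, and d_nabla J = 0 exchanges u and xi
in the first term, which then vanishes by nabla_xi_J. *)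
Lemma Jxi_der i x : img i x ->
  is_der (fun y => xi i y *m J i y) x
    (fun u => u *m J i x - chr nab i x u (xi i x *m J i x)).
Proof.
move=> ix; have hJ := smooth_on_der (cask_endo.1 i) ix.
apply: is_der_eqd (is_der_mul (xi_der ix) hJ) _ => u.
have h := is_der_mul (is_der_cst (xi i x) x) hJ.
have := is_der_unique h (Jconst_der (xi i x) ix) => /(congr1 (@^~ u)) /=.
rewrite mul0mx add0r => ->; rewrite (cask_dnablaJ u (xi i x) ix) nabla_xi_J //.
by rewrite mulmxBl (cask_torsion u) // addrA subrK.
Qed.

Section FlatDerivatives.
Variables (i : idx M) (W : set E) (s : E -> E).
Hypotheses (Wo : open W) (Wi : W `<=` img i) (sf : flat_section nab i W s).

Lemma flat_der x : W x -> is_der s x (fun u => - chr nab i x u (s x)).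
Proof.
move=> Wx; apply: is_der_eqd (smooth_on_der sf.1 Wx) _ => u.
by apply/eqP; rewrite -addr_eq0; apply/eqP; exact: (sf.2 x u Wx).
Qed.

Lemma om_xi_der x : W x ->
  is_der (fun y => ev2 (om i y) (xi i y) (s y)) x (fun u => ev2 (om i x) u (s x)).
Proof.
move=> Wx; have ix := Wi Wx.
apply: is_der_eqd (parallel_der cask_form cask_parallel ix (xi_der ix) (flat_der Wx)) _ => u.
by rewrite subrK addNr ev20r addr0.
Qed.

Lemma om_Jxi_der x : W x ->
  is_der (fun y => ev2 (om i y) (xi i y *m J i y) (s y)) x
    (fun u => ev2 (om i x) (u *m J i x) (s x)).
Proof.
move=> Wx; have ix := Wi Wx.
apply: is_der_eqd (parallel_der cask_form cask_parallel ix (Jxi_der ix) (flat_der Wx)) _ => u.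
by rewrite subrK addNr ev20r addr0.
Qed.

Lemma om_cst_der (v : E) x : W x ->
  is_der (fun y => ev2 (om i y) v (s y)) x (fun u => ev2 (om i x) (chr nab i x u v) (s x)).
Proof.
move=> Wx; have ix := Wi Wx.
apply: is_der_eqd (parallel_der cask_form cask_parallel ix (is_der_cst v x) (flat_der Wx)) _ => u.
by rewrite add0r addNr ev20r addr0.
Qed.

(** The differential of the component along v of the 1-form om (J ., s).  By
d_nabla J = 0 it is symmetric in v and u, that is, this form is closed. *)
Lemma om_Jcst_der (v : E) x : W x ->
  is_der (fun y => ev2 (om i y) (v *m J i y) (s y)) x
    (fun u => ev2 (om i x) (cov nab i x u (fun y => v *m J i y)) (s x)).
Proof.
move=> Wx; have ix := Wi Wx.
apply: is_der_eqd (parallel_der cask_form cask_parallel ix (Jconst_der v ix) (flat_der Wx)) _ => u.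
by rewrite subrK addNr ev20r addr0.
Qed.

Lemma chrM_der (v : E) x : img i x ->
  is_der (fun y => chrM nab i y v) x (fun u => 'D_u (fun y => chrM nab i y v) x).
Proof.
move=> ix; apply: differentiable_der.
suff : is_der (fun y => chrM nab i y v) x (fun u => \sum_a v 0 a *: 'D_u (nab i a) x) by case.
apply: is_der_sum => a _; apply: is_derZ; exact: smooth_on_der (cask_connection.1 i a) ix.
Qed.

Lemma chr_flat_der (v : E) x : W x -> exists2 h : E -> E,
  is_der (fun y => chr nab i y v (s y)) x h &
  forall u, h u = cov nab i x u (fun y => cov nab i y v (cst (s x)))
      - chr nab i x u (chr nab i x v (s x)) - chr nab i x v (chr nab i x u (s x)).
Proof.
move=> Wx; have ix := Wi Wx.
have h0 := is_der_mul (flat_der Wx) (chrM_der v ix).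
exists (fun u => - chr nab i x u (s x) *m chrM nab i x v
     + s x *m 'D_u (fun y => chrM nab i y v) x).
  apply: is_der_near h0; near=> y; exact/esym/chrE.
move=> u; rewrite mulNmx -[X in - X]chrE addrC; congr (_ - _).
have h1 := is_der_mul (is_der_cst (s x) x) (chrM_der v ix).
have h2 : is_der (fun y => cov nab i y v (cst (s x))) x
    (fun u => s x *m 'D_u (fun y => chrM nab i y v) x).
  apply: is_der_eqd (is_der_near _ h1) _ => [|w]; last by rewrite mul0mx add0r.
  by near=> y; rewrite /cov derive_cst add0r chrE.
rewrite [in RHS]/cov; case: h2 => _ ->.
by rewrite derive_cst add0r addrK.
Unshelve. all: by end_near. Qed.

(** Flatness of nabla, evaluated on the section s; it makes dangle a closed form. *)
Lemma chr_flat_sym x u v : W x ->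
  'D_u (fun y => chr nab i y v (s y)) x = 'D_v (fun y => chr nab i y u (s y)) x.
Proof.
move=> Wx; have ix := Wi Wx.
have [h1 [_ ->] ->] := chr_flat_der v Wx; have [h2 [_ ->] ->] := chr_flat_der u Wx.
by rewrite (cask_flat u v (s x) ix) addrAC.
Qed.

End FlatDerivatives.
End Geometry.

Lemma linear_row_sum (R : nzRingType) (N : nat) (f : 'rV[R]_N -> R) :
  (forall c u v, f (c *: u + v) = c * f u + f v) ->
  forall v, f v = \sum_r v 0 r * f (delta_mx 0 r).
Proof.
move=> fl v; have f0 : f 0 = 0 by have := fl (-1) 0 0; rewrite scaler0 addr0 mulN1r addNr.
rewrite {1}[v]row_sum_delta; apply: (big_ind2 (fun p q => f p = q)) => //.
  by move=> p p' q q' <- <-; have := fl 1 p q; rewrite scale1r mul1r.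
by move=> r _; have := fl (v 0 r) (delta_mx 0 r) 0; rewrite !addr0 f0 addr0.
Qed.

Section OneForm.
Variables (R : realType) (N : nat).
Notation TE := 'rV[R]_N.

(** Cartan's formula L_V al = d (al (V)) for a closed 1-form al, the closedness
being the symmetry of the derivatives be of its components. *)
Lemma closed_form_lie (V : TE -> TE) dV (al : TE -> TE -> R) (be : TE -> TE -> R) z f df :
  (forall y (c : R) u v, al y (c *: u + v) = c * al y u + al y v) ->
  (forall u, is_der (al^~ u) z (be u)) -> (forall u v, be u v = be v u) ->
  is_der V z dV -> is_der f z df -> (\forall y \near z, al y (V y) = f y) ->
  forall u, be u (V z) + al z (dV u) = df u.
Proof.
move=> allin hal besym hV hf alV u.
have alE y v : al y v = \sum_c v 0 c * al y (delta_mx 0 c).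
  exact: (linear_row_sum (allin y)).
have beE v w : be v w = \sum_c v 0 c * be (delta_mx 0 c) w.
  have h : is_der (al^~ v) z (fun w => \sum_c v 0 c * be (delta_mx 0 c) w).
    apply: (is_der_near (f := fun y => \sum_c v 0 c * al y (delta_mx 0 c))).
      by near=> y.
    apply: is_der_sum => c _.
    apply: is_der_eqd (is_derM (is_der_cst (v 0 c) z) (hal _)) _ => u'.
    by rewrite mul0r add0r.
  by have := is_der_unique (hal v) h => /(congr1 (@^~ w)).
have h : is_der f z (fun u => \sum_c (dV u 0 c * al z (delta_mx 0 c)
     + V z 0 c * be (delta_mx 0 c) u)).
  apply: (is_der_near (f := fun y => \sum_c V y 0 c * al y (delta_mx 0 c))).
    by apply: filterS alV => y <-.
  apply: is_der_sum => c _; apply: is_derM (is_der_entry 0 c hV) (hal _).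
rewrite (is_der_unique hf h) big_split /= -alE -beE addrC.
by rewrite (besym u).
Unshelve. all: by end_near. Qed.

End OneForm.

Lemma row_mx_der (R : realType) (V : normedModType R) p q
    (f : V -> 'rV[R]_p) (g : V -> 'rV[R]_q) x df dg :
  is_der f x df -> is_der g x dg ->
  is_der (fun z => row_mx (f z) (g z)) x (fun v => row_mx (df v) (dg v)).
Proof.
move=> hf hg; apply: is_der_mx => k j; rewrite (ord1 k).
case: (split_ordP j) => j' ->.
  apply: (is_der_near (f := fun z => f z 0 j')); first by near=> z; rewrite row_mxEl.
  by apply: is_der_eqd (is_der_entry 0 j' hf) _ => v; rewrite row_mxEl.
apply: (is_der_near (f := fun z => g z 0 j')); first by near=> z; rewrite row_mxEr.
by apply: is_der_eqd (is_der_entry 0 j' hg) _ => v; rewrite row_mxEr.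
Unshelve. all: by end_near. Qed.

(** * The horizontal lift acting on central charges and angles *)
Section Lift.
Variables (R : realType) (n : nat) (M : manifold R (n + n)).
Notation E := 'rV[R]_(n + n).
Notation TE := 'rV[R]_((n + n) + (n + n)).
Variables (g om : form2 M) (J : endo M) (D nab : connection M) (xi : vfield M).
Hypothesis hM : cask g om J D nab xi.

Lemma base_der (z : TE) : is_der (@base R n) z (@base R n).
Proof.
apply: is_der_mx => i j.
apply: (@is_der_lin _ _ _ _ 1) => [u v|c u|u]; rewrite ?mxE // mul1r; exact: mx_entry_norm.
Qed.

Lemma fibre_der (z : TE) : is_der (@fibre R n) z (@fibre R n).
Proof.
apply: is_der_mx => i j.
apply: (@is_der_lin _ _ _ _ 1) => [u v|c u|u]; rewrite ?mxE // mul1r; exact: mx_entry_norm.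
Qed.

Lemma baseD (u v : TE) : base (u + v) = base u + base v.
Proof. exact: linearD. Qed.
Lemma baseZ (c : R) (u : TE) : base (c *: u) = c *: base u.
Proof. exact: linearZ. Qed.
Lemma fibreD (u v : TE) : fibre (u + v) = fibre u + fibre v.
Proof. exact: linearD. Qed.
Lemma fibreZ (c : R) (u : TE) : fibre (c *: u) = c *: fibre u.
Proof. exact: linearZ. Qed.

Lemma base_open (W : set E) (z : TE) : open W -> W (base z) -> \forall y \near z, W (base y).
Proof.
move=> Wo Wz; have := differentiable_continuous (base_der z).1.
by apply; apply: open_nbhs_nbhs.
Qed.

Definition dotp (u v : E) : R := (u *m v^T) 0 0.

Lemma dotpDl u v w : dotp (u + v) w = dotp u w + dotp v w.
Proof. by rewrite /dotp mulmxDl mxE. Qed.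
Lemma dotpZl (c : R) u w : dotp (c *: u) w = c * dotp u w.
Proof. by rewrite /dotp -scalemxAl mxE. Qed.
Lemma dotpDr u v w : dotp w (u + v) = dotp w u + dotp w v.
Proof. by rewrite /dotp linearD /= mulmxDr mxE. Qed.
Lemma dotpZr (c : R) u w : dotp w (c *: u) = c * dotp w u.
Proof. by rewrite /dotp linearZ /= -scalemxAr mxE. Qed.

Lemma dotp0l u : dotp 0 u = 0. Proof. by rewrite -(scale0r 0) dotpZl mul0r. Qed.
Lemma dotp0r u : dotp u 0 = 0. Proof. by rewrite -(scale0r 0) dotpZr mul0r. Qed.

Lemma dotp_der (V : normedModType R) (f h : V -> E) x df dh :
  is_der f x df -> is_der h x dh ->
  is_der (fun z => dotp (f z) (h z)) x (fun v => dotp (df v) (h x) + dotp (f x) (dh v)).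
Proof.
move=> hf hh; apply: is_der_eqd (is_der_entry 0 0 (is_der_mul hf (is_der_trmx hh))) _ => v.
by rewrite /dotp mxE.
Qed.

Variable i : idx M.

(** Real part and imaginary part of the central charge of a section s of the
tangent bundle, and its angle coordinate, followed by their differentials. *)
Definition rez (s : E -> E) (z : TE) : R := ev2 (om i (base z)) (xi i (base z)) (s (base z)).
Definition imz (s : E -> E) (z : TE) : R :=
  - ev2 (om i (base z)) (xi i (base z) *m J i (base z)) (s (base z)).
Definition angle (s : E -> E) (z : TE) : R := 2 * pi * dotp (s (base z)) (fibre z).

Definition drez (s : E -> E) (z u : TE) : R := ev2 (om i (base z)) (base u) (s (base z)).
Definition dimz (s : E -> E) (z u : TE) : R :=
  - ev2 (om i (base z)) (base u *m J i (base z)) (s (base z)).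
Definition dangle (s : E -> E) (z u : TE) : R := 2 * pi *
  (dotp (s (base z)) (fibre u) - dotp (chr nab i (base z) (base u) (s (base z))) (fibre z)).

Lemma central_chargeE (x v : E) : central_charge om J xi i x v =
  ev2 (om i x) (xi i x) v +i* (- ev2 (om i x) (xi i x *m J i x) v).
Proof.
rewrite /central_charge mulrA divff // mul1r; apply/eqP; rewrite eq_complex /=; apply/andP.
by split; apply/eqP; ring.
Qed.

Lemma is_der_scalemx (V : normedModType R) p q (k : V -> R) (A : V -> 'M[R]_(p, q)) x dk dA :
  is_der k x dk -> is_der A x dA ->
  is_der (fun z => k z *: A z) x (fun v => dk v *: A x + k x *: dA v).
Proof.
move=> hk hA; apply: is_der_mx => a b.
apply: (is_der_near (f := fun z => k z * A z a b)); first by near=> z; rewrite mxE.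
by apply: is_der_eqd (is_derM hk (is_der_entry a b hA)) _ => v; rewrite !mxE.
Unshelve. all: by end_near. Qed.

Lemma hliftE (z : TE) : hlift J nab xi i z =
  row_mx (xi i (base z) *m J i (base z))
    (fibre z *m (chrM nab i (base z) (xi i (base z) *m J i (base z)))^T).
Proof.
congr row_mx; apply/rowP => c; rewrite mxE chrE.
rewrite -mulmxA -rowE !mxE; apply: eq_bigr => j _.
by rewrite !mxE mulrC.
Qed.

Lemma hlift_diff (z : TE) : img i (base z) -> differentiable (hlift J nab xi i) z.
Proof.
move=> iz; pose v (y : TE) : E := xi i (base y) *m J i (base y).
have hv : is_der v z _ := is_der_comp (base_der z) (Jxi_der hM iz).
have hG (b : 'I_(n + n)) : is_der (fun y : TE => nab i b (base y)) z _ :=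
  is_der_comp (base_der z) (smooth_on_der ((cask_connection hM).1 i b) iz).
have hC : is_der (fun y : TE => chrM nab i (base y) (v y)) z _ :=
  is_der_sum (fun b _ => is_der_scalemx (is_der_entry 0 b hv) (hG b)).
rewrite (_ : hlift J nab xi i = fun y => row_mx (v y)
    (fibre y *m (chrM nab i (base y) (v y))^T)); last first.
  by apply/funext => y; exact: hliftE.
by have [] := row_mx_der hv (is_der_mul (fibre_der z) (is_der_trmx hC)).
Qed.

Lemma drez_lin s y c u v : drez s y (c *: u + v) = c * drez s y u + drez s y v.
Proof. by rewrite /drez baseD baseZ ev2Dl ev2Zl. Qed.

Lemma dimz_lin s y c u v : dimz s y (c *: u + v) = c * dimz s y u + dimz s y v.
Proof. by rewrite /dimz baseD baseZ mulmxDl -scalemxAl ev2Dl ev2Zl opprD mulrN. Qed.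

Lemma dangle_lin s y c u v : dangle s y (c *: u + v) = c * dangle s y u + dangle s y v.
Proof.
rewrite /dangle baseD baseZ fibreD fibreZ !chrE chrM_add chrM_scale.
by rewrite mulmxDr -scalemxAr dotpDl dotpZl dotpDr dotpZr; ring.
Qed.

Section FlatSection.
Variables (W : set E) (s : E -> E).
Hypotheses (Wo : open W) (Wi : W `<=` img i) (sf : flat_section nab i W s).

Lemma base_flat_der z : W (base z) ->
  is_der (fun y : TE => s (base y)) z (fun u => - chr nab i (base z) (base u) (s (base z))).
Proof. by move=> Wz; exact: is_der_comp (base_der z) (flat_der sf Wz). Qed.

Lemma rez_der z : W (base z) -> is_der (rez s) z (drez s z).
Proof. by move=> Wz; exact: is_der_comp (base_der z) (om_xi_der hM Wi sf Wz). Qed.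

Lemma imz_der z : W (base z) -> is_der (imz s) z (dimz s z).
Proof. by move=> Wz; apply: is_derN; exact: is_der_comp (base_der z) (om_Jxi_der hM Wi sf Wz). Qed.

Lemma angle_der z : W (base z) -> is_der (angle s) z (dangle s z).
Proof.
move=> Wz; apply: is_der_eqd (is_derM (is_der_cst (2 * pi) z)
   (dotp_der (base_flat_der Wz) (fibre_der z))) _ => u.
rewrite mul0r add0r /dangle; congr (_ * _).
by rewrite -scaleN1r dotpZl mulN1r addrC.
Qed.

Lemma dangle_der z u : W (base z) -> is_der (fun y => dangle s y u) z (fun w =>
  2 * pi * (- dotp (chr nab i (base z) (base w) (s (base z))) (fibre u)
     - dotp ('D_(base w) (fun y => chr nab i y (base u) (s y)) (base z)) (fibre z)
     - dotp (chr nab i (base z) (base u) (s (base z))) (fibre w))).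
Proof.
move=> Wz.
have [h hh _] := chr_flat_der hM Wi sf (base u) Wz.
have h1 := is_der_comp (base_der z) hh.
have h2 := is_derB (dotp_der (base_flat_der Wz) (is_der_cst (fibre u) z))
   (dotp_der h1 (fibre_der z)).
apply: is_der_eqd (is_derM (is_der_cst (2 * pi) z) h2) _ => w.
rewrite mul0r add0r; congr (_ * _); case: hh => _ ->.
by rewrite dotp0r -scaleN1r dotpZl mulN1r addr0 opprD addrA.
Qed.

Local Notation V := (hlift J nab xi i).

Lemma base_hlift z : base (V z) = xi i (base z) *m J i (base z).
Proof. by rewrite /base row_mxKl. Qed.

Lemma drez_hlift z : drez s z (V z) = - imz s z.
Proof. by rewrite /drez base_hlift /imz opprK. Qed.

Lemma dimz_hlift z : W (base z) -> dimz s z (V z) = rez s z.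
Proof. by move=> Wz; rewrite /dimz base_hlift (cask_JJ hM) ?ev2Nl ?opprK //; exact: Wi. Qed.

Lemma dangle_hlift z : dangle s z (V z) = 0.
Proof.
rewrite /dangle base_hlift hliftE {1}/fibre row_mxKr /dotp trmx_mul trmxK mulmxA.
by rewrite chrE subrr mulr0.
Qed.

Variables (z : TE).
Hypothesis Wz : W (base z).

Lemma drez_lie u : differentiable (fun y => drez s y u) z /\
  'D_(V z) (fun y => drez s y u) z + drez s z ('D_u V z) = - dimz s z u.
Proof.
have hd v : is_der (fun y => drez s y v) z _ :=
  is_der_comp (base_der z) (om_cst_der hM Wi sf (base v) Wz).
split; first exact: (hd u).1.
rewrite ((hd u).2 (V z)).
apply: (@closed_form_lie _ _ V (fun u => 'D_u V z) (drez s) (fun u w : TE =>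
   ev2 (om i (base z)) (chr nab i (base z) (base w) (base u)) (s (base z))) z
   (fun y => - imz s y) (fun u => - dimz s z u)) => //.
- exact: drez_lin.
- by move=> a b; rewrite (cask_torsion hM) //; exact: Wi.
- by apply: differentiable_der; apply: hlift_diff; exact: Wi.
- by apply: is_derN; exact: imz_der.
- by near=> y; exact: drez_hlift.
Unshelve. all: by end_near. Qed.

Lemma dimz_lie u : differentiable (fun y => dimz s y u) z /\
  'D_(V z) (fun y => dimz s y u) z + dimz s z ('D_u V z) = drez s z u.
Proof.
have hd v : is_der (fun y => dimz s y v) z _ :=
  is_derN (is_der_comp (base_der z) (om_Jcst_der hM Wi sf (base v) Wz)).
split; first exact: (hd u).1.
rewrite ((hd u).2 (V z)).
apply: (@closed_form_lie _ _ V (fun u => 'D_u V z) (dimz s) (fun u w : TE =>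
   - ev2 (om i (base z)) (cov nab i (base z) (base w) (fun y => base u *m J i y)) (s (base z))) z
   (rez s) (drez s z)) => //.
- exact: dimz_lin.
- by move=> a b; rewrite (cask_dnablaJ hM) //; exact: Wi.
- by apply: differentiable_der; apply: hlift_diff; exact: Wi.
- exact: rez_der.
- by apply: filterS (base_open Wo Wz) => y; exact: dimz_hlift.
Unshelve. all: by end_near. Qed.

Lemma dangle_lie u : differentiable (fun y => dangle s y u) z /\
  'D_(V z) (fun y => dangle s y u) z + dangle s z ('D_u V z) = 0.
Proof.
have hd v := dangle_der v Wz.
split; first exact: (hd u).1.
rewrite ((hd u).2 (V z)).
apply: (@closed_form_lie _ _ V (fun u => 'D_u V z) (dangle s) _ z
   (fun=> 0) (fun=> 0) _ hd) => //.
- exact: dangle_lin.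
- move=> a b; rewrite (chr_flat_sym hM Wi sf _ _ Wz); ring.
- by apply: differentiable_der; apply: hlift_diff; exact: Wi.
- exact: is_der_cst.
- by near=> y; exact: dangle_hlift.
Unshelve. all: by end_near. Qed.

End FlatSection.
End Lift.

(** * Lattice, support and wall-crossing *)
Section SmoothLinear.
Variables (R : realType) (E F : normedModType R).

(** Smoothness of the lattice sections from that of the frame: iterated
derivatives commute with linear combinations on W only, hence the induction on
the list of directions at all points of W. *)
Lemma smooth_on_lin (I : finType) (W : set E) (c : I -> R) (f : I -> E -> F) :
  open W -> (forall r, smooth_on W (f r)) ->
  smooth_on W (fun y => \sum_r c r *: f r y).
Proof.
move=> Wo fs.
have der s x r : W x -> is_der (foldr (fun v h => 'D_v h) (f r) s) x
    (fun u => 'D_u (foldr (fun v h => 'D_v h) (f r) s) x).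
  by move=> Wx; apply: differentiable_der; exact: fs.
have key s x : W x -> is_der (fun y => \sum_r c r *: foldr (fun v h => 'D_v h) (f r) s y) x
    (fun u => \sum_r c r *: 'D_u (foldr (fun v h => 'D_v h) (f r) s) x).
  by move=> Wx; apply: is_der_sum => r _; apply: is_derZ; exact: der.
pose F0 s := foldr (fun v h => 'D_v h) (fun y => \sum_r c r *: f r y) s.
have eqs s : forall x, W x -> F0 s x = \sum_r c r *: foldr (fun v h => 'D_v h) (f r) s x.
  elim: s => [//|v s IH] x Wx.
  suff h : is_der (F0 s) x
      (fun u => \sum_r c r *: 'D_u (foldr (fun v h => 'D_v h) (f r) s) x) by exact: h.2.
  apply: is_der_near (key s x Wx).
  by apply: filterS (open_nbhs_nbhs (conj Wo Wx)) => y Wy; rewrite IH.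
move=> s x Wx; apply: (proj1 (is_der_near (f := fun y => _) _ (key s x Wx))).
by apply: filterS (open_nbhs_nbhs (conj Wo Wx)) => y Wy; rewrite -eqs.
Qed.

End SmoothLinear.

(** The derivative of an integer valued function that is locally constant
vanishes, and the mean value theorem applies on [0, 1]. *)
Lemma locally_constant_segment (R : realType) (f : R -> int) :
  (forall t : R, 0 <= t <= 1 -> \forall u \near t, f u = f t) -> f 1 = f 0.
Proof.
move=> hf; pose h t : R := (f t)%:~R.
have hd (t : R) : t \in `[0, 1] -> is_derive t (1 : R) h 0.
  rewrite in_itv /= => /hf ft.
  have hh : is_der h t (fun=> 0).
    by apply: is_der_near (is_der_cst (h t) t); apply: filterS ft => u; rewrite /h => ->.
  split; [exact: diff_derivable hh.1 | exact: hh.2].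
have cont : {within `[0, 1], continuous h}.
  by apply: derivable_within_continuous => t ht; case: (hd t ht).
have hdo (t : R) : t \in `]0, 1[ -> is_derive t (1 : R) h 0.
  by move=> ht; apply: hd; apply: subset_itv_oo_cc.
have [c _ hE] := MVT_segment (ler01 : (0 : R) <= 1) hdo cont.
have : h 1 = h 0 by apply/eqP; rewrite -subr_eq0 hE mul0r.
by move=> /intr_inj.
Qed.

Section Transitions.
Variables (R : realType) (n : nat) (M : manifold R (n + n)).
Notation E := 'rV[R]_(n + n).
Implicit Types (i j k : idx M) (x y : E).

Lemma psi_dom j y : img j y -> dom j (psi j y).
Proof. by case=> p dp <-; rewrite phiK. Qed.
Lemma psiK j y : img j y -> phi j (psi j y) = y.
Proof. by case=> p dp <-; rewrite phiK. Qed.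

Lemma near_dom j k y : img j y -> dom k (psi j y) ->
  \forall y' \near y, img j y' /\ dom k (psi j y').
Proof.
move=> jy ky; apply: filterI.
  by apply: open_nbhs_nbhs; split=> //; exact: img_open.
by apply: (psi_continuous jy); apply: open_nbhs_nbhs; split=> //; exact: dom_open.
Qed.

Lemma ov_in j k y : img j y -> dom k (psi j y) -> ov j k y.
Proof. by move=> jy ky; exists (psi j y); [split=> //; exact: psi_dom | exact: psiK]. Qed.

Lemma tr_der j k y : img j y -> dom k (psi j y) -> is_der (tr j k) y (dtr j k y).
Proof.
move=> jy ky; exact: smooth_on_der (@trans_smooth R _ M j k) (ov_in jy ky).
Qed.

Lemma dtr_comp j k l y v : img j y -> dom k (psi j y) -> dom l (psi j y) ->
  dtr k l (tr j k y) (dtr j k y v) = dtr j l y v.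
Proof.
move=> jy ky ly.
have ky' : img k (tr j k y) by exists (psi j y).
have ly' : dom l (psi k (tr j k y)) by rewrite /tr /= phiK.
have h := is_der_comp (tr_der jy ky) (tr_der ky' ly').
suff h' : is_der (tr j l) y (fun v => dtr k l (tr j k y) (dtr j k y v)).
  by have := is_der_unique h' (tr_der jy ly) => /(congr1 (@^~ v)).
apply: is_der_near h; apply: filterS (near_dom jy ky) => y' [jy' ky''].
by rewrite /tr /= phiK.
Qed.

Lemma dtr_id j y v : img j y -> dtr j j y v = v.
Proof.
move=> jy; have h := tr_der jy (psi_dom jy).
suff h' : is_der (tr j j) y id by have := is_der_unique h h' => /(congr1 (@^~ v)).
apply: (is_der_near (f := id)); last exact: is_diff_der (is_diff_id y).
by apply: filterS (near_dom jy (psi_dom jy)) => y' [jy' _]; rewrite /tr /= psiK.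
Qed.

(** For a Darboux frame this is the l1 norm of the coefficients. *)
Definition coframe_norm (B : 'M[R]_(n + n)) (I : finType) (fr : I -> E) (v : E) : R :=
  \sum_r `|ev2 B v (fr r)|.

Lemma coframe_is_norm B (I : finType) (fr : I -> E) :
  (forall v, (forall r, ev2 B v (fr r) = 0) -> v = 0) -> is_norm (coframe_norm B fr).
Proof.
move=> nd; split.
- by move=> v; apply: sumr_ge0.
- move=> v /eqP; rewrite psumr_eq0 // => /allP h; apply: nd => r.
  by apply/eqP; rewrite -normr_eq0; apply: (h r); rewrite mem_index_enum.
- by move=> c v; rewrite mulr_sumr; apply: eq_bigr => r _; rewrite ev2Zl normrM.
- by move=> v w; rewrite -big_split; apply: ler_sum => r _; rewrite ev2Dl; exact: ler_normD.
Qed.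

(** On a single point every norm is covariantly constant, once transported
between the charts, so that the support property applies to any norm there. *)
Lemma point_parallel_norm (nab : connection M) i x (N0 : E -> R) : img i x -> is_norm N0 ->
  parallel_norm nab [set psi i x] (fun j y v => N0 (dtr j i y v)).
Proof.
move=> ix [n0 n1 n2 n3].
have di : dom i (psi i x) := psi_dom ix.
split.
- move=> j y jy yx.
  have iy : dom i (psi j y) by rewrite yx.
  have [dD dZ _] := is_der_linear (tr_der jy iy).
  split=> [v|v /n1 h|c v|v w]; rewrite ?dD ?dZ //.
  rewrite -(dtr_id v jy) -(@dtr_comp j i j y v) // ?h; last exact: psi_dom.
  have iy' : img i (tr j i y) by exists (psi j y).
  have jy' : dom j (psi i (tr j i y)) by rewrite /tr /= phiK //; exact: psi_dom.
  have [_ dZ' _] := is_der_linear (tr_der iy' jy').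
  by have := dZ' 0 0; rewrite !scale0r.
- move=> j k y v [p [pj pk] <-]; rewrite phiK // => pE.
  rewrite dtr_comp //; first by exists p.
  + by rewrite phiK.
  + by rewrite phiK // pE.
- move=> j W s Wo Wi _ y Wy yx; near=> y' => y'x.
  suff -> : y' = y by [].
  rewrite -(psiK (Wi _ Wy)) yx -y'x psiK //; apply: Wi.
  by near: y'; exact: open_nbhs_nbhs.
Unshelve. all: by end_near. Qed.

End Transitions.

Section Lattice.
Variables (R : realType) (n : nat) (M : manifold R (n + n)).
Notation E := 'rV[R]_(n + n).
Notation K := 'rV[int]_(n + n).
Variables (g om : form2 M) (J : endo M) (D nab : connection M) (xi : vfield M).
Variables (Lam : idx M -> E -> set E) (Om : idx M -> E -> E -> int).
Hypothesis hM : cask g om J D nab xi.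
Hypothesis hOm : bps_structure om J nab xi Lam Om.

Lemma om_anti i x (u v : E) : img i x -> ev2 (om i x) u v = - ev2 (om i x) v u.
Proof.
move=> ix; rewrite -!(cask_gJ hM) //.
have gJJ (u' v' : E) : ev2 (g i x) (u' *m J i x) (v' *m J i x) = ev2 (g i x) u' v'.
  by case: hM => -[[_ _ h _ _]] _ _ _ _ _ _ _; case: (h i x ix).
by rewrite -gJJ (cask_JJ hM) // ev2Nl (cask_gsym hM).
Qed.

Variables (i : idx M) (W : set E) (a b : 'I_n -> E -> E).
Hypothesis df : darboux_frame om nab Lam i W a b.

Definition frame (r : 'I_(n + n)) : E -> E :=
  match fintype.split r with inl r' => a r' | inr r' => b r' end.

Lemma frame_l r : frame (lshift n r) = a r.
Proof. by rewrite /frame; case: split_ordP => j /eqP; rewrite ?eq_shift // => /eqP ->. Qed.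
Lemma frame_r r : frame (rshift n r) = b r.
Proof. by rewrite /frame; case: split_ordP => j /eqP; rewrite ?eq_shift // => /eqP ->. Qed.

Lemma lsecE k x : lsec a b k x = \sum_r (k 0 r)%:~R *: frame r x.
Proof.
rewrite /lsec big_split_ord; congr (_ + _); apply: eq_bigr => r _.
  by rewrite frame_l.
by rewrite frame_r.
Qed.

Lemma frame_flat r : flat_section nab i W (frame r).
Proof. by rewrite /frame; case: fintype.split => r'; [exact: (df_flata df) | exact: (df_flatb df)]. Qed.

Lemma lsec_flat k : flat_section nab i W (lsec a b k).
Proof.
have lE : lsec a b k = fun y => \sum_r (k 0 r)%:~R *: frame r y.
  by apply/funext => y; exact: lsecE.
have Wo := df_open df; split.
  rewrite lE; apply: smooth_on_lin => // r; exact: (frame_flat r).1.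
move=> x u Wx; rewrite /cov lE.
have h : is_der (fun y => \sum_r (k 0 r)%:~R *: frame r y) x
    (fun u => \sum_r (k 0 r)%:~R *: - chr nab i x u (frame r x)).
  apply: is_der_sum => r _; exact: is_derZ (flat_der (frame_flat r) Wx).
case: h => _ ->; rewrite chrE mulmx_suml -big_split big1 // => r _ /=.
by rewrite chrE -scalemxAl scalerN addNr.
Qed.

Lemma lsec_Lam k x : W x -> Lam i x (lsec a b k x).
Proof. by move=> Wx; rewrite (df_gen df Wx); exists k. Qed.

Definition l1 (k : K) : R := \sum_r `|(k 0 r)%:~R|.

Section AtPoint.
Variable x : E.
Hypothesis Wx : W x.
Let ix : img i x := df_sub df Wx.

Lemma om_comb_l (c : 'I_(n + n) -> R) s :
  ev2 (om i x) (\sum_r c r *: frame r x) (b s x) = c (lshift n s).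
Proof.
rewrite ev2_suml big_split_ord /= [X in _ + X]big1 ?addr0 => [|r _]; last first.
  by rewrite frame_r (df_bb df) // mulr0.
rewrite (bigD1 s) //= big1 ?addr0 => [|r rs]; rewrite frame_l (df_ab df) //.
  by rewrite eqxx mulr1.
by rewrite (negPf rs) mulr0.
Qed.

Lemma om_comb_r (c : 'I_(n + n) -> R) s :
  ev2 (om i x) (\sum_r c r *: frame r x) (a s x) = - c (rshift n s).
Proof.
rewrite ev2_suml big_split_ord /= big1 ?add0r => [|r _]; last first.
  by rewrite frame_l (df_aa df) // mulr0.
rewrite (bigD1 s) //= big1 ?addr0 => [|r rs]; rewrite frame_r om_anti // (df_ab df) //.
  by rewrite eqxx mulrN1.
by rewrite eq_sym (negPf rs) oppr0 mulr0.
Qed.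

Lemma frame_span (v : E) : exists c : 'I_(n + n) -> R, v = \sum_r c r *: frame r x.
Proof.
pose F : 'M[R]_(n + n) := \matrix_r frame r x.
have mulF (c : E) : c *m F = \sum_r c 0 r *: frame r x.
  by rewrite mulmx_sum_row; apply: eq_bigr => r _; rewrite rowK.
have Ffree : row_free F.
  rewrite -kermx_eq0; apply/eqP/row_matrixP => r; rewrite row0.
  have : row r (kermx F) *m F = 0 by rewrite -row_mul mulmx_ker row0.
  move: (row r (kermx F)) => c; rewrite mulF => c0.
  apply/rowP => j; rewrite mxE; case: (split_ordP j) => s ->.
    by rewrite -(om_comb_l (fun r => c 0 r) s) c0 ev20l.
  by apply/eqP; rewrite -oppr_eq0 -(om_comb_r (fun r => c 0 r) s) c0 ev20l.
exists (fun r => (v *m invmx F) 0 r).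
by rewrite -mulF mulmxKV // -row_free_unit.
Qed.

Definition frame_norm : E -> R := coframe_norm (om i x) (frame^~ x).

Lemma frame_norm_lsec k : frame_norm (lsec a b k x) = l1 k.
Proof.
rewrite /frame_norm /coframe_norm /l1 !big_split_ord /= addrC; congr (_ + _).
  by apply: eq_bigr => s _; rewrite frame_r lsecE; have /= -> := om_comb_l (fun r => (k 0 r)%:~R) s.
by apply: eq_bigr => s _; rewrite frame_l lsecE; have /= -> := om_comb_r (fun r => (k 0 r)%:~R) s; rewrite normrN.
Qed.

Lemma frame_norm_is_norm : is_norm frame_norm.
Proof.
apply: coframe_is_norm => v vfr; have [c vE] := frame_span v.
rewrite vE big1 // => r _; case: (split_ordP r) => s ->.
  by rewrite -(om_comb_l c s) -vE -frame_r vfr scale0r.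
have -> : c (rshift n s) = 0; last by rewrite scale0r.
by apply/eqP; rewrite -oppr_eq0 -(om_comb_r c s) -vE -frame_l vfr.
Qed.

Definition active : set K := [set k | Om i x (lsec a b k x) != 0].
Definition zval (k : K) : R[i] := central_charge om J xi i x (lsec a b k x).

Lemma active_bound : exists2 c : R, 0 < c & forall k, active k -> c * l1 k < normc (zval k).
Proof.
have [c c0 hc] := bps_support hOm (@compact_set1 _ (psi i x))
  (point_parallel_norm nab ix frame_norm_is_norm).
exists c => // k kS; have := hc i x _ ix erefl (lsec_Lam k Wx) kS.
by rewrite dtr_id // frame_norm_lsec.
Qed.

Lemma lsec0 : lsec a b 0 x = 0.
Proof. by rewrite lsecE big1 // => r _; rewrite mxE scale0r. Qed.

Lemma lsecN k : lsec a b (- k) x = - lsec a b k x.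
Proof. by rewrite !lsecE -sumrN; apply: eq_bigr => r _; rewrite mxE rmorphN scaleNr. Qed.

Lemma l1_ge0 k : 0 <= l1 k. Proof. exact: sumr_ge0. Qed.

(** The zero class is not active, since |Z_0| > 0 is impossible; a nonzero
integral vector has l1 norm at least 1. *)
Lemma l1_ge1 k : active k -> 1 <= l1 k.
Proof.
move=> kS; have [k0|/eqP kn0] := eqVneq k 0.
  have [c c0 /(_ k kS)] := active_bound.
  rewrite k0 /zval central_chargeE lsec0 !ev20r oppr0 /l1 big1 ?mulr0.
    by rewrite /= !expr0n /= addr0 sqrtr0 ltxx.
  by move=> r _; rewrite mxE normr0.
have [r kr] : exists r, k 0 r != 0.
  apply/existsP; apply: contra_notT kn0; rewrite negb_exists => /forallP h.
  by apply/rowP => r; rewrite mxE; apply/eqP; rewrite -[_ == _]negbK; exact: h.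
rewrite /l1 (bigD1 r) //=; apply: ler_wpDr; first exact: sumr_ge0.
by rewrite -intr_norm ler1z -gtz0_ge1 normr_gt0.
Qed.

Lemma active_opp k : active k -> active (- k).
Proof.
rewrite /active /= lsecN => kS; rewrite (bps_even hOm) //; exact: lsec_Lam.
Qed.

Lemma Om_opp k : Om i x (lsec a b (- k) x) = Om i x (lsec a b k x).
Proof. rewrite lsecN (bps_even hOm) //; exact: lsec_Lam. Qed.

Lemma active_local k l : active k -> active l ->
  ev2 (om i x) (lsec a b k x) (lsec a b l x) = 0.
Proof. by move=> kS lS; apply: (bps_local hOm ix) => //; exact: lsec_Lam. Qed.

Lemma zvalE k : zval k = (\sum_r (k 0 r)%:~R * ev2 (om i x) (xi i x) (frame r x)) +i*
  (\sum_r (k 0 r)%:~R * - ev2 (om i x) (xi i x *m J i x) (frame r x)).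
Proof.
rewrite /zval central_chargeE !lsecE !ev2_sumr; congr (_ +i* _).
by rewrite -sumrN; apply: eq_bigr => r _; rewrite mulrN.
Qed.

Lemma normc_le (u v : R) : normc (u +i* v) <= `|u| + `|v|.
Proof.
rewrite /= -[leRHS]ger0_norm ?addr_ge0 // -sqrtr_sqr ler_wsqrtr //.
rewrite sqrrD !real_normK ?num_real // -addrA [X in _ <= _ + X]addrC addrA.
by rewrite lerDl mulrn_wge0 // mulr_ge0.
Qed.

Lemma zval_upper : exists2 L : R, 0 < L & forall k, normc (zval k) <= L * l1 k.
Proof.
pose c r := `|ev2 (om i x) (xi i x) (frame r x)|
   + `|ev2 (om i x) (xi i x *m J i x) (frame r x)|.
exists (1 + \sum_r c r); first by rewrite ltr_pwDl // sumr_ge0 // => r _; rewrite addr_ge0.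
move=> k; rewrite zvalE; apply: le_trans (normc_le _ _) _.
apply: le_trans (lerD (ler_norm_sum _ _ _) (ler_norm_sum _ _ _)) _.
rewrite -big_split /=; apply: (@le_trans _ _ (\sum_r `|(k 0 r)%:~R| * c r)).
  by apply: ler_sum => r _; rewrite !normrM normrN mulrDr.
rewrite [leRHS]mulrC /l1 mulr_suml; apply: ler_sum => r _; rewrite ler_wpM2l //.
rewrite [X in _ <= _ + X](bigD1 r) //= addrCA lerDl addr_ge0 // sumr_ge0 // => j _.
exact: addr_ge0.
Qed.

(** |Z| <= L |k| turns a bound by exp (- r |Z|) into one by exp (- rho |k|),
with r = rho / L. *)
Lemma Om_summable (rho : R) : 0 < rho ->
  (\esum_(k in active) (`|(Om i x (lsec a b k x))%:~R| * expR (- rho * l1 k))%:E < +oo)%E.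
Proof.
move=> rho0; have [L L0 hL] := zval_upper.
have r0 : 0 < rho / L by rewrite divr_gt0.
have K1 : [set x] `<=` W by move=> _ ->.
apply: le_lt_trans (bps_convergence hOm df (@compact_set1 _ x) K1 r0).
rewrite esum_mkcond; apply: le_esum => k _; set u := ereal_sup _.
have hu : ((`|(Om i x (lsec a b k x))%:~R| * expR (- (rho / L) * normc (zval k)))%:E <= u)%E.
  by apply: ereal_sup_ubound; exists x.
case: ifP => _; last by apply: le_trans hu; rewrite lee_fin mulr_ge0 // expR_ge0.
apply: le_trans hu; rewrite lee_fin ler_wpM2l // ler_expR !mulNr lerN2.
by rewrite -mulrA ler_pM2l // ler_pdivrMl.
Qed.

(** The wall-crossing axiom gives a neighbourhood depending on the section;
connectedness of segments makes one ball valid for all lattice sections. *)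
Lemma Om_locally_constant : exists2 d : R, 0 < d & ball x d `<=` W /\
  forall k y, ball x d y -> Om i y (lsec a b k y) = Om i x (lsec a b k x).
Proof.
have /nbhs_ballP [d d0 dW] := open_nbhs_nbhs (conj (df_open df) Wx).
exists d => //; split=> // k y yB.
pose c (t : R) : E := x + t *: (y - x).
have c0 : c 0 = x by rewrite /c scale0r addr0.
have c1 : c 1 = y by rewrite /c scale1r addrC subrK.
have cW t : 0 <= t <= 1 -> W (c t).
  move=> /andP[t0 t1]; apply: dW; move: yB; rewrite -!ball_normE /ball_ /=.
  rewrite /c opprD addNKr normrN normrZ ger0_norm // distrC; apply: le_lt_trans.
  by rewrite ler_piMl.
suff : Om i (c 1) (lsec a b k (c 1)) = Om i (c 0) (lsec a b k (c 0)) by rewrite c0 c1.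
apply: (@locally_constant_segment R (fun t => Om i (c t) (lsec a b k (c t)))) => t /cW Wt.
have cc : c u @[u --> t] --> c t.
  by apply: cvgD; [exact: cvg_cst | apply: cvgZr_tmp; exact: cvg_id].
exact: cc (bps_wall hOm (df_open df) (df_sub df) (lsec_flat k) (lsec_Lam k) Wt).
Qed.

End AtPoint.
End Lattice.

(** * Tensor families of given weight under a vector field *)
Section ComplexFamilies.
Variables (R : realType) (V : normedModType R) (x : V).
Local Notation C := R[i].

Lemma ReM (z w : C) : Re (z * w) = Re z * Re w - Im z * Im w.
Proof. by case: z; case: w. Qed.
Lemma ImM (z w : C) : Im (z * w) = Re z * Im w + Im z * Re w.
Proof. by case: z => a b; case: w => c d. Qed.
Lemma ReD (z w : C) : Re (z + w) = Re z + Re w.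
Proof. by case: z; case: w. Qed.
Lemma ImD (z w : C) : Im (z + w) = Im z + Im w.
Proof. by case: z; case: w. Qed.
Lemma ReN (z : C) : Re (- z) = - Re z. Proof. by case: z. Qed.
Lemma ImN (z : C) : Im (- z) = - Im z. Proof. by case: z. Qed.
Lemma ReJ (z : C) : Re (conjc z) = Re z. Proof. by case: z. Qed.
Lemma ImJ (z : C) : Im (conjc z) = - Im z. Proof. by case: z. Qed.
Lemma complexP (z w : C) : Re z = Re w -> Im z = Im w -> z = w.
Proof. by case: z => a b; case: w => c d /= -> ->. Qed.
Lemma RerC (c : R) (z : C) : Re (c%:C * z) = c * Re z.
Proof. by case: z => p q /=; rewrite mul0r subr0. Qed.
Lemma ImrC (c : R) (z : C) : Im (c%:C * z) = c * Im z.
Proof. by case: z => p q /=; rewrite mul0r addr0. Qed.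
Lemma Re_ii (z : C) : Re (ii * z) = - Im z.
Proof. by case: z => p q /=; rewrite mul0r mul1r sub0r. Qed.
Lemma Im_ii (z : C) : Im (ii * z) = Re z.
Proof. by case: z => p q /=; rewrite mul0r mul1r add0r. Qed.
Lemma conjc_ii : conjc ii = - ii :> C.
Proof. by apply: complexP; rewrite /= ?oppr0. Qed.
Definition ReImE := (ReM, ImM, ReD, ImD, ReN, ImN, ReJ, ImJ).

Definition cctl (I : Type) (S : set I) (m : I -> R) (f df : I -> V -> C) : Prop :=
  ctl x S m (fun i z => Re (f i z)) (fun i v => Re (df i v)) /\
  ctl x S m (fun i z => Im (f i z)) (fun i v => Im (df i v)).

Section Rules.
Variables (I : Type) (S : set I).
Implicit Types (m : I -> R) (f g df dg : I -> V -> C).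

Lemma ctl_ext m (f g df dg : I -> V -> R) : (forall i z, f i z = g i z) ->
  (forall i v, df i v = dg i v) -> ctl x S m f df -> ctl x S m g dg.
Proof.
move=> fg dfg h; apply: ctl_eqd (ctl_near _ h) _ => [|i v _]; last exact: dfg.
by near=> z.
Unshelve. all: by end_near. Qed.

Lemma cctl_near m f g df : (\forall z \near x, forall i, S i -> f i z = g i z) ->
  cctl S m f df -> cctl S m g df.
Proof.
move=> fg [h1 h2]; split.
  by apply: ctl_near h1; apply: filterS fg => z hz i Si; rewrite hz.
by apply: ctl_near h2; apply: filterS fg => z hz i Si; rewrite hz.
Qed.

Lemma cctl_le m m' f df (c : R) : 0 <= c -> (forall i, S i -> m i <= c * m' i) ->
  cctl S m f df -> cctl S m' f df.
Proof. by move=> c0 mm [h1 h2]; split; [exact: ctl_le c0 mm h1 | exact: ctl_le c0 mm h2]. Qed.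

Lemma cctlD m f g df dg : (forall i, S i -> 0 <= m i) ->
  cctl S m f df -> cctl S m g dg ->
  cctl S m (fun i z => f i z + g i z) (fun i v => df i v + dg i v).
Proof.
move=> m0 [f1 f2] [g1 g2]; split.
  by apply: ctl_ext (ctlD m0 f1 g1) => *; rewrite ReD.
by apply: ctl_ext (ctlD m0 f2 g2) => *; rewrite ImD.
Qed.

Lemma cctlN m f df : cctl S m f df -> cctl S m (fun i z => - f i z) (fun i v => - df i v).
Proof.
move=> [f1 f2]; split.
  by apply: ctl_ext (ctlN f1) => *; rewrite ReN.
by apply: ctl_ext (ctlN f2) => *; rewrite ImN.
Qed.

Lemma cctlJ m f df : cctl S m f df ->
  cctl S m (fun i z => conjc (f i z)) (fun i v => conjc (df i v)).
Proof.
move=> [f1 f2]; split.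
  by apply: ctl_ext f1 => *; rewrite ReJ.
by apply: ctl_ext (ctlN f2) => *; rewrite ImJ.
Qed.

Lemma cctlM m m' f g df dg : (forall i, S i -> 0 <= m i) -> (forall i, S i -> 0 <= m' i) ->
  cctl S m f df -> cctl S m' g dg ->
  cctl S (fun i => m i * m' i) (fun i z => f i z * g i z)
    (fun i v => df i v * g i x + f i x * dg i v).
Proof.
move=> m0 m0' [f1 f2] [g1 g2]; have mm i : S i -> 0 <= m i * m' i.
  by move=> Si; rewrite mulr_ge0 ?m0 ?m0'.
split.
  apply: ctl_ext (ctlB mm (ctlM m0 m0' f1 g1) (ctlM m0 m0' f2 g2)) => *; by rewrite !ReImE; ring.
apply: ctl_ext (ctlD mm (ctlM m0 m0' f1 g2) (ctlM m0 m0' f2 g1)) => *; by rewrite !ReImE; ring.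
Qed.

Lemma cctl_scalar m (a : I -> C) : (forall i, S i -> `|Re (a i)| <= m i) ->
  (forall i, S i -> `|Im (a i)| <= m i) -> cctl S m (fun i _ => a i) (fun _ _ => 0).
Proof. by move=> h1 h2; split; apply: ctl_scalar. Qed.

Lemma cctl_real m (f df : I -> V -> R) : (forall i, S i -> 0 <= m i) -> ctl x S m f df ->
  cctl S m (fun i z => (f i z)%:C) (fun i v => (df i v)%:C).
Proof.
by move=> m0 h; split => //; apply: (@ctl_scalar _ _ _ _ _ _ (fun=> 0)) => i Si; rewrite normr0 m0.
Qed.

Lemma ctl_reindex (I' : Type) (S' : set I') (h : I' -> I) m (f df : I -> V -> R) :
  (forall i, S' i -> S (h i)) -> ctl x S m f df ->
  ctl x S' (fun i => m (h i)) (fun i => f (h i)) (fun i => df (h i)).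
Proof.
move=> hS [c [c0 h1 h2 h3]]; exists c; split=> // [i Si|i Si|].
- exact/h1/hS.
- exact/h2/hS.
- by apply: filterS h3 => z hz i Si; apply/hz/hS.
Qed.

Lemma cctl_reindex (I' : Type) (S' : set I') (h : I' -> I) m f df :
  (forall i, S' i -> S (h i)) -> cctl S m f df ->
  cctl S' (fun i => m (h i)) (fun i => f (h i)) (fun i => df (h i)).
Proof. by move=> hS [h1 h2]; split; [exact: ctl_reindex h1 | exact: ctl_reindex h2]. Qed.

End Rules.
End ComplexFamilies.

Section Lie.
Variables (R : realType) (V : normedModType R) (x v0 : V) (dV : V -> V).
Local Notation C := R[i].

Section Fam.
Variables (I : Type) (S : set I).
Implicit Types (m : I -> R) (p : I -> V -> C) (al be : I -> V -> V -> C)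
  (ta : I -> V -> V -> V -> C) (la mu : C).

(** Controlled families of functions, 1-forms and 2-forms that are multiplied by
a complex number, their weight, by the Lie derivative at x along a field with
value v0 and differential dV.  Weights add up under products and wedges. *)
Definition fam0 m p mu : Prop := (forall i, S i -> 0 <= m i) /\ exists2 dp, cctl x S m p dp &
  forall i, S i -> dp i v0 = mu * p i x.

Definition fam1 m al la : Prop := (forall i, S i -> 0 <= m i) /\
  forall u, exists2 da, cctl x S m (fun i z => al i z u) da &
    forall i, S i -> da i v0 + al i x (dV u) = la * al i x u.

Definition fam2 m ta la : Prop := (forall i, S i -> 0 <= m i) /\
  forall u w, exists2 dt, cctl x S m (fun i z => ta i z u w) dt &
    forall i, S i -> dt i v0 + ta i x (dV u) w + ta i x u (dV w) = la * ta i x u w.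

Lemma fam0_le m m' p mu (c : R) : 0 <= c -> (forall i, S i -> 0 <= m' i) ->
  (forall i, S i -> m i <= c * m' i) -> fam0 m p mu -> fam0 m' p mu.
Proof. by move=> c0 m0 mm [_ [dp h1 h2]]; split=> //; exists dp => //; exact: cctl_le c0 mm h1. Qed.

Lemma fam2_le m m' ta la (c : R) : 0 <= c -> (forall i, S i -> 0 <= m' i) ->
  (forall i, S i -> m i <= c * m' i) -> fam2 m ta la -> fam2 m' ta la.
Proof.
move=> c0 m0 mm [_ h]; split=> // u w; have [dt h1 h2] := h u w.
by exists dt => //; exact: cctl_le c0 mm h1.
Qed.

Lemma fam0M m m' p q mu nu : fam0 m p mu -> fam0 m' q nu ->
  fam0 (fun i => m i * m' i) (fun i z => p i z * q i z) (mu + nu).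
Proof.
move=> [m0 [dp h1 h2]] [m0' [dq k1 k2]]; split.
  by move=> i Si; rewrite mulr_ge0 ?m0 ?m0'.
exists (fun i v => dp i v * q i x + p i x * dq i v); first exact: cctlM.
by move=> i Si; rewrite h2 // k2 //; ring.
Qed.

Lemma fam0J m p mu : fam0 m p mu -> fam0 m (fun i z => conjc (p i z)) (conjc mu).
Proof.
move=> [m0 [dp h1 h2]]; split=> //; exists (fun i v => conjc (dp i v)); first exact: cctlJ.
by move=> i Si; rewrite h2 // rmorphM.
Qed.

Lemma fam0_scalar m (a : I -> C) : (forall i, S i -> `|Re (a i)| <= m i) ->
  (forall i, S i -> `|Im (a i)| <= m i) -> fam0 m (fun i _ => a i) 0.
Proof.
move=> h1 h2; split; first by move=> i Si; apply: le_trans (h1 i Si).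
by exists (fun _ _ => 0) => [|i _]; [exact: cctl_scalar | rewrite mul0r].
Qed.

Lemma fam1M m m' p al mu la : fam0 m p mu -> fam1 m' al la ->
  fam1 (fun i => m i * m' i) (fun i z u => p i z * al i z u) (mu + la).
Proof.
move=> [m0 [dp h1 h2]] [m0' k]; split.
  by move=> i Si; rewrite mulr_ge0 ?m0 ?m0'.
move=> u; have [da k1 k2] := k u.
exists (fun i v => dp i v * al i x u + p i x * da i v); first exact: cctlM.
move=> i Si; rewrite h2 // -addrA -mulrDr k2 //; ring.
Qed.

Lemma fam1J m al la : fam1 m al la ->
  fam1 m (fun i z u => conjc (al i z u)) (conjc la).
Proof.
move=> [m0 k]; split=> // u; have [da k1 k2] := k u.
exists (fun i v => conjc (da i v)); first exact: cctlJ.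
by move=> i Si; rewrite -rmorphD k2 // rmorphM.
Qed.

Lemma fam1B m al be la : fam1 m al la -> fam1 m be la ->
  fam1 m (fun i z u => al i z u - be i z u) la.
Proof.
move=> [m0 h] [_ k]; split=> // u; have [da h1 h2] := h u; have [db k1 k2] := k u.
exists (fun i v => da i v - db i v); first by apply: cctlD => //; exact: cctlN.
by move=> i Si; rewrite mulrBr -h2 // -k2 //; ring.
Qed.

Lemma fam_wedge m m' al be la mu : fam1 m al la -> fam1 m' be mu ->
  fam2 (fun i => m i * m' i) (fun i z => wedge (al i z) (be i z)) (la + mu).
Proof.
move=> [m0 h] [m0' k]; have mm i : S i -> 0 <= m i * m' i.
  by move=> Si; rewrite mulr_ge0 ?m0 ?m0'.
split=> // u w.
have [au hu1 hu2] := h u; have [aw hw1 hw2] := h w.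
have [bu ku1 ku2] := k u; have [bw kw1 kw2] := k w.
eexists.
  apply: cctlD => //; first exact: cctlM m0 m0' hu1 kw1.
  by apply: cctlN; exact: cctlM m0 m0' hw1 ku1.
move=> i Si /=; rewrite /wedge.
have := hu2 i Si; have := hw2 i Si; have := ku2 i Si; have := kw2 i Si.
move=> /(canRL (addrK _)) -> /(canRL (addrK _)) -> /(canRL (addrK _)) -> /(canRL (addrK _)) ->.
ring.
Qed.

Lemma fam2M m m' p ta mu la : fam0 m p mu -> fam2 m' ta la ->
  fam2 (fun i => m i * m' i) (fun i z u w => p i z * ta i z u w) (mu + la).
Proof.
move=> [m0 [dp h1 h2]] [m0' k]; split.
  by move=> i Si; rewrite mulr_ge0 ?m0 ?m0'.
move=> u w; have [da k1 k2] := k u w.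
exists (fun i v => dp i v * ta i x u w + p i x * da i v); first exact: cctlM.
move=> i Si; rewrite h2 //.
transitivity (mu * p i x * ta i x u w
  + p i x * (da i v0 + ta i x (dV u) w + ta i x u (dV w))); first by ring.
by rewrite k2 //; ring.
Qed.

Lemma fam2D m ta tb la : fam2 m ta la -> fam2 m tb la ->
  fam2 m (fun i z u w => ta i z u w + tb i z u w) la.
Proof.
move=> [m0 h] [_ k]; split=> // u w; have [da h1 h2] := h u w; have [db k1 k2] := k u w.
exists (fun i v => da i v + db i v); first exact: cctlD.
by move=> i Si; rewrite mulrDr -h2 // -k2 //; ring.
Qed.

Lemma fam0_near m p q mu : (\forall z \near x, forall i, S i -> p i z = q i z) ->
  fam0 m p mu -> fam0 m q mu.
Proof.
move=> e [m0 [dp h1 h2]]; split=> //; exists dp; first exact: cctl_near h1.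
by move=> i Si; rewrite -(nbhs_singleton e) // h2.
Qed.

Lemma fam1_near m al be la : (\forall z \near x, forall i u, S i -> al i z u = be i z u) ->
  fam1 m al la -> fam1 m be la.
Proof.
move=> e [m0 h]; split=> // u; have [dt h1 h2] := h u.
exists dt; first by apply: cctl_near h1; apply: filterS e => z hz i Si; exact: hz.
move=> i Si; have ex := nbhs_singleton e; rewrite -!ex //; exact: h2.
Qed.

End Fam.

Lemma fam1_reindex (I I' : Type) (S : set I) (S' : set I') (h : I' -> I) m al la :
  (forall i, S' i -> S (h i)) -> fam1 S m al la ->
  fam1 S' (fun i => m (h i)) (fun i => al (h i)) la.
Proof.
move=> hS [m0 k]; split=> [i Si|u]; first exact/m0/hS.
have [da k1 k2] := k u; exists (fun i => da (h i)); first exact: cctl_reindex k1.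
by move=> i Si; apply/k2/hS.
Qed.

(** The analogue of fam2 for a single form, without any control. *)
Definition lie2 (ta : V -> V -> V -> C) (la : C) : Prop := forall u w, exists dt : V -> C,
  [/\ is_der (fun z => Re (ta z u w)) x (fun v => Re (dt v)),
      is_der (fun z => Im (ta z u w)) x (fun v => Im (dt v)) &
      dt v0 + ta x (dV u) w + ta x u (dV w) = la * ta x u w].

Lemma lie2_fam (I : Type) (S : set I) m ta la i : S i -> fam2 S m ta la -> lie2 (ta i) la.
Proof.
move=> Si [m0 h] u w; have [dt [[c1 [_ h1 _ _]] [c2 [_ h2 _ _]]] e] := h u w.
by exists (dt i); split; [exact: h1 | exact: h2 | exact: e].
Qed.

Lemma lie2D ta tb la : lie2 ta la -> lie2 tb la -> lie2 (fun z u w => ta z u w + tb z u w) la.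
Proof.
move=> h k u w; have [da [h1 h2 h3]] := h u w; have [db [k1 k2 k3]] := k u w.
exists (fun v => da v + db v); split.
- rewrite (_ : (fun z => _) = fun z => Re (ta z u w) + Re (tb z u w)); last first.
    by apply/funext => z; rewrite ReD.
  by apply: is_der_eqd (is_derD h1 k1) _ => v; rewrite ReD.
- rewrite (_ : (fun z => _) = fun z => Im (ta z u w) + Im (tb z u w)); last first.
    by apply/funext => z; rewrite ImD.
  by apply: is_der_eqd (is_derD h2 k2) _ => v; rewrite ImD.
- by rewrite mulrDr -h3 -k3; ring.
Qed.

Lemma lie2_0 la : lie2 (fun _ _ _ => 0) la.
Proof.
move=> u w; exists (fun=> 0); split; rewrite ?mulr0 ?addr0 //; exact: is_der_cst.
Qed.

Lemma lie2_sum (I : Type) (s : seq I) (ta : I -> V -> V -> V -> C) la :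
  (forall i, lie2 (ta i) la) -> lie2 (fun z u w => \sum_(i <- s) ta i z u w) la.
Proof.
move=> h; elim: s => [|i s IH].
  rewrite (_ : (fun z u w => _) = fun _ _ _ => 0); first exact: lie2_0.
  by apply/funext => z; apply/funext => u; apply/funext => w; rewrite big_nil.
rewrite (_ : (fun z u w => _) = fun z u w => ta i z u w + \sum_(j <- s) ta j z u w).
  exact: lie2D.
by apply/funext => z; apply/funext => u; apply/funext => w; rewrite big_cons.
Qed.

Lemma lie2Z (c : C) ta la : lie2 ta la -> lie2 (fun z u w => c * ta z u w) la.
Proof.
move=> h u w; have [da [h1 h2 h3]] := h u w.
exists (fun v => c * da v); split.
- rewrite (_ : (fun z => _) = fun z => Re c *: Re (ta z u w) - Im c *: Im (ta z u w)); last first.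
    by apply/funext => z; rewrite ReM.
  by apply: is_der_eqd (is_derB (is_derZ (Re c) h1) (is_derZ (Im c) h2)) _ => v; rewrite ReM.
- rewrite (_ : (fun z => _) = fun z => Re c *: Im (ta z u w) + Im c *: Re (ta z u w)); last first.
    by apply/funext => z; rewrite ImM.
  by apply: is_der_eqd (is_derD (is_derZ (Re c) h2) (is_derZ (Im c) h1)) _ => v; rewrite ImM.
- by rewrite mulrCA -h3; ring.
Qed.

Lemma lie2_near ta tb la : (\forall z \near x, forall u w, ta z u w = tb z u w) ->
  lie2 ta la -> lie2 tb la.
Proof.
move=> e h u w; have [da [h1 h2 h3]] := h u w; exists da; split.
- by apply: is_der_near h1; apply: filterS e => z hz; rewrite hz.
- by apply: is_der_near h2; apply: filterS e => z hz; rewrite hz.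
- by have ex := nbhs_singleton e; rewrite -!ex.
Qed.

Definition csm (I : Type) (sm : (I -> R) -> R) (f : I -> C) : C :=
  sm (fun i => Re (f i)) +i* sm (fun i => Im (f i)).

Section Csm.
Variables (I : choiceType) (S : set I) (sm : (I -> R) -> R) (m : I -> R).
Hypothesis smP : summing S sm m.

Definition cdominated (f : I -> C) : Prop :=
  dominated S m (fun i => Re (f i)) /\ dominated S m (fun i => Im (f i)).

Lemma csm_lin (a b : C) f h : cdominated f -> cdominated h ->
  csm sm (fun i => a * f i + b * h i) = a * csm sm f + b * csm sm h.
Proof.
move=> [f1 f2] [h1 h2]; have df := dominated_lin (Re a) (- Im a) f1 f2.
have dh := dominated_lin (Re b) (- Im b) h1 h2.
have df' := dominated_lin (Re a) (Im a) f2 f1.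
have dh' := dominated_lin (Re b) (Im b) h2 h1.
apply: complexP => /=.
  transitivity (1 * sm (fun i => Re a * Re (f i) + - Im a * Im (f i))
      + 1 * sm (fun i => Re b * Re (h i) + - Im b * Im (h i))).
    rewrite -(sm_lin smP) //; congr sm; apply/funext => i; rewrite !ReImE; ring.
  by rewrite !(sm_lin smP) // !ReImE /csm /=; ring.
transitivity (1 * sm (fun i => Re a * Im (f i) + Im a * Re (f i))
      + 1 * sm (fun i => Re b * Im (h i) + Im b * Re (h i))).
  rewrite -(sm_lin smP) //; congr sm; apply/funext => i; rewrite !ReImE; ring.
by rewrite !(sm_lin smP) // !ReImE /csm /=; ring.
Qed.

Lemma cctl_dominated f df : cctl x S m f df -> cdominated (f^~ x).
Proof.
by move=> [[c1 [_ _ h1 _]] [c2 [_ _ h2 _]]]; split; [exists c1 | exists c2].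
Qed.

Lemma ctl_near_dominated f df : ctl x S m f df -> \forall z \near x, dominated S m (f^~ z).
Proof.
move=> [c [c0 _ h2 h3]]; apply: filterS h3 => z hz.
exists (c * `|z - x| + c) => i Si; rewrite -[f i z](subrK (f i x)).
apply: le_trans (ler_normD _ _) _; rewrite mulrDl; apply: lerD; last exact: h2.
by apply: le_trans (hz i Si) _; rewrite -!mulrA [X in c * X]mulrC.
Qed.

Lemma cctl_near_dominated f df : cctl x S m f df -> \forall z \near x, cdominated (f^~ z).
Proof.
move=> [h1 h2]; have d1 := ctl_near_dominated h1; have d2 := ctl_near_dominated h2.
by apply: filterS2 d1 d2.
Qed.

(** By sm_der the derivative of the sum along V is the sum of the derivatives, so
that the weight equation may be checked term by term. *)
Lemma lie2_csm ta la : fam2 S m ta la -> lie2 (fun z u w => csm sm (fun i => ta i z u w)) la.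
Proof.
move=> [m0 h] u w; have [dt [d1 d2] e] := h u w.
have [du [u1 u2] _] := h (dV u) w; have [dw [w1 w2] _] := h u (dV w).
exists (fun v => csm sm (fun i => dt i v)); split.
- exact: (sm_der smP d1).
- exact: (sm_der smP d2).
have ddom : cdominated (fun i => dt i v0).
  have [c1 _ c1P] := ctl_der d1; have [c2 _ c2P] := ctl_der d2.
  split; [exists (c1 * `|v0|) | exists (c2 * `|v0|)] => i Si.
    by rewrite mulrAC; exact: c1P.
  by rewrite mulrAC; exact: c2P.
have udom := cctl_dominated (conj u1 u2); have wdom := cctl_dominated (conj w1 w2).
have tdom := cctl_dominated (conj d1 d2).
have lin3 : csm sm (fun i => 1 * (1 * dt i v0 + 1 * ta i x (dV u) w) + 1 * ta i x u (dV w))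
    = csm sm (fun i => dt i v0) + csm sm (fun i => ta i x (dV u) w)
      + csm sm (fun i => ta i x u (dV w)).
  rewrite csm_lin // ?csm_lin // ?mul1r //.
  have [[p1 p2] [q1 q2]] := (ddom, udom); split.
    have := dominated_lin 1 1 p1 q1; congr dominated; apply/funext => i; rewrite !ReImE /=; ring.
  have := dominated_lin 1 1 p2 q2; congr dominated; apply/funext => i; rewrite !ReImE /=; ring.
rewrite -lin3 -[RHS]addr0 -[X in _ = _ + X](mul0r (csm sm (fun i => ta i x u w))) -csm_lin //.
have eE i : S i -> 1 * (1 * dt i v0 + 1 * ta i x (dV u) w) + 1 * ta i x u (dV w) =
    la * ta i x u w + 0 * ta i x u w by move=> Si; rewrite !mul1r mul0r addr0 e.
have [t1 t2] := tdom.
apply: complexP => /=; apply/esym; apply: (sm_ext smP).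
- have := dominated_lin (Re la) (- Im la) t1 t2; congr dominated; apply/funext => i.
  rewrite !ReImE /=; ring.
- by move=> i Si; rewrite eE.
- have := dominated_lin (Re la) (Im la) t2 t1; congr dominated; apply/funext => i.
  rewrite !ReImE /=; ring.
- by move=> i Si; rewrite eE.
Qed.

End Csm.
End Lie.

Lemma lie2_is_clie (R : realType) (E : normedModType R) (V : E -> E) (B : E -> E -> E -> R[i]) z la :
  differentiable V z -> lie2 z (V z) (fun u => 'D_u V z) B la ->
  is_clie V B z (fun u w => la * B z u w).
Proof.
move=> dV h; split; split=> // u w; have [dt [[h1 h1'] [h2 h2'] h3]] := h u w; split=> //.
  by rewrite h1' -h3 !ReD.
by rewrite h2' -h3 !ImD.
Qed.

(** * Controlled families from phases, norms and Bessel functions *)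
Section Outer.
Variable R : realType.

Lemma is_derive_is_der (phi : R -> R) y c : is_derive y (1 : R) phi c -> is_der phi y (fun v => c * v).
Proof.
move=> [h1 h2]; have d : differentiable phi y by apply/derivable1_diffP.
split=> // v; rewrite deriveE // -[v]mulr1 -[v * 1]/(v *: (1 : R)) linearZ /= -deriveE // h2.
by rewrite /GRing.scale /= mulr1 mulrC.
Qed.

Lemma lip_of_derive (phi dphi : R -> R) : (forall y, is_derive y (1 : R) phi (dphi y)) ->
  (forall y, `|dphi y| <= 1) -> forall a b, `|phi a - phi b| <= `|a - b|.
Proof.
move=> hd hb a b; wlog ab : a b / b <= a.
  move=> H; have [ba|/ltW ab] := leP b a; first exact: H.
  by rewrite distrC [`|a - b|]distrC; exact: H.
have cont : {within `[b, a], continuous phi}.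
  by apply: derivable_within_continuous => t _; case: (hd t).
have [c _ ->] := MVT_segment ab (fun t _ => hd t) cont.
by rewrite normrM ler_piMl.
Qed.

Lemma exp_poly_bound (p : nat) (e : R) : 0 < e -> exists2 C : R, 0 <= C &
  forall x, 0 <= x -> x ^+ p * expR (- e * x) <= C.
Proof.
move=> e0; case: p => [|p].
  exists 1 => // x x0; rewrite mul1r -[leRHS]expR0 ler_expR mulNr oppr_le0.
  by rewrite mulr_ge0 // ltW.
exists (p.+1`!%:R / e ^+ p.+1) => [|x x0].
  by rewrite divr_ge0 // exprn_ge0 // ltW.
have ex : 0 <= e * x by rewrite mulr_ge0 // ltW.
have := expR_ge1Dxn p ex; rewrite exprMn mulNr expRN => h.
have f0 : (0 : R) < p.+1`!%:R by rewrite ltr0n fact_gt0.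
have ep : 0 < e ^+ p.+1 by rewrite exprn_gt0.
rewrite ler_pdivrMr ?expR_gt0 //.
have -> : x ^+ p.+1 = p.+1`!%:R / e ^+ p.+1 * (e ^+ p.+1 * x ^+ p.+1 / p.+1`!%:R).
  by field; rewrite !gt_eqF.
rewrite ler_wpM2l ?divr_ge0 ?(ltW ep) ?(ltW f0) //.
by apply: le_trans h; rewrite lerDr.
Qed.

(** Splits the decay in n |k|, with n = l + 1 >= 1 and |k| >= 1, into a decay in
|k| and a geometric one in l, for use with ctl_inner; the cube makes room for
three polynomial weights. *)
Lemma weight_bound (s : R) : 0 < s -> exists2 C : R, 0 <= C & forall (u : R) (l : nat), 1 <= u ->
  (l.+1%:R * u) ^+ 3 * expR (- s * (l.+1%:R * u)) <= C * (expR (- (s / 2) * u) * expR (- (s / 2)) ^+ l).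
Proof.
move=> s0; have s2 : 0 < s / 2 by rewrite divr_gt0.
have [C C0 hC] := exp_poly_bound 3 s2; exists C => // u l u1.
set v := l.+1%:R * u; have v0 : 0 <= v by rewrite mulr_ge0 // (le_trans ler01).
have -> : expR (- s * v) = expR (- (s / 2) * v) * expR (- (s / 2) * v).
  by rewrite -expRD; congr expR; field.
have h2 : expR (- (s / 2) * v) <= expR (- (s / 2) * u) * expR (- (s / 2)) ^+ l.
  rewrite -expRM_natl -expRD ler_expR [l%:R * _]mulrC -mulrDr !mulNr lerN2 ler_pM2l //.
  by rewrite /v -natr1 mulrDl mul1r addrC lerD2r ler_peMr.
rewrite mulrA; apply: ler_pM (hC v v0) h2; last exact: expR_ge0.
by apply: mulr_ge0; [exact: exprn_ge0 | exact: expR_ge0].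
Qed.

End Outer.

Section MoreCtl.
Variables (R : realType) (V : normedModType R) (x : V).

Lemma ctl_D (I : Type) (S : set I) m (f df : I -> V -> R) : ctl x S m f df ->
  ctl x S m f (fun i v => 'D_v (f i) x).
Proof.
move=> h; apply: ctl_eqd (h) _ => i v Si; have [c [_ /(_ i Si) [_ ->]]] := h.
by [].
Qed.

Lemma ctl_outer (I : Type) (S : set I) m (f df : I -> V -> R) (phi dphi : R -> R) :
  (forall y, is_derive y (1 : R) phi (dphi y)) -> (forall y, `|dphi y| <= 1) ->
  (forall y, `|phi y| <= 1) -> (forall i, S i -> 1 <= m i) -> ctl x S m f df ->
  ctl x S m (fun i z => phi (f i z)) (fun i v => dphi (f i x) * df i v).
Proof.
move=> hd hb hb' m1 [C [C0 h1 h2 h3]]; exists (C + 1); split.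
- by rewrite addr_ge0.
- by move=> i Si; exact: is_der_comp (h1 i Si) (is_derive_is_der (hd _)).
- move=> i Si; apply: le_trans (hb' _) _; rewrite mulrDl mul1r.
  by rewrite ler_wpDl ?m1 // mulr_ge0 // (le_trans ler01) ?m1.
- apply: filterS h3 => z hz i Si; apply: le_trans (lip_of_derive hd hb _ _) _.
  apply: le_trans (hz i Si) _; rewrite ler_wpM2r // mulrDl lerDl mul1r.
  by rewrite (le_trans ler01) ?m1.
Qed.

Lemma normcD (z w : R[i]) : normc (z + w) <= normc z + normc w.
Proof. exact: (@le_normcD R z w). Qed.

Lemma normcB (z w : R[i]) : normc (w - z) = normc (z - w).
Proof. by rewrite -(opprB z w); exact: (@normcN R (z - w)). Qed.

Lemma normc_dist (z w : R[i]) : `|normc z - normc w| <= normc (z - w).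
Proof.
have h1 : normc z <= normc (z - w) + normc w.
  by apply: le_trans (normcD _ _); rewrite subrK.
have h2 : normc w <= normc (z - w) + normc z.
  rewrite -normcB.
  by apply: le_trans (normcD _ _); rewrite subrK.
by rewrite ler_norml; apply/andP; split; lra.
Qed.

Lemma ctl_normc (I : Type) (S : set I) m (f g df dg : I -> V -> R) :
  (forall i, S i -> 0 <= m i) ->
  (forall i, S i -> 0 < normc (f i x +i* g i x)) -> ctl x S m f df -> ctl x S m g dg ->
  ctl x S m (fun i z => normc (f i z +i* g i z))
   (fun i v => (f i x * df i v + g i x * dg i v) / normc (f i x +i* g i x)).
Proof.
move=> m0 fg [C [C0 h1 h2 h3]] [D [D0 k1 k2 k3]]; exists (C + D); split.
- by rewrite addr_ge0.
- move=> i Si; have hq := is_derD (is_derM (h1 i Si) (h1 i Si)) (is_derM (k1 i Si) (k1 i Si)).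
  have q0 : 0 < f i x * f i x + g i x * g i x.
    by have := fg i Si; rewrite /= sqrtr_gt0 !expr2.
  have hs := is_derive_is_der (is_derive1_sqrt q0).
  apply: (is_der_near (f := fun z => Num.sqrt (f i z * f i z + g i z * g i z))).
    by near=> z; rewrite /= !expr2.
  apply: is_der_eqd (is_der_comp hq hs) _ => v /=; rewrite !expr2.
  have sn : Num.sqrt (f i x * f i x + g i x * g i x) != 0 by rewrite gt_eqF // sqrtr_gt0.
  by field.
- move=> i Si; rewrite ger0_norm ?sqrtr_ge0 // mulrDl.
  by apply: le_trans (normc_le _ _) _; apply: lerD; [exact: h2 | exact: k2].
- apply: filterS2 h3 k3 => z hz kz i Si; apply: le_trans (normc_dist _ _) _.
  apply: le_trans (normc_le _ _) _; rewrite !mulrDl.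
  by apply: lerD; [exact: hz | exact: kz].
Unshelve. all: by end_near. Qed.

Lemma ctl_inv (I : Type) (S : set I) m (f df : I -> V -> R) (c : R) :
  0 < c -> (forall i, S i -> 1 <= m i) ->
  (\forall z \near x, forall i, S i -> c <= f i z) -> ctl x S m f df ->
  ctl x S m (fun i z => (f i z)^-1) (fun i v => - (f i x)^-2 * df i v).
Proof.
move=> c0 m1 fc [C [C0 h1 h2 h3]]; have fx := nbhs_singleton fc.
have f0 i : S i -> 0 < f i x by move=> Si; apply: lt_le_trans c0 (fx i Si).
exists (C / c ^+ 2 + c^-1); split.
- by rewrite addr_ge0 ?invr_ge0 ?divr_ge0 // ?ltW // exprn_gt0.
- by move=> i Si; apply: is_derV; [exact: h1 | rewrite gt_eqF // f0].
- move=> i Si; have fi0 := f0 i Si; have m0 : 0 <= m i by rewrite (le_trans ler01) ?m1.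
  have h0 : 0 <= C / c ^+ 2 * m i by rewrite mulr_ge0 // divr_ge0 // exprn_ge0 // ltW.
  rewrite ger0_norm; last by rewrite invr_ge0 ltW.
  rewrite mulrDl; apply: ler_wpDl => //.
  apply: (@le_trans _ _ c^-1); first by rewrite lef_pV2 ?posrE // fx.
  by rewrite ler_peMr ?m1 // invr_ge0 ltW.
- apply: filterS2 fc h3 => z cz hz i Si.
  have fz0 : 0 < f i z by apply: lt_le_trans c0 (cz i Si).
  have -> : (f i z)^-1 - (f i x)^-1 = - ((f i z - f i x) / (f i z * f i x)).
    by field; rewrite !gt_eqF // f0.
  rewrite normrN normrM normfV [X in _ / X]ger0_norm; last by rewrite mulr_ge0 // ltW // f0.
  apply: (@le_trans _ _ (C * m i * `|z - x| / c ^+ 2)).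
    apply: ler_pM => //; first by rewrite invr_ge0 mulr_ge0 // ltW // f0.
      exact: hz.
    rewrite lef_pV2 ?posrE ?mulr_gt0 ?f0 ?exprn_gt0 // expr2.
    by apply: ler_pM; rewrite ?(ltW c0) // ?cz ?fx.
  rewrite !mulrDl -!mulrA; rewrite (mulrA C) -[leLHS]addr0; apply: lerD.
    by rewrite le_eqVlt; apply/orP; left; apply/eqP; ring.
  by rewrite !mulr_ge0 // ?invr_ge0 ?(ltW c0) // (le_trans ler01) ?m1.
Qed.

(** A lower bound proportional to the weights survives, halved, near x. *)
Lemma ctl_lower (I : Type) (S : set I) m (f df : I -> V -> R) (c : R) :
  0 < c -> (forall i, S i -> 0 <= m i) -> (forall i, S i -> c * m i <= f i x) -> ctl x S m f df ->
  \forall z \near x, forall i, S i -> c / 2 * m i <= f i z.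
Proof.
move=> c0 m0 fc [C [C0 h1 h2 h3]].
have e0 : 0 < c / 2 / (C + 1) by rewrite !divr_gt0 // ltr_wpDl.
have nr : \forall z \near x, `|z - x| <= c / 2 / (C + 1).
  apply: filterS (nbhsx_ballx x _ e0) => z; rewrite -ball_normE /= distrC.
  exact: ltW.
apply: filterS2 nr h3 => z hz hz' i Si.
have h : C * m i * `|z - x| <= c / 2 * m i.
  apply: (@le_trans _ _ ((C + 1) * m i * (c / 2 / (C + 1)))).
    apply: ler_pM => //; first by rewrite mulr_ge0 // m0.
    by rewrite ler_wpM2r ?m0 // lerDl.
  by rewrite mulrC mulrA divfK // gt_eqF // ltr_wpDl.
have := le_trans (hz' i Si) h; rewrite ler_norml => /andP[h' _].
have := fc i Si; lra.
Qed.

(** The Lipschitz bound of besselK_bound must be taken at the lower bound c m of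
the argument and not at a fixed e: this is what gives exponentially small
weights. *)
Lemma ctl_besselK (I : Type) (S : set I) (nu : nat) (m : I -> R) (f df : I -> V -> R) (c : R) :
  (nu <= 1)%N -> 0 < c -> (forall i, S i -> 1 <= m i) ->
  (\forall z \near x, forall i, S i -> c * m i <= f i z) -> ctl x S m f df ->
  ctl x S (fun i => m i * expR (- (c / 2) * m i)) (fun i z => besselK nu (f i z))
   (fun i v => 'D_v (fun z => besselK nu (f i z)) x).
Proof.
move=> n1 c0 m1 fc [C [C0 h1 h2 h3]]; have fx := nbhs_singleton fc.
have [D D0 [hD1 hD2]] := besselK_bound n1 c0.
have cm i : S i -> c <= c * m i by move=> Si; rewrite ler_peMr ?m1 // ltW.
have ee (y : R) : expR (- (c / 2) * y) = expR (- (c * y) / 2) by congr expR; ring.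
exists (D * (C + 1)); split.
- by rewrite mulr_ge0 // addr_ge0.
- move=> i Si; apply: differentiable_der; apply: differentiable_comp; first by case: (h1 i Si).
  apply: differentiable_besselK => //.
  exact: lt_le_trans c0 (le_trans (cm i Si) (fx i Si)).
- move=> i Si; have m1' := m1 i Si.
  apply: le_trans (hD1 _ (le_trans (cm i Si) (fx i Si))) _.
  apply: (@le_trans _ _ (D * expR (- (c / 2) * m i))).
    rewrite ler_wpM2l // ee ler_expR ler_pM2r ?invr_gt0 // lerN2; exact: fx.
  rewrite -[leRHS]mulrA ler_wpM2l //.
  rewrite mulrA ler_peMl ?expR_ge0 //.
  by have : 0 <= C * m i; [rewrite mulr_ge0 // (le_trans ler01) | rewrite mulrDl mul1r; lra].
- apply: filterS2 fc h3 => z cz hz i Si.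
  apply: le_trans (hD2 _ _ _ (cm i Si) (cz i Si) (fx i Si)) _.
  rewrite -ee; apply: (@le_trans _ _ (D * expR (- (c / 2) * m i) * (C * m i * `|z - x|))).
    by rewrite ler_wpM2l ?hz // mulr_ge0 // expR_ge0.
  apply: (@le_trans _ _ (D * (C * (m i * expR (- (c / 2) * m i))) * `|z - x|)).
    by rewrite le_eqVlt; apply/orP; left; apply/eqP; ring.
  rewrite ler_wpM2r // -mulrA ler_wpM2l // ler_wpM2r ?lerDl //.
  by rewrite mulr_ge0 ?expR_ge0 // (le_trans ler01) ?m1.
Qed.

End MoreCtl.

Section Inner.
Variables (R : realType) (V : normedModType R) (x v0 : V).

Lemma fam0_inner (I : Type) (S : set I) (L : choiceType) (T : set L) sm (m : I -> R) q
    (p : I * L -> V -> R[i]) :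
  summing T sm q -> (forall i, S i -> 0 <= m i) ->
  fam0 x v0 (S `*` T) (fun j => m j.1 * q j.2) p 0 ->
  fam0 x v0 S m (fun i z => csm sm (fun l => p (i, l) z)) 0.
Proof.
move=> smP m0 [_ [dp [h1 h2] h3]]; split=> //.
exists (fun i v => csm sm (fun l => dp (i, l) v)).
  by split; [exact: ctl_inner smP m0 h1 | exact: ctl_inner smP m0 h2].
have d0 : dominated T q (fun=> 0) by exists 0 => l _; rewrite normr0 mul0r.
have sm0 : sm (fun=> 0) = 0.
  transitivity (0 * sm (fun=> 0) + 0 * sm (fun=> 0)); last by rewrite !mul0r addr0.
  by rewrite -(sm_lin smP) //; congr sm; apply/funext => l; rewrite mul0r addr0.
move=> i Si; rewrite mul0r /csm; apply: complexP => /=; rewrite -[RHS]sm0; apply/esym.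
  by apply: (sm_ext smP d0) => l Tl; rewrite h3 // mul0r.
by apply: (sm_ext smP d0) => l Tl; rewrite h3 // mul0r.
Qed.

End Inner.

Lemma cexpiE (R : realType) (t r : R) : cexpi t * r%:C = (cos t * r) +i* (sin t * r).
Proof. by apply: complexP; rewrite !ReImE /=; ring. Qed.

(** * Weights of the forms on the total space *)
Section LinearFamilies.
Variables (R : realType) (V : normedModType R) (x : V) (n : nat).
Local Notation K := 'rV[int]_(n + n).

(** Quantities depending linearly on the lattice class are controlled by the l1
norm, as integral combinations of finitely many functions. *)
Lemma ctl_integer_comb (F : 'I_(n + n) -> V -> R) (f : K -> V -> R) :
  (forall r, differentiable (F r) x) ->
  (forall k z, f k z = \sum_r (k 0 r)%:~R * F r z) ->
  ctl x setT (@l1 R n) f (fun k v => 'D_v (f k) x).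
Proof.
move=> hF fE.
suff h : ctl x setT (@l1 R n) (fun k z => \sum_r (k 0 r)%:~R * F r z)
    (fun k v => \sum_r (0 * F r x + (k 0 r)%:~R * 'D_v (F r) x)).
  by apply: (ctl_D (ctl_ext _ (fun _ _ => erefl) h)) => k z; rewrite fE.
apply: ctl_sum => [k _|r _]; first exact: l1_ge0.
have h1 : ctl x setT (@l1 R n) (fun k (_ : V) => (k 0 r)%:~R) (fun _ _ => 0).
  apply: ctl_scalar => k _; rewrite /l1 (bigD1 r) //= lerDl; exact: sumr_ge0.
have h2 := ctl_cst [set: K] (differentiable_der (hF r)).
have := ctlM (fun k _ => l1_ge0 R k) (fun _ _ => ler01) h1 h2.
by apply: ctl_le (ler01) _ => k _; rewrite mulr1 mul1r.
Qed.

End LinearFamilies.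

Section AtPoint.
Variables (R : realType) (n : nat) (M : manifold R (n + n)).
Notation E := 'rV[R]_(n + n).
Notation TE := 'rV[R]_((n + n) + (n + n)).
Local Notation K := 'rV[int]_(n + n).
Local Notation C := R[i].
Variables (g om : form2 M) (J : endo M) (D nab : connection M) (xi : vfield M).
Variables (Lam : idx M -> E -> set E) (Om : idx M -> E -> E -> int).
Hypothesis hM : cask g om J D nab xi.
Hypothesis hOm : bps_structure om J nab xi Lam Om.
Variables (i : idx M) (W : set E) (a b : 'I_n -> E -> E).
Hypothesis df : darboux_frame om nab Lam i W a b.
Variable z0 : TE.
Hypothesis Wz : W (base z0).

Local Notation ls k := (lsec a b k).
Local Notation zr k := (rez om xi i (ls k)).
Local Notation zi k := (imz om J xi i (ls k)).
Local Notation th k := (angle (ls k)).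
Local Notation dzr k := (drez om i (ls k)).
Local Notation dzi k := (dimz om J i (ls k)).
Local Notation dth k := (dangle nab i (ls k)).
Local Notation V := (hlift J nab xi i).
Local Notation v0 := (V z0).
Local Notation dV := (fun u => 'D_u V z0).
Local Notation l1 := (@l1 R n).
Local Notation S := (active Om i a b (base z0)).
Local Notation fam0 := (fam0 z0 v0).
Local Notation fam1 := (fam1 z0 v0 dV).
Local Notation fam2 := (fam2 z0 v0 dV).
Local Notation lie2 := (lie2 z0 v0 dV).
Let Wi : W `<=` img i := df_sub df.
Let Wo : open W := df_open df.
Let sf k : flat_section nab i W (ls k) := lsec_flat df k.

Lemma near_W : \forall z \near z0, W (base z).
Proof. exact: base_open. Qed.

Lemma ZE k z : Z om J xi i a b k z = zr k z +i* zi k z.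
Proof. by rewrite /Z central_chargeE. Qed.

Lemma dZE k z u : W (base z) -> dZ om J xi i a b k z u = dzr k z u +i* dzi k z u.
Proof.
move=> Wz'; rewrite /dZ /cdiff; congr (_ +i* _).
  rewrite -(rez_der hM Wi (sf k) Wz').2; congr ('D_u _ z).
  by apply/funext => y; rewrite ZE.
rewrite -(imz_der hM Wi (sf k) Wz').2; congr ('D_u _ z).
by apply/funext => y; rewrite ZE.
Qed.

Lemma dthetaE k z u : W (base z) -> dtheta a b k z u = (dth k z u)%:C.
Proof. by move=> Wz'; rewrite /dtheta -(angle_der (sf k) Wz').2. Qed.

Lemma ev2_lsec (B : 'M[R]_(n + n)) (u y : E) k :
  ev2 B u (ls k y) = \sum_r (k 0 r)%:~R * ev2 B u (frame a b r y).
Proof. by rewrite lsecE ev2_sumr. Qed.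

Lemma dotp_lsec (p y : E) k : dotp (ls k y) p = \sum_r (k 0 r)%:~R * dotp (frame a b r y) p.
Proof.
rewrite lsecE; apply: (big_ind2 (fun p' q => dotp p' p = q)).
- exact: dotp0l.
- by move=> ? ? ? ? <- <-; exact: dotpDl.
- by move=> r _; exact: dotpZl.
Qed.

Lemma ctl_zr : ctl z0 setT l1 (fun k => zr k) (fun k => dzr k z0).
Proof.
apply: ctl_eqd (ctl_integer_comb (F := fun r => rez om xi i (frame a b r)) _ _) _.
- by move=> r; case: (rez_der hM Wi (frame_flat df r) Wz).
- by move=> k z; exact: ev2_lsec.
- by move=> k v _; exact: (rez_der hM Wi (sf k) Wz).2.
Qed.

Lemma ctl_zi : ctl z0 setT l1 (fun k => zi k) (fun k => dzi k z0).
Proof.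
apply: ctl_eqd (ctl_integer_comb (F := fun r => imz om J xi i (frame a b r)) _ _) _.
- by move=> r; case: (imz_der hM Wi (frame_flat df r) Wz).
- by move=> k z; rewrite /imz ev2_lsec -sumrN; apply: eq_bigr => r _; rewrite mulrN.
- by move=> k v _; exact: (imz_der hM Wi (sf k) Wz).2.
Qed.

Lemma ctl_th : ctl z0 setT l1 (fun k => th k) (fun k => dth k z0).
Proof.
apply: ctl_eqd (ctl_integer_comb (F := fun r => angle (frame a b r)) _ _) _.
- by move=> r; case: (angle_der (frame_flat df r) Wz).
- by move=> k z; rewrite /angle dotp_lsec mulr_sumr; apply: eq_bigr => r _; rewrite mulrCA.
- by move=> k v _; exact: (angle_der (sf k) Wz).2.
Qed.

Lemma ctl_dzr u : ctl z0 setT l1 (fun k z => dzr k z u) (fun k v => 'D_v (fun z => dzr k z u) z0).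
Proof.
apply: (ctl_integer_comb (F := fun r z => drez om i (frame a b r) z u)).
- by move=> r; case: (drez_lie hM Wi (frame_flat df r) Wz u).
- by move=> k z; exact: ev2_lsec.
Qed.

Lemma ctl_dzi u : ctl z0 setT l1 (fun k z => dzi k z u) (fun k v => 'D_v (fun z => dzi k z u) z0).
Proof.
apply: (ctl_integer_comb (F := fun r z => dimz om J i (frame a b r) z u)).
- by move=> r; case: (dimz_lie hM Wo Wi (frame_flat df r) Wz u).
- by move=> k z; rewrite /dimz ev2_lsec -sumrN; apply: eq_bigr => r _; rewrite mulrN.
Qed.

Lemma ctl_dth u : ctl z0 setT l1 (fun k z => dth k z u) (fun k v => 'D_v (fun z => dth k z u) z0).
Proof.
apply: (ctl_integer_comb (F := fun r z => dangle nab i (frame a b r) z u)).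
- by move=> r; case: (dangle_lie hM Wi (frame_flat df r) Wz u).
- move=> k z; rewrite /dangle dotp_lsec; have -> : dotp (chr nab i (base z) (base u) (ls k (base z))) (fibre z)
     = \sum_r (k 0 r)%:~R * dotp (chr nab i (base z) (base u) (frame a b r (base z))) (fibre z).
    rewrite lsecE; apply: (big_ind2 (fun p q => dotp (chr nab i (base z) (base u) p) (fibre z) = q)).
    + by rewrite chrE mul0mx dotp0l.
    + by move=> ? ? ? ? <- <-; rewrite !chrE mulmxDl dotpDl.
    + by move=> r _; rewrite !chrE -scalemxAl dotpZl.
  by rewrite -sumrB mulr_sumr; apply: eq_bigr => r _; ring.
Qed.

Lemma fam0_Z : fam0 setT l1 (fun k z => zr k z +i* zi k z) ii.
Proof.
split; first by move=> k _; exact: l1_ge0.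
exists (fun k v => dzr k z0 v +i* dzi k z0 v); first by split; [exact: ctl_zr | exact: ctl_zi].
move=> k _; rewrite drez_hlift (dimz_hlift hM _ Wi Wz).
by apply: complexP; rewrite !ReImE /=; ring.
Qed.

Lemma fam1_dZ : fam1 setT l1 (fun k z u => dzr k z u +i* dzi k z u) ii.
Proof.
split; first by move=> k _; exact: l1_ge0.
move=> u; exists (fun k v => 'D_v (fun z => dzr k z u) z0 +i* 'D_v (fun z => dzi k z u) z0).
  by split; [exact: ctl_dzr | exact: ctl_dzi].
move=> k _; have [_ h1] := drez_lie hM Wi (sf k) Wz u.
have [_ h2] := dimz_lie hM Wo Wi (sf k) Wz u.
by apply: complexP; rewrite !ReImE /= ?h1 ?h2; ring.
Qed.

Lemma fam1_dth : fam1 setT l1 (fun k z u => (dth k z u)%:C) 0.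
Proof.
split; first by move=> k _; exact: l1_ge0.
move=> u; exists (fun k v => ('D_v (fun z => dth k z u) z0)%:C).
  by apply: cctl_real; [move=> k _; exact: l1_ge0 | exact: ctl_dth].
move=> k _; have [_ h1] := dangle_lie hM Wi (sf k) Wz u.
by apply: complexP; rewrite !ReImE /= ?h1; ring.
Qed.

Lemma ctl_sub (I : Type) (T T' : set I) (m : I -> R) (f f' : I -> TE -> R) : T' `<=` T -> ctl z0 T m f f' -> ctl z0 T' m f f'.
Proof. by move=> TT h; exact: (ctl_reindex (h := id) TT h). Qed.

Local Notation nz k z := (normc (zr k z +i* zi k z)).
Local Notation dnz := (fun k v => (zr k z0 * dzr k z0 v + zi k z0 * dzi k z0 v) / nz k z0).

Lemma l1_ge1S k : S k -> 1 <= l1 k.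
Proof. exact: (l1_ge1 hM hOm df Wz). Qed.

Lemma l1_ge0' (T : set K) k : T k -> 0 <= l1 k. Proof. by move=> _; exact: l1_ge0. Qed.

Lemma nz_lower : exists2 c : R, 0 < c & forall k, S k -> c * l1 k <= nz k z0.
Proof.
have [c c0 hc] := active_bound hM hOm df Wz; exists c => // k /hc /ltW.
by rewrite /zval central_chargeE.
Qed.

Lemma ctl_nz : ctl z0 S l1 (fun k z => nz k z) dnz.
Proof.
have [c c0 hc] := nz_lower; apply: ctl_normc.
- exact: l1_ge0'.
- move=> k Sk; apply: lt_le_trans (hc k Sk).
  by rewrite mulr_gt0 // (lt_le_trans ltr01) // l1_ge1S.
- by apply: ctl_sub ctl_zr.
- by apply: ctl_sub ctl_zi.
Qed.

(** A rotation preserves the modulus. *)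
Lemma dnz_v0 k : dnz k v0 = 0.
Proof.
rewrite /= drez_hlift (dimz_hlift hM _ Wi Wz) (_ : _ + _ = 0) ?mul0r //; ring.
Qed.

Lemma nz_lower_near : exists2 c : R, 0 < c & \forall z \near z0, forall k, S k -> c * l1 k <= nz k z.
Proof.
have [c c0 hc] := nz_lower; exists (c / 2); first by rewrite divr_gt0.
by apply: (ctl_lower c0 _ hc ctl_nz); exact: l1_ge0'.
Qed.

Lemma fam0_nz : fam0 S l1 (fun k z => (nz k z)%:C) 0.
Proof.
split; first exact: l1_ge0'.
exists (fun k v => (dnz k v)%:C); first by apply: cctl_real; [exact: l1_ge0' | exact: ctl_nz].
by move=> k Sk; rewrite dnz_v0 mul0r.
Qed.

Lemma fam0_nzV : fam0 S l1 (fun k z => ((nz k z)^-1)%:C) 0.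
Proof.
have [c c0 hc] := nz_lower_near; split; first exact: l1_ge0'.
exists (fun k v => (- (nz k z0)^-2 * dnz k v)%:C).
  apply: cctl_real; first exact: l1_ge0'.
  apply: (ctl_inv c0 l1_ge1S _ ctl_nz); apply: filterS hc => z hz k Sk.
  by apply: le_trans (hz k Sk); rewrite ler_peMr ?l1_ge1S // ltW.
by move=> k Sk; rewrite dnz_v0 mulr0 mul0r.
Qed.

(* A pair p = (k, l) is a class of the lattice and the index of the term n = l + 1
   of its series. *)
Local Notation arg p z := (2 * pi * p.2.+1%:R * nz p.1 z).
Local Notation wt := (fun p : K * nat => p.2.+1%:R * l1 p.1).

Lemma wt_ge1 p : (S `*` setT) p -> 1 <= wt p.
Proof.
move=> [Sp _]; rewrite -[leLHS]mulr1; apply: ler_pM => //; last exact: l1_ge1S.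
by rewrite ler1n.
Qed.

Lemma ctl_scaled (c : R) (f f' : K -> TE -> R) : 0 <= c -> ctl z0 S l1 f f' ->
  ctl z0 (S `*` setT) wt (fun p z => c * p.2.+1%:R * f p.1 z) (fun p v => c * p.2.+1%:R * f' p.1 v).
Proof.
move=> c0 h.
have h1 : ctl z0 (S `*` setT) (fun p : K * nat => l1 p.1) (fun p => f p.1) (fun p => f' p.1).
  exact: (ctl_reindex (h := @fst K nat) (S' := S `*` setT) (fun p hp => hp.1) h).
have h2 : ctl z0 (S `*` setT) (fun p : K * nat => c * p.2.+1%:R)
    (fun (p : K * nat) (_ : TE) => c * p.2.+1%:R) (fun _ _ => 0).
  by apply: ctl_scalar => p _; rewrite ger0_norm // mulr_ge0.
have h3 : forall p : K * nat, (S `*` setT) p -> 0 <= c * p.2.+1%:R.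
  by move=> p _; rewrite mulr_ge0.
have := ctlM h3 (fun p _ => l1_ge0 R p.1) h2 h1.
move=> /(ctl_le c0 (m' := wt)) h4.
apply: ctl_eqd (h4 _) _ => [p _|p v _]; first by rewrite mulrA.
by rewrite mul0r add0r.
Qed.

Lemma fam0_phase : fam0 (S `*` setT) wt (fun p z => cexpi (p.2.+1%:R * th p.1 z)) 0.
Proof.
split; first by move=> p Sp; apply: le_trans (wt_ge1 Sp).
have h := ctl_scaled ler01 (ctl_sub (@subsetT _ S) ctl_th).
have hs : ctl z0 (S `*` setT) wt (fun p z => p.2.+1%:R * th p.1 z) (fun p v => p.2.+1%:R * dth p.1 z0 v).
  by apply: ctl_ext h => p v; rewrite mul1r.
exists (fun p v => (- sin (p.2.+1%:R * th p.1 z0) * (p.2.+1%:R * dth p.1 z0 v))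
    +i* (cos (p.2.+1%:R * th p.1 z0) * (p.2.+1%:R * dth p.1 z0 v))).
  split.
    apply: (ctl_outer (phi := cos) (dphi := fun y => - sin y) _ _ _ wt_ge1 hs) => y.
      by rewrite normrN sin_max.
    exact: cos_max.
  by apply: (ctl_outer (phi := sin) (dphi := cos) _ _ _ wt_ge1 hs) => y; rewrite ?cos_max ?sin_max.
by move=> p _; rewrite dangle_hlift !mulr0 mul0r.
Qed.

Lemma fam0_bessel nu : (nu <= 1)%N -> exists2 s : R, 0 < s &
  fam0 (S `*` setT) (fun p => wt p * expR (- s * wt p))
    (fun p z => (besselK nu (arg p z))%:C) 0.
Proof.
move=> n1; have [c c0 hc] := nz_lower_near.
have p2 : 0 < 2 * pi * c :> R by rewrite !mulr_gt0 // pi_gt0.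
have tp : 0 <= 2 * pi :> R by rewrite mulr_ge0 // pi_ge0.
have w0 p : (S `*` setT) p -> 0 <= wt p * expR (- (2 * pi * c / 2) * wt p).
  by move=> Sp; rewrite mulr_ge0 ?expR_ge0 // (le_trans ler01) // wt_ge1.
exists (2 * pi * c / 2); first by rewrite divr_gt0.
split=> //.
have hctl := ctl_scaled tp ctl_nz.
have hlow : \forall z \near z0, forall p, (S `*` setT) p -> 2 * pi * c * wt p <= arg p z.
  apply: filterS hc => z hz [k l] [/= Sk _].
  have := hz k Sk; set y := normc _ => hy.
  rewrite (_ : _ * (_ * _) = 2 * pi * l.+1%:R * (c * l1 k)); last by ring.
  by rewrite ler_wpM2l // mulr_ge0.
have h := ctl_besselK n1 p2 wt_ge1 hlow hctl.
exists (fun p v => ('D_v (fun z => besselK nu (arg p z)) z0)%:C).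
  by apply: cctl_real.
move=> p Sp; rewrite mul0r.
have [C1 [_ hd _ _]] := hctl.
have ax : 0 < arg p z0.
  apply: lt_le_trans (nbhs_singleton hlow p Sp); rewrite mulr_gt0 //.
  exact: lt_le_trans (wt_ge1 Sp).
have := is_der_comp (hd p Sp) (differentiable_der (differentiable_besselK n1 ax)).
case=> _ ->; rewrite dnz_v0 mulr0.
have [_ dZ _] := is_der_linear (differentiable_der (differentiable_besselK n1 ax)).
by have := dZ 0 0; rewrite !scale0r => ->.
Qed.

Definition ser0 k z : C :=
  csm (fun f => limn (series f)) (fun l => cexpi (l.+1%:R * th k z) * (besselK 0 (arg (k, l) z))%:C).
Definition ser1 k z : C :=
  csm (fun f => limn (series f)) (fun l => cexpi (l.+1%:R * th k z) * (nz k z * besselK 1 (arg (k, l) z))%:C).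

Lemma summing_geom (s : R) : 0 < s ->
  summing setT (fun f => limn (series f)) (fun l => expR (- s) ^+ l).
Proof.
move=> s0; apply: summing_series => [l|]; first by rewrite exprn_ge0 // expR_ge0.
have := @is_cvg_geometric_series R 1 (expR (- s)).
rewrite (_ : geometric 1 (expR (- s)) = fun l => expR (- s) ^+ l); last first.
  by apply/funext => l; rewrite /geometric /= mul1r.
by apply; rewrite ger0_norm ?expR_ge0 // -expR0 ltr_expR oppr_lt0.
Qed.

Lemma fam0_term0 : exists2 s : R, 0 < s & fam0 (S `*` setT)
   (fun p => expR (- s * l1 p.1) * expR (- s) ^+ p.2)
   (fun p z => cexpi (p.2.+1%:R * th p.1 z) * (besselK 0 (arg p z))%:C) 0.
Proof.
have [s s0 hb] := fam0_bessel (leq0n 1).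
have [c c0 hc] := weight_bound s0; exists (s / 2); first by rewrite divr_gt0.
have h := fam0M fam0_phase hb; rewrite addr0 in h.
apply: fam0_le c0 _ _ h => [p _|p Sp]; first by rewrite mulr_ge0 ?exprn_ge0 ?expR_ge0.
have [Sk _] := Sp; apply: le_trans (hc _ p.2 (l1_ge1S Sk)); have w1 := wt_ge1 Sp.
rewrite mulrA ler_pM2r ?expR_gt0 // -expr2.
by rewrite [in leRHS]exprSr ler_peMr ?sqr_ge0.
Qed.

Lemma fam0_term1 : exists2 s : R, 0 < s & fam0 (S `*` setT)
   (fun p => expR (- s * l1 p.1) * expR (- s) ^+ p.2)
   (fun p z => cexpi (p.2.+1%:R * th p.1 z) * (nz p.1 z * besselK 1 (arg p z))%:C) 0.
Proof.
have [s s0 hb] := fam0_bessel (leqnn 1).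
have [c c0 hc] := weight_bound s0; exists (s / 2); first by rewrite divr_gt0.
have hn : fam0 (S `*` setT) (fun p : K * nat => l1 p.1) (fun p z => (nz p.1 z)%:C) 0.
  have [h0 [dp h1 h2]] := fam0_nz; split=> [p _|]; first exact: l1_ge0.
  exists (fun p => dp p.1); last by move=> p [Sp _]; exact: h2.
  exact: (cctl_reindex (h := @fst K nat) (S' := S `*` setT) (fun p hp => hp.1) h1).
have h := fam0M fam0_phase (fam0M hn hb); rewrite !addr0 in h.
have h' : fam0 (S `*` setT)
   (fun p => expR (- (s / 2) * l1 p.1) * expR (- (s / 2)) ^+ p.2)
   (fun p z => cexpi (p.2.+1%:R * th p.1 z) * ((nz p.1 z)%:C * (besselK 1 (arg p z))%:C)) 0.
  apply: fam0_le c0 _ _ h => [p _|p Sp]; first by rewrite mulr_ge0 ?exprn_ge0 ?expR_ge0.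
  have [Sk _] := Sp; apply: le_trans (hc _ p.2 (l1_ge1S Sk)); have w1 := wt_ge1 Sp.
  have w0 : 0 <= wt p by rewrite (le_trans ler01).
  apply: (@le_trans _ _ (wt p * (wt p * (wt p * expR (- s * wt p))))); last first.
    by rewrite exprS expr2 !mulrA.
  apply: ler_wpM2l => //; apply: ler_wpM2r; first by rewrite mulr_ge0 ?expR_ge0.
  by rewrite ler_peMl ?l1_ge0 // ler1n.
by apply: fam0_near h'; near=> z => p _; rewrite rmorphM.
Unshelve. all: by end_near. Qed.

Lemma fam0_ser0 : exists2 s : R, 0 < s & fam0 S (fun k => expR (- s * l1 k)) ser0 0.
Proof.
have [s s0 h] := fam0_term0; exists s => //.
apply: (fam0_inner (summing_geom s0) _ h) => k _; exact: expR_ge0.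
Qed.

Lemma fam0_ser1 : exists2 s : R, 0 < s & fam0 S (fun k => expR (- s * l1 k)) ser1 0.
Proof.
have [s s0 h] := fam0_term1; exists s => //.
apply: (fam0_inner (summing_geom s0) _ h) => k _; exact: expR_ge0.
Qed.

Lemma thetaE k z : theta a b k z = th k z.
Proof. by []. Qed.

Lemma VinstE k z : Vinst om J xi i a b k z = ((2 * pi)^-1)%:C * ser0 k z.
Proof. by rewrite /Vinst thetaE ZE. Qed.

Local Notation Zc k z := (zr k z +i* zi k z).
Local Notation dzc k z u := (dzr k z u +i* dzi k z u).
Local Notation oc k := ((Om i (base z0) (ls k (base z0)))%:~R : C).

(** alph is the invariant 1-form dZ / Z - d conj Z / conj Z in Ainst. *)
Definition dlogZ k z u : C := dzc k z u / Zc k z.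
Definition alph k z u : C := dlogZ k z u - conjc (dlogZ k z u).

Lemma near_Om : \forall z \near z0, forall k,
  Om i (base z) (ls k (base z)) = Om i (base z0) (ls k (base z0)).
Proof.
have [d d0 [_ hd]] := Om_locally_constant hOm df Wz.
have hb : \forall z \near z0, ball (base z0) d (base z).
  exact: (differentiable_continuous (base_der z0).1 (nbhsx_ballx (base z0) d d0)).
by apply: filterS hb => z hz k; exact: hd.
Qed.

Lemma near_supp : \forall z \near z0, supp Om i a b z = S.
Proof.
apply: filterS near_Om => z hz; apply/seteqP; split=> k; rewrite /supp /active /= hz //.
Qed.

Lemma near_Zn0 : \forall z \near z0, forall k, S k -> Zc k z != 0.
Proof.
have [c c0 hc] := nz_lower_near; apply: filterS hc => z hz k Sk.
apply: contraTneq (hz k Sk) => ->; rewrite ComplexField.Normc.normc0 -ltNge.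
by rewrite mulr_gt0 // (lt_le_trans ltr01) // l1_ge1S.
Qed.

Lemma invc_normc (z : C) : z != 0 -> z^-1 = conjc z * (((normc z)^-1)%:C * ((normc z)^-1)%:C).
Proof.
move=> z0'; apply: (mulfI z0'); rewrite mulfV // mulrA.
have n0 : normc z != 0 by apply: contra_neq z0' => /ComplexField.Normc.eq0_normc.
have nn : normc z * normc z = Re z * Re z + Im z * Im z.
  by case: (z) => p q /=; rewrite -expr2 sqr_sqrtr ?addr_ge0 ?sqr_ge0 // !expr2.
have -> : z * conjc z = (normc z * normc z)%:C.
  by rewrite nn; apply: complexP; rewrite !ReImE /=; ring.
by rewrite -!rmorphM /= mulrACA divff // mulr1.
Qed.

(** 1 / Z = conj Z / |Z| ^ 2, where conj Z has weight - i and |Z| weight 0; the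
division by |Z| costs no more than the weights since |Z| is bounded below. *)
Lemma fam0_Zinv : fam0 S (fun k => l1 k ^+ 3) (fun k z => (Zc k z)^-1) (- ii).
Proof.
have hZ : fam0 S l1 (fun k z => Zc k z) ii.
  have [h0 [dp h1 h2]] := fam0_Z; split; first exact: l1_ge0'.
  exists dp => [|k _]; last exact: h2.
  exact: (cctl_reindex (h := id) (fun k _ => I) h1).
have h := fam0M (fam0J hZ) (fam0M fam0_nzV fam0_nzV).
rewrite !addr0 conjc_ii in h.
apply: (fam0_near (p := fun k z => conjc (Zc k z) * (((nz k z)^-1)%:C * ((nz k z)^-1)%:C))).
  by apply: filterS near_Zn0 => z hz k Sk; rewrite -invc_normc // hz.
apply: fam0_le (ler01) _ _ h => k Sk; first by rewrite exprn_ge0 // l1_ge0.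
by rewrite mul1r !exprS expr0 mulr1.
Qed.

Lemma fam1_dZS : fam1 S l1 (fun k z u => dzc k z u) ii.
Proof. exact: (fam1_reindex (h := id) (fun k _ => I) fam1_dZ). Qed.

Lemma fam1_dthS : fam1 S l1 (fun k z u => (dth k z u)%:C) 0.
Proof. exact: (fam1_reindex (h := id) (fun k _ => I) fam1_dth). Qed.

Lemma fam1_alph : fam1 S (fun k => l1 k ^+ 3 * l1 k) alph 0.
Proof.
have h := fam1M fam0_Zinv fam1_dZS; rewrite addNr in h.
have h' : fam1 S (fun k => l1 k ^+ 3 * l1 k) dlogZ 0.
  by apply: fam1_near h; near=> z => k u _; rewrite mulrC.
have hJ := fam1J h'; rewrite rmorph0 in hJ.
exact: fam1B h' hJ.
Unshelve. all: by end_near. Qed.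

(** The 1-form is constant along the series, so it factors out.  This requires
convergence, and hence holds near z0 only. *)
Lemma near_Ainst : \forall z \near z0, forall k u, S k ->
  Ainst om J xi i a b k z u = - ((4 * pi)^-1)%:C * (ser1 k z * alph k z u).
Proof.
have [s s0 [_ [dp hc _]]] := fam0_term1.
have hd := cctl_near_dominated hc.
apply: filterS2 near_W hd => z Wz' [[c1 h1] [c2 h2]] k u Sk.
rewrite /Ainst; congr (_ * _); rewrite thetaE ZE /dZbar dZE //.
have -> : conjc (dzc k z u) / conjc (Zc k z) = conjc (dlogZ k z u).
  by rewrite /dlogZ (fmorph_div (@conjc R)).
rewrite -/(dlogZ k z u) -/(alph k z u).
pose e l := cexpi (l.+1%:R * th k z) * (nz k z * besselK 1 (arg (k, l) z))%:C.
have de : cdominated setT (fun l => expR (- s) ^+ l) e.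
  split; [exists (c1 * expR (- s * l1 k)) | exists (c2 * expR (- s * l1 k))] => l _.
    by rewrite -mulrA; exact: (h1 (k, l)).
  by rewrite -mulrA; exact: (h2 (k, l)).
rewrite -/(cseries _).
transitivity (csm (fun f => limn (series f)) (fun l => alph k z u * e l + 0 * e l)).
  by congr csm; apply/funext => l; rewrite mul0r addr0 mulrC.
by rewrite (csm_lin (summing_geom s0)) // mul0r addr0 mulrC.
Qed.

(** Half of the exponential decay absorbs the polynomial weights. *)
Lemma fam2_absorb (p : nat) (s : R) ta la : 0 < s ->
  fam2 S (fun k => expR (- s * l1 k) * l1 k ^+ p) ta la ->
  forall s', s' <= s / 2 -> fam2 S (fun k => expR (- s' * l1 k)) ta la.
Proof.
move=> s0 h s' ss; have s2 : 0 < s / 2 by rewrite divr_gt0.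
have [c c0 hc] := exp_poly_bound p s2.
apply: fam2_le c0 _ _ h => k Sk; first exact: expR_ge0.
have -> : expR (- s * l1 k) = expR (- (s / 2) * l1 k) * expR (- (s / 2) * l1 k).
  by rewrite -expRD; congr expR; field.
rewrite -mulrA mulrC; apply: ler_pM.
- by rewrite mulr_ge0 ?expR_ge0 ?exprn_ge0 ?l1_ge0.
- exact: expR_ge0.
- by rewrite mulrC; apply: hc; exact: l1_ge0.
- by rewrite ler_expR !mulNr lerN2 ler_wpM2r ?l1_ge0.
Qed.

Lemma fam2Z (I : Type) (T : set I) m ta la (c : C) : fam2 T m ta la ->
  fam2 T m (fun k z u w => c * ta k z u w) la.
Proof.
move=> h; have [m0 _] := h.
have hc : fam0 T (fun=> `|Re c| + `|Im c|) (fun _ _ => c) 0.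
  by apply: fam0_scalar => k _; rewrite ?lerDl ?lerDr.
have := fam2M hc h; rewrite add0r; apply: (fam2_le (c := `|Re c| + `|Im c|)) => //.
Qed.

Lemma fam2_Om m ta la : fam2 S m ta la ->
  fam2 S (fun k => `|(Om i (base z0) (ls k (base z0)))%:~R| * m k)
    (fun k z u w => oc k * ta k z u w) la.
Proof.
move=> h; have hO : fam0 S (fun k => `|(Om i (base z0) (ls k (base z0)))%:~R| : R) (fun k _ => oc k) 0.
  have rc (j : int) : (j%:~R : C) = (j%:~R)%:C by rewrite (rmorph_int (real_complex R)).
  by apply: fam0_scalar => k _; rewrite rc /= ?normr0.
by have := fam2M hO h; rewrite add0r.
Qed.

Definition varpi_term k z u w : C :=
  - ((4 * pi)^-1)%:C * (ser1 k z * wedge (fun u => dzc k z u) (alph k z) u w)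
  + (ii / (2 * pi)%:C * ((2 * pi)^-1)%:C) *
     (ser0 k z * wedge (fun u => (dth k z u)%:C) (fun u => dzc k z u) u w).
Definition omega3_term k z u w : C :=
  (ii / 2 * ((2 * pi)^-1)%:C) *
     (ser0 k z * wedge (fun u => dzc k z u) (fun u => conjc (dzc k z u)) u w)
  + (((2 * pi)%:C)^-1 * - ((4 * pi)^-1)%:C) *
     (ser1 k z * wedge (fun u => (dth k z u)%:C) (alph k z) u w).

(** ser0 and ser1 have weight 0, as have dtheta and alph, while dZ has weight i
and its conjugate - i. *)
Lemma fam2_terms : exists2 s : R, 0 < s &
  fam2 S (fun k => expR (- s * l1 k)) varpi_term ii /\
  fam2 S (fun k => expR (- s * l1 k)) omega3_term 0.
Proof.
have [s1 s10 h1] := fam0_ser1; have [s2 s20 h2] := fam0_ser0.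
pose s := Num.min s1 s2 / 2.
have e0 (t : R) p : forall k, S k -> 0 <= expR (- t * l1 k) * l1 k ^+ p.
  by move=> k _; rewrite mulr_ge0 ?expR_ge0 ?exprn_ge0 ?l1_ge0.
have ss1 : s <= s1 / 2 by rewrite /s ler_pM2r ?invr_gt0 // ge_min lexx.
have ss2 : s <= s2 / 2 by rewrite /s ler_pM2r ?invr_gt0 // ge_min lexx orbT.
exists s; first by rewrite divr_gt0 // lt_min s10.
have hdJ : fam1 S l1 (fun k z u => conjc (dzc k z u)) (- ii).
  have := fam1J fam1_dZS; by rewrite conjc_ii.
split; apply: fam2D; apply: fam2Z.
- apply: (fam2_absorb (p := 5) s10 _ ss1).
  have := fam2M h1 (fam_wedge fam1_dZS fam1_alph); rewrite addr0 add0r.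
  by apply: fam2_le (ler01) (e0 _ 5%N) _ => k Sk; rewrite mul1r ler_pM2l ?expR_gt0 // -exprSr -exprS.
- apply: (fam2_absorb (p := 2) s20 _ ss2).
  have := fam2M h2 (fam_wedge fam1_dthS fam1_dZS); rewrite !add0r.
  by apply: fam2_le (ler01) (e0 _ 2%N) _ => k Sk; rewrite mul1r ler_pM2l ?expR_gt0 // -expr2.
- apply: (fam2_absorb (p := 2) s20 _ ss2).
  have := fam2M h2 (fam_wedge fam1_dZS hdJ); rewrite subrr addr0.
  by apply: fam2_le (ler01) (e0 _ 2%N) _ => k Sk; rewrite mul1r ler_pM2l ?expR_gt0 // -expr2.
- apply: (fam2_absorb (p := 5) s10 _ ss1).
  have := fam2M h1 (fam_wedge fam1_dthS fam1_alph); rewrite !addr0.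
  by apply: fam2_le (ler01) (e0 _ 5%N) _ => k Sk; rewrite mul1r ler_pM2l ?expR_gt0 // -exprSr -exprS.
Qed.

Lemma summing_Om (s : R) : 0 < s -> summing S (@rsum R _ S)
  (fun k => `|(Om i (base z0) (ls k (base z0)))%:~R| * expR (- s * l1 k)).
Proof.
move=> s0; apply: summing_rsum => [k _|]; first by rewrite mulr_ge0 ?expR_ge0.
exact: (Om_summable hOm df Wz s0).
Qed.

Lemma lie2_wedge_bracket (al be : K -> TE -> TE -> C) la mu :
  fam1 setT l1 al la -> fam1 setT l1 be mu ->
  lie2 (fun z u w => bracket (al^~ z) (be^~ z) u w) (la + mu).
Proof.
move=> ha hb; rewrite /bracket; apply: lie2_sum => r.
have h (k k' : K) : lie2 (fun z u w => wedge (al k z) (be k' z) u w) (la + mu).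
  have hk := fam1_reindex (h := fun _ : unit => k) (S' := setT) (fun _ _ => I) ha.
  have hk' := fam1_reindex (h := fun _ : unit => k') (S' := setT) (fun _ _ => I) hb.
  exact: (lie2_fam (i := tt) I (fam_wedge hk hk')).
apply: lie2D; first exact: h.
have := lie2Z (-1) (h (kb r) (ka r)).
by apply: lie2_near; near=> z => u w; rewrite mulN1r.
Unshelve. all: by end_near. Qed.

Lemma rsum_ext (I : choiceType) (T : set I) (f h : I -> R) :
  (forall k, T k -> f k = h k) -> rsum T f = rsum T h.
Proof.
move=> fh; rewrite /rsum; congr (fine (_ - _)%E); apply: eq_esum => k Tk.
  by rewrite !funeposE /= fh.
by rewrite !funenegE /= fh.
Qed.

Lemma csum_ext (I : choiceType) (T : set I) (f h : I -> C) :
  (forall k, T k -> f k = h k) -> csum T f = csm (@rsum R I T) h.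
Proof.
by move=> fh; apply: complexP; apply: rsum_ext => k Tk; rewrite fh.
Qed.

(** Near z0 the support and the BPS invariants are those at z0, so that the sums
run over a fixed set with constant coefficients. *)
Lemma near_forms : \forall z \near z0, forall u w,
  varpi om J xi Om i a b z u w =
    - ((2 * pi)^-1)%:C * bracket (fun k u => dzc k z u) (fun k u => (dth k z u)%:C) u w
    + csm (@rsum R _ S) (fun k => oc k * varpi_term k z u w) /\
  omega3_formula om J xi Om i a b z u w =
    (4^-1)%:C * bracket (fun k u => dzc k z u) (fun k u => conjc (dzc k z u)) u w
    - ((8 * pi ^+ 2)^-1)%:C * bracket (fun k u => (dth k z u)%:C) (fun k u => (dth k z u)%:C) u w
    + csm (@rsum R _ S) (fun k => oc k * omega3_term k z u w).
Proof.
near=> z => u w.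
have Wz' : W (base z) by near: z; exact: near_W.
have hS : supp Om i a b z = S by near: z; exact: near_supp.
have hO : forall k, Om i (base z) (ls k (base z)) = Om i (base z0) (ls k (base z0)).
  by near: z; exact: near_Om.
have hA : forall k u, S k ->
    Ainst om J xi i a b k z u = - ((4 * pi)^-1)%:C * (ser1 k z * alph k z u).
  by near: z; exact: near_Ainst.
have hZ : (fun k => dZ om J xi i a b k z) = fun k u => dzc k z u.
  by apply/funext => k; apply/funext => u'; rewrite dZE.
have hZb : (fun k => dZbar om J xi i a b k z) = fun k u => conjc (dzc k z u).
  by apply/funext => k; apply/funext => u'; rewrite /dZbar dZE.
have hth : (fun k => dtheta a b k z) = fun k u => (dth k z u)%:C.
  by apply/funext => k; apply/funext => u'; rewrite dthetaE.
have hZk k : dZ om J xi i a b k z = fun u => dzc k z u := congr1 (@^~ k) hZ.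
have hZbk k : dZbar om J xi i a b k z = fun u => conjc (dzc k z u) := congr1 (@^~ k) hZb.
have hthk k : dtheta a b k z = fun u => (dth k z u)%:C := congr1 (@^~ k) hth.
split.
  rewrite /varpi hS hZ hth; congr (_ + _); apply: csum_ext => k Sk.
  rewrite /OmC hO hZk hthk VinstE /wedge !hA // /varpi_term /wedge; ring.
rewrite /omega3_formula hS hZ hZb hth; congr (_ + _); apply: csum_ext => k Sk.
rewrite /OmC hO hZk hZbk hthk VinstE /wedge !hA // /omega3_term /wedge; ring.
Unshelve. all: by end_near. Qed.

Lemma lie2_varpi : lie2 (varpi om J xi Om i a b) ii.
Proof.
have [s s0 [h _]] := fam2_terms.
have h1 := lie2_csm (summing_Om s0) (fam2_Om h).
have h2 := lie2_wedge_bracket fam1_dZ fam1_dth; rewrite addr0 in h2.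
apply: lie2_near (lie2D (lie2Z (- ((2 * pi)^-1)%:C) h2) h1).
by apply: filterS near_forms => z hz u w; have [-> _] := hz u w.
Qed.

Lemma lie2_omega3 : lie2 (omega3_formula om J xi Om i a b) 0.
Proof.
have [s s0 [_ h]] := fam2_terms.
have h1 := lie2_csm (summing_Om s0) (fam2_Om h).
have h2 := lie2_wedge_bracket fam1_dZ (fam1J fam1_dZ).
rewrite conjc_ii subrr in h2.
have h3 := lie2_wedge_bracket fam1_dth fam1_dth; rewrite addr0 in h3.
apply: lie2_near (lie2D (lie2D (lie2Z (4^-1)%:C h2) (lie2Z (- ((8 * pi ^+ 2)^-1)%:C) h3)) h1).
by apply: filterS near_forms => z hz u w; have [_ ->] := hz u w; rewrite mulNr.
Qed.

Lemma varpi_clie : is_clie V (varpi om J xi Om i a b) z0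
  (fun u w => ii * varpi om J xi Om i a b z0 u w).
Proof. exact: lie2_is_clie (hlift_diff hM (Wi Wz)) lie2_varpi. Qed.

Lemma omega3_lie : is_lie V (omega3 om J xi Om i a b) z0 (fun _ _ => 0).
Proof.
have [h _] := lie2_is_clie (hlift_diff hM (Wi Wz)) lie2_omega3.
case: h => h1 h2; split=> // u w; have [h3 h4] := h2 u w.
by split=> //; rewrite h4 mul0r.
Qed.

(** * Non-degeneracy and the complex structure I_3 *)
Lemma rsumN (I : choiceType) (T : set I) (f : I -> R) :
  rsum T (fun k => - f k) = - rsum T f.
Proof.
rewrite /rsum.
have -> : \esum_(k in T) (EFin \o (fun k => (- f k)%R))^\+%E k = \esum_(k in T) (EFin \o f)^\-%E k.
  by apply: eq_esum => k _; rewrite funeposE funenegE.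
have -> : \esum_(k in T) (EFin \o (fun k => (- f k)%R))^\-%E k = \esum_(k in T) (EFin \o f)^\+%E k.
  by apply: eq_esum => k _; rewrite funeposE funenegE /= opprK.
set p := esum _ _; set q := esum _ _.
have p0 : (0 <= p)%E by apply: esum_ge0.
have q0 : (0 <= q)%E by apply: esum_ge0.
by case: p q p0 q0 => [p||] [q||] //= _ _; rewrite ?oppr0 // opprB.
Qed.

Local Notation x0 := (base z0).
Local Notation csumS := (csm (@rsum R _ S)).
Local Notation vp := (varpi om J xi Om i a b z0).
Local Notation w3 := (omega3_formula om J xi Om i a b z0).
Let ix0 : img i x0 := Wi Wz.

Lemma csumS_ext (f h : K -> C) : (forall k, S k -> f k = h k) -> csumS f = csumS h.
Proof. by move=> fh; rewrite /csm; congr (_ +i* _); apply: rsum_ext => k Sk; rewrite fh. Qed.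

Lemma vpE u w : vp u w =
  - ((2 * pi)^-1)%:C * bracket (fun k u => dzc k z0 u) (fun k u => (dth k z0 u)%:C) u w
  + csumS (fun k => oc k * varpi_term k z0 u w).
Proof. by have [-> _] := nbhs_singleton near_forms u w. Qed.

Lemma w3E u w : w3 u w =
  (4^-1)%:C * bracket (fun k u => dzc k z0 u) (fun k u => conjc (dzc k z0 u)) u w
  - ((8 * pi ^+ 2)^-1)%:C * bracket (fun k u => (dth k z0 u)%:C) (fun k u => (dth k z0 u)%:C) u w
  + csumS (fun k => oc k * omega3_term k z0 u w).
Proof. by have [_ ->] := nbhs_singleton near_forms u w. Qed.

Definition weightS (s : R) (k : K) : R :=
  `|(Om i x0 (ls k x0))%:~R| * expR (- s * l1 k).

Lemma terms_dominated : exists2 s : R, 0 < s & forall u w,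
  cdominated S (weightS s) (fun k => oc k * varpi_term k z0 u w) /\
  cdominated S (weightS s) (fun k => oc k * omega3_term k z0 u w).
Proof.
have [s s0 [h1 h2]] := fam2_terms; exists s => // u w.
have [_ k1] := fam2_Om h1; have [_ k2] := fam2_Om h2.
have [d1 c1 _] := k1 u w; have [d2 c2 _] := k2 u w.
by split; [exact: cctl_dominated c1 | exact: cctl_dominated c2].
Qed.

Lemma dzcD c u v k : dzc k z0 (c *: u + v) = c%:C * dzc k z0 u + dzc k z0 v.
Proof. by rewrite drez_lin dimz_lin; apply: complexP; rewrite !ReImE /=; ring. Qed.

Lemma dthcD c u v k : (dth k z0 (c *: u + v))%:C = c%:C * (dth k z0 u)%:C + (dth k z0 v)%:C.
Proof. by rewrite dangle_lin rmorphD rmorphM. Qed.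

Lemma conjc_lin (c : R) (p q : C) : conjc (c%:C * p + q) = c%:C * conjc p + conjc q.
Proof. rewrite rmorphD rmorphM; congr (_ * _ + _); exact: conjc_real. Qed.

Lemma dzcJD c u v k : conjc (dzc k z0 (c *: u + v))
  = c%:C * conjc (dzc k z0 u) + conjc (dzc k z0 v).
Proof. by rewrite dzcD conjc_lin. Qed.

Lemma alphD c u v k : alph k z0 (c *: u + v) = c%:C * alph k z0 u + alph k z0 v.
Proof.
by rewrite /alph /dlogZ dzcD mulrDl -mulrA conjc_lin opprD addrACA -mulrBr.
Qed.

Lemma wedge_bilin (al be : TE -> C) :
  (forall c u v, al (c *: u + v) = c%:C * al u + al v) ->
  (forall c u v, be (c *: u + v) = c%:C * be u + be v) ->
  forall c u v w, wedge al be (c *: u + v) w = c%:C * wedge al be u w + wedge al be v w.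
Proof. by move=> ha hb c u v w; rewrite /wedge ha hb; ring. Qed.

Lemma wedgeNN (al be al' be' : TE -> C) u w : (forall u, al' u = - al u) ->
  (forall u, be' u = - be u) -> wedge al' be' u w = wedge al be u w.
Proof. by move=> ha hb; rewrite /wedge !ha !hb !mulrNN. Qed.

Lemma wedge_anti (al be : TE -> C) u w : wedge al be w u = - wedge al be u w.
Proof. by rewrite /wedge opprB. Qed.

Lemma bracket_bilin (al be : K -> TE -> C) :
  (forall k c u v, al k (c *: u + v) = c%:C * al k u + al k v) ->
  (forall k c u v, be k (c *: u + v) = c%:C * be k u + be k v) ->
  forall c u v w, bracket al be (c *: u + v) w = c%:C * bracket al be u w + bracket al be v w.
Proof.
move=> ha hb c u v w; rewrite /bracket mulr_sumr -big_split; apply: eq_bigr => r _ /=.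
by rewrite !wedge_bilin //; ring.
Qed.

Lemma bracket_anti (al be : K -> TE -> C) u w : bracket al be w u = - bracket al be u w.
Proof.
rewrite /bracket -sumrN; apply: eq_bigr => r _.
by rewrite [in LHS]wedge_anti [X in _ - X = _]wedge_anti; ring.
Qed.

Lemma csumS_lin (f : K -> TE -> TE -> C) s : 0 < s ->
  (forall u w, cdominated S (weightS s) (fun k => f k u w)) ->
  forall (p q : C) u w u' w',
  csumS (fun k => p * f k u w + q * f k u' w') = p * csumS (fun k => f k u w) + q * csumS (fun k => f k u' w').
Proof. by move=> s0 h p q u w u' w'; apply: (csm_lin (summing_Om s0)). Qed.

Lemma form_bilin (f : K -> TE -> TE -> C) s : 0 < s ->
  (forall u w, cdominated S (weightS s) (fun k => f k u w)) ->
  (forall k (c : R) u v w, f k (c *: u + v) w = c%:C * f k u w + f k v w) ->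
  forall (c : R) u v w, csumS (fun k => f k (c *: u + v) w)
     = c%:C * csumS (fun k => f k u w) + csumS (fun k => f k v w).
Proof.
move=> s0 h hf c u v w; rewrite -[X in _ = _ + X]mul1r -(csumS_lin s0) //.
by apply: csumS_ext => k _; rewrite hf mul1r.
Qed.

Lemma form_anti (f : K -> TE -> TE -> C) s : 0 < s ->
  (forall u w, cdominated S (weightS s) (fun k => f k u w)) ->
  (forall k u w, f k w u = - f k u w) ->
  forall u w, csumS (fun k => f k w u) = - csumS (fun k => f k u w).
Proof.
move=> s0 h hf u w; rewrite -[RHS]addr0 -mulN1r -[X in _ = _ + X](mul0r (csumS (fun k => f k u w))).
rewrite -(csumS_lin s0) //; apply: csumS_ext => k _; rewrite hf; ring.
Qed.

(** The ring identities by which bilinearity and type pass from the factors dZ,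
dtheta and alph to the forms. *)
Lemma lin_comb (A : comNzRingType) (e c p q s t : A) :
  e * (c * p + q) + (c * s + t) = c * (e * p + s) + (e * q + t).
Proof. ring. Qed.

Lemma lin_comb2 (A : comNzRingType) (d e c p q p' q' s t : A) :
  d * (c * p + q) - e * (c * p' + q') + (c * s + t)
  = c * (d * p - e * p' + s) + (d * q - e * q' + t).
Proof. ring. Qed.

Lemma lin_term (A : comNzRingType) (o d e x y c p q p' q' : A) :
  o * (d * (x * (c * p + q)) + e * (y * (c * p' + q')))
  = c * (o * (d * (x * p) + e * (y * p'))) + o * (d * (x * q) + e * (y * q')).
Proof. ring. Qed.

Lemma type_comb (A : comNzRingType) (I p1 p2 q1 q2 r1 r2 t1 t2 : A) :
  p1 - I * q1 = I * r1 + t1 -> p2 - I * q2 = I * r2 + t2 ->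
  (p1 - p2) - I * (q1 - q2) = I * (r1 - r2) + (t1 - t2).
Proof.
move=> h1 h2; transitivity ((p1 - I * q1) - (p2 - I * q2)); first by ring.
by rewrite h1 h2; ring.
Qed.

Lemma type_comb_term (A : comNzRingType) (I o c d x y p1 p2 q1 q2 r1 r2 t1 t2 : A) :
  p1 - I * q1 = I * r1 + t1 -> p2 - I * q2 = I * r2 + t2 ->
  1 * (o * (c * (x * p1) + d * (y * p2))) + - I * (o * (c * (x * q1) + d * (y * q2)))
  = I * (o * (c * (x * r1) + d * (y * r2))) + 1 * (o * (c * (x * t1) + d * (y * t2))).
Proof.
move=> h1 h2; transitivity (o * (c * (x * (p1 - I * q1)) + d * (y * (p2 - I * q2)))).
  by ring.
by rewrite h1 h2; ring.
Qed.

Lemma type_comb_sum (A : comNzRingType) (I c b1 b2 b3 b4 s1 s2 s3 s4 : A) :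
  b1 - I * b2 = I * b3 + b4 -> 1 * s1 + - I * s2 = I * s3 + 1 * s4 ->
  c * b1 + s1 - I * (c * b2 + s2) = I * (c * b3 + s3) + (c * b4 + s4).
Proof.
move=> h1 h2; transitivity (c * (b1 - I * b2) + (1 * s1 + - I * s2)); first by ring.
by rewrite h1 h2; ring.
Qed.

Lemma vp_bilin (c : R) u v w : vp (c *: u + v) w = c%:C * vp u w + vp v w.
Proof.
have [s s0 h] := terms_dominated.
rewrite !vpE (bracket_bilin (fun k c u v => dzcD c u v k) (fun k c u v => dthcD c u v k)).
rewrite (form_bilin s0 (fun u w => (h u w).1)); first exact: lin_comb.
move=> k c' u' v' w'; rewrite /varpi_term.
rewrite (wedge_bilin (fun c u v => dzcD c u v k) (fun c u v => alphD c u v k)).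
rewrite (wedge_bilin (fun c u v => dthcD c u v k) (fun c u v => dzcD c u v k)).
exact: lin_term.
Qed.

Lemma vp_anti u w : vp w u = - vp u w.
Proof.
have [s s0 h] := terms_dominated.
rewrite !vpE bracket_anti (form_anti s0 (fun u w => (h u w).1)); first by rewrite mulrN opprD.
by move=> k u' w'; rewrite /varpi_term wedge_anti [wedge _ _ w' u']wedge_anti !mulrN -opprD mulrN.
Qed.

Lemma w3_bilin (c : R) u v w : w3 (c *: u + v) w = c%:C * w3 u w + w3 v w.
Proof.
have [s s0 h] := terms_dominated.
rewrite !w3E (bracket_bilin (fun k c u v => dzcD c u v k) (fun k c u v => dzcJD c u v k)).
rewrite (bracket_bilin (fun k c u v => dthcD c u v k) (fun k c u v => dthcD c u v k)).
rewrite (form_bilin s0 (fun u w => (h u w).2)); first exact: lin_comb2.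
move=> k c' u' v' w'; rewrite /omega3_term.
rewrite (wedge_bilin (fun c u v => dzcD c u v k) (fun c u v => dzcJD c u v k)).
rewrite (wedge_bilin (fun c u v => dthcD c u v k) (fun c u v => alphD c u v k)).
exact: lin_term.
Qed.

Lemma w3_anti u w : w3 w u = - w3 u w.
Proof.
have [s s0 h] := terms_dominated.
rewrite !w3E !(bracket_anti _ _ u w) (form_anti s0 (fun u w => (h u w).2)).
  by rewrite !mulrN !opprD.
by move=> k u' w'; rewrite /omega3_term wedge_anti [wedge _ _ w' u']wedge_anti !mulrN -opprD mulrN.
Qed.

Lemma dzc_J k u u' : base u' = base u *m J i x0 -> dzc k z0 u' = ii * dzc k z0 u.
Proof.
move=> uu; rewrite /drez /dimz uu (cask_JJ hM) // ev2Nl opprK.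
by apply: complexP; rewrite !ReImE /=; ring.
Qed.

Lemma dzc_vert k u : base u = 0 -> dzc k z0 u = 0.
Proof. by move=> u0; rewrite /drez /dimz u0 mul0mx !ev20l oppr0. Qed.

Lemma iiBii (p q : C) : ii * (p - ii * q) = ii * p + q.
Proof.
have i2 : ii * ii = -1 :> C by apply: complexP; rewrite !ReImE /=; ring.
by rewrite mulrBr mulrA i2 mulN1r opprK.
Qed.

(** If al is of type (1, 0), that is, kills u' - i u and w' - i w, then any wedge
product with al vanishes on this pair; the equation is this vanishing, expanded. *)
Lemma wedge_type10 (al be : TE -> C) u u' w w' : al u' = ii * al u -> al w' = ii * al w ->
  wedge al be u' w' - ii * wedge al be u w' = ii * wedge al be u' w + wedge al be u w.
Proof. by move=> hu hw; rewrite -iiBii /wedge hu hw; ring. Qed.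

Lemma wedge_type01 (al be : TE -> C) u u' w w' : al u' = ii * al u -> al w' = ii * al w ->
  wedge be al u' w' - ii * wedge be al u w' = ii * wedge be al u' w + wedge be al u w.
Proof. by move=> hu hw; rewrite -iiBii /wedge hu hw; ring. Qed.

(** For u', w' lifting J u, J w, the form omega_1 + i omega_2 vanishes on the pair
u' - i u, w' - i w: it has no component of type (0, 2), as each summand has a
factor dZ. *)
Lemma vp_type u u' w w' : base u' = base u *m J i x0 -> base w' = base w *m J i x0 ->
  vp u' w' - ii * vp u w' = ii * vp u' w + vp u w.
Proof.
move=> uu ww; have [s s0 h] := terms_dominated.
pose T (r : 'I_n) (p q : TE) := wedge (fun u => dzc (ka r) z0 u) (fun u => (dth (kb r) z0 u)%:C) p q
  - wedge (fun u => dzc (kb r) z0 u) (fun u => (dth (ka r) z0 u)%:C) p q.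
have hT r : T r u' w' - ii * T r u w' = ii * T r u' w + T r u w.
  have h1 := @wedge_type10 (fun u => dzc (ka r) z0 u) (fun u => (dth (kb r) z0 u)%:C) _ _ _ _ (dzc_J (ka r) uu) (dzc_J (ka r) ww).
  have h2 := @wedge_type10 (fun u => dzc (kb r) z0 u) (fun u => (dth (ka r) z0 u)%:C) _ _ _ _ (dzc_J (kb r) uu) (dzc_J (kb r) ww).
  exact: type_comb h1 h2.
have hb : \sum_r T r u' w' - ii * (\sum_r T r u w') = ii * (\sum_r T r u' w) + \sum_r T r u w.
  by rewrite !mulr_sumr -sumrB -big_split; apply: eq_bigr => r _; rewrite hT.
have hs : csumS (fun k => 1 * (oc k * varpi_term k z0 u' w') + (- ii) * (oc k * varpi_term k z0 u w'))
   = csumS (fun k => ii * (oc k * varpi_term k z0 u' w) + 1 * (oc k * varpi_term k z0 u w)).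
  apply: csumS_ext => k _; rewrite /varpi_term.
  have h1 := @wedge_type10 (fun u => dzc k z0 u) (alph k z0) _ _ _ _ (dzc_J k uu) (dzc_J k ww).
  have h2 := @wedge_type01 (fun u => dzc k z0 u) (fun u => (dth k z0 u)%:C) _ _ _ _ (dzc_J k uu) (dzc_J k ww).
  exact: type_comb_term h1 h2.
move: hs; rewrite !(csumS_lin s0 (fun u w => (h u w).1)) => hs.
rewrite !vpE /bracket -/(T _ _ _).
have eT p q : \sum_r (wedge (fun u => dzc (ka r) z0 u) (fun u => (dth (kb r) z0 u)%:C) p q
  - wedge (fun u => dzc (kb r) z0 u) (fun u => (dth (ka r) z0 u)%:C) p q) = \sum_r T r p q by [].
rewrite !eT; exact: type_comb_sum hb hs.
Qed.

Lemma vp_vert_J u u' w : base w = 0 -> base u' = base u *m J i x0 -> vp u' w = ii * vp u w.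
Proof.
move=> w0 uu; have [s s0 h] := terms_dominated.
have key k (be : TE -> C) : wedge (fun u => dzc k z0 u) be u' w = ii * wedge (fun u => dzc k z0 u) be u w.
  by rewrite /wedge (dzc_vert k w0) (dzc_J k uu); ring.
have key' k (be : TE -> C) : wedge be (fun u => dzc k z0 u) u' w = ii * wedge be (fun u => dzc k z0 u) u w.
  by rewrite /wedge (dzc_vert k w0) (dzc_J k uu); ring.
rewrite !vpE; set f := csumS _; set f' := csumS (fun k => _ * varpi_term k z0 u w).
have -> : f = ii * f'.
  rewrite -[RHS]addr0 -[X in _ = _ + X](mul0r f') /f' -(csumS_lin s0 (fun u w => (h u w).1)).
  by apply: csumS_ext => k _; rewrite /varpi_term key key'; ring.
suff -> : bracket (fun k u => dzc k z0 u) (fun k u => (dth k z0 u)%:C) u' w =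
    ii * bracket (fun k u => dzc k z0 u) (fun k u => (dth k z0 u)%:C) u w by ring.
by rewrite /bracket mulr_sumr; apply: eq_bigr => r _; rewrite mulrBr -!key.
Qed.

Lemma ev2_lsN (B : 'M[R]_(n + n)) u k y : ev2 B u (ls (- k) y) = - ev2 B u (ls k y).
Proof. by rewrite lsecN ev2Nr. Qed.

Lemma zrN k : zr (- k) z0 = - zr k z0. Proof. exact: ev2_lsN. Qed.
Lemma ziN k : zi (- k) z0 = - zi k z0. Proof. by rewrite /imz ev2_lsN. Qed.
Lemma dzcN k u : dzc (- k) z0 u = - dzc k z0 u.
Proof. by rewrite /drez /dimz !ev2_lsN; apply: complexP; rewrite !ReImE /=. Qed.
Lemma thN k : th (- k) z0 = - th k z0.
Proof. by rewrite /angle lsecN -scaleN1r dotpZl; ring. Qed.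
Lemma dthN k u : dth (- k) z0 u = - dth k z0 u.
Proof.
rewrite /dangle lsecN !chrE mulNmx -scaleN1r -[- (_ *m _)]scaleN1r !dotpZl; ring.
Qed.

(** The phases of - k and k are conjugate, and the moduli agree. *)
Lemma ser0N k : S k -> ser0 (- k) z0 = conjc (ser0 k z0).
Proof.
move=> Sk; have [s s0 [_ [dp [[c1 [_ _ h1 _]] [c2 [_ _ h2 _]]] _]]] := fam0_term0.
pose e k' l := cexpi (l.+1%:R * th k' z0) * (besselK 0 (2 * pi * l.+1%:R * nz k' z0))%:C.
have eN l : e (- k) l = conjc (e k l).
  have nE : nz (- k) z0 = nz k z0 by rewrite zrN ziN /= !sqrrN.
  rewrite /e thN nE mulrN !cexpiE cosN sinN.
  by apply: complexP; rewrite /= ?mulNr.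
have d2 : dominated setT (fun l => expR (- s) ^+ l) (fun l => Im (e k l)).
  by exists (c2 * expR (- s * l1 k)) => l _; rewrite -mulrA; exact: (h2 (k, l)).
change (csm (fun f => limn (series f)) (e (- k)) = conjc (csm (fun f => limn (series f)) (e k))).
have hR : (fun l => Re (e (- k) l)) = (fun l => Re (e k l)).
  by apply/funext => l; rewrite eN ReJ.
have hI : limn (series (fun l => Im (e (- k) l))) = - limn (series (fun l => Im (e k l))).
  transitivity (limn (series (fun l => (-1) * Im (e k l) + 0 * Im (e k l)))).
    by congr (limn (series _)); apply/funext => l; rewrite eN ImJ; ring.
  have h := sm_lin (summing_geom s0) (-1) 0 d2 d2.
  by rewrite mul0r addr0 mulN1r in h.
exact: (f_equal2 (@Complex R) (congr1 (fun q : nat -> R => limn (series q)) hR) hI).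
Qed.

Lemma rsum_opp (f : K -> R) : rsum S (fun k => f (- k)) = rsum S f.
Proof.
have hb : set_bij S S (@GRing.opp K).
  split; first by move=> k Sk; exact: (active_opp hOm df Wz).
    by move=> k l _ _ /oppr_inj.
  by move=> k Sk; exists (- k); [exact: (active_opp hOm df Wz) | rewrite opprK].
rewrite /rsum; congr (fine (_ - _)%E).
  by rewrite [RHS](reindex_esum S S _ _ hb); apply: eq_esum => k _; rewrite !funeposE.
by rewrite [RHS](reindex_esum S S _ _ hb); apply: eq_esum => k _; rewrite !funenegE.
Qed.

Lemma csumS_opp (f : K -> C) : csumS (fun k => f (- k)) = csumS f.
Proof. by rewrite /csm (rsum_opp (fun k => Re (f k))) (rsum_opp (fun k => Im (f k))). Qed.

Local Notation al k v := (ev2 (om i x0) v (ls k x0)).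
(** The vertical vector on which dtheta_k is 2 pi om (v, gamma_k). *)
Definition vertv (v : E) : TE := row_mx 0 (v *m om i x0).

Lemma base_vertv v : base (vertv v) = 0.
Proof. by rewrite /base row_mxKl. Qed.

Lemma dth_vertv k v : dth k z0 (vertv v) = 2 * pi * al k v.
Proof.
rewrite /dangle base_vertv chrE; have -> : chrM nab i x0 0 = 0.
  by have := chrM_scale nab i x0 0 0; rewrite !scale0r.
rewrite mulmx0 dotp0l subr0 /fibre row_mxKr /dotp /ev2; congr (_ * _).
by rewrite -[in RHS](trmxK (v *m om i x0 *m _)) [in RHS]trmx_mul trmxK [RHS]mxE.
Qed.

(** The Darboux expansion, which identifies the bracket of the semi-flat part
with om. *)
Lemma om_darboux (u v : E) : ev2 (om i x0) u v =
  \sum_r (ev2 (om i x0) u (a r x0) * ev2 (om i x0) v (b r x0)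
        - ev2 (om i x0) u (b r x0) * ev2 (om i x0) v (a r x0)).
Proof.
have [c uE] := frame_span hM df Wz u.
have cl s := om_comb_l df Wz c s; have cr s := om_comb_r hM df Wz c s.
rewrite -uE in cl cr.
have -> : ev2 (om i x0) u v = \sum_r c r * ev2 (om i x0) (frame a b r x0) v.
  by rewrite {1}uE ev2_suml.
rewrite big_split_ord /= -big_split; apply: eq_bigr => r _ /=.
rewrite frame_l frame_r (om_anti hM (a r x0)) // (om_anti hM (b r x0)) // cl cr; ring.
Qed.

Lemma lsec_delta r y : ls (delta_mx 0 r) y = frame a b r y.
Proof.
rewrite lsecE (bigD1 r) //= big1 ?addr0; last first.
  by move=> j jr; rewrite mxE eqxx (negPf jr) scale0r.
by rewrite mxE !eqxx scale1r.
Qed.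

Lemma lsec_ka r y : ls (ka r) y = a r y. Proof. by rewrite lsec_delta frame_l. Qed.
Lemma lsec_kb r y : ls (kb r) y = b r y. Proof. by rewrite lsec_delta frame_r. Qed.

Definition vcoef k : R := (Om i x0 (ls k x0))%:~R * (Re (ser0 k z0) / (2 * pi)).
(** The part om (u, gamma) om (v, gamma) of the real part of
dZ (u) conj (dZ (v)), summed with the coefficients Omega Re Vinst. *)
Definition Qform (u v : E) : R := rsum S (fun k => vcoef k * (al k u * al k v)).

Lemma average_ring (A : comNzRingType) (h o I p q x y r d : A) :
  h * (o * ((I * p * q) * (x * - (r * d)))) + h * (o * ((I * p * q) * (y * - (r * d))))
  = (h * (x + y) * o * p * q * r) * - (I * d).
Proof. ring. Qed.

Lemma re_average (o p t : R) (s d : C) : p != 0 ->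
  Re (2^-1 * (o%:C * ((ii / p%:C * (p^-1)%:C) * (s * - ((p * t)%:C * d))))
    + 2^-1 * (o%:C * ((ii / p%:C * (p^-1)%:C) * (conjc s * - ((p * t)%:C * d)))))
  = - (o * (Re s / p) * (- Im d * t)).
Proof.
move=> p0; have -> : (p%:C)^-1 = (p^-1)%:C :> C by rewrite fmorphV.
have -> : (2^-1 : C) = (2^-1)%:C by rewrite fmorphV rmorph_nat.
have sE : s + conjc s = (2 * Re s)%:C.
  by case: s => s1 s2; apply: complexP; rewrite /= ?subrr // mulr_natl mulr2n.
have dE : Re (- (ii * d)) = Im d by case: d => d1 d2 /=; ring.
rewrite average_ring sE -!rmorphM RerC dE.
by move: (Re s) (Im d) => x y; field.
Qed.

(** Only the terms containing dtheta contribute, and there Vinst may be replaced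
by its real part: averaging over k and - k replaces ser0 by the mean of itself and
its conjugate. *)
Lemma vp_vertv U v : Re (vp U (vertv v)) =
  - (ev2 (g i x0) (base U *m J i x0) v + Qform (base U *m J i x0) v).
Proof.
have [s1 s10 hs] := fam0_ser0; pose s := s1 / 2; have s0 : 0 < s by rewrite divr_gt0.
pose f (q : K -> C) k u w : C := oc k * ((ii / (2 * pi)%:C * ((2 * pi)^-1)%:C) *
     (q k * wedge (fun u => (dth k z0 u)%:C) (fun u => dzc k z0 u) u w)).
have dom (q : K -> TE -> C) : fam0 S (fun k => expR (- s1 * l1 k)) q 0 ->
    forall u w, cdominated S (weightS s) (fun k => f (q^~ z0) k u w).
  move=> hq u w; have h2 := fam2M hq (fam_wedge fam1_dthS fam1_dZS); rewrite !add0r in h2.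
  have h3 : fam2 S (fun k => expR (- s1 * l1 k) * l1 k ^+ 2)
    (fun k z u w => q k z * wedge (fun u => (dth k z u)%:C) (fun u => dzc k z u) u w) ii.
    apply: fam2_le (ler01) _ _ h2 => k Sk.
      by rewrite mulr_ge0 ?expR_ge0 ?exprn_ge0 ?l1_ge0.
    by rewrite mul1r ler_pM2l ?expR_gt0 // -expr2.
  have h4 := fam2_Om (fam2Z (ii / (2 * pi)%:C * ((2 * pi)^-1)%:C) (fam2_absorb s10 h3 (lexx _))).
  by have [_ /(_ u w) [d2 c2 _]] := h4; exact: cctl_dominated c2.
have hJ := fam0J hs; rewrite rmorph0 in hJ.
have d1 := dom _ hs; have d2 := dom _ hJ.
set w := vertv v; have bw : base w = 0 by exact: base_vertv.
have fE : csumS (fun k => oc k * varpi_term k z0 U w) = csumS (fun k => f (ser0^~ z0) k U w).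
  apply: csumS_ext => k Sk; rewrite /f /varpi_term.
  have a0 : alph k z0 w = 0 by rewrite /alph /dlogZ dzc_vert // mul0r rmorph0 subrr.
  have -> : wedge (fun u => dzc k z0 u) (alph k z0) U w = 0.
    by rewrite /wedge a0 (dzc_vert k bw) mulr0 mul0r subrr.
  by rewrite !mulr0 add0r.
have fN : csumS (fun k => f (ser0^~ z0) k U w) = csumS (fun k => f (fun k => conjc (ser0 k z0)) k U w).
  rewrite -(csumS_opp (fun k => f (ser0^~ z0) k U w)); apply: csumS_ext => k Sk.
  rewrite /f (Om_opp hOm df Wz) ser0N //.
  have -> // : wedge (fun u => (dth (- k) z0 u)%:C) (fun u => dzc (- k) z0 u) U w
     = wedge (fun u => (dth k z0 u)%:C) (fun u => dzc k z0 u) U w.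
  by apply: wedgeNN => u; [rewrite dthN rmorphN | exact: dzcN].
have fA : csumS (fun k => f (ser0^~ z0) k U w) =
    csumS (fun k => 2^-1 * f (ser0^~ z0) k U w + 2^-1 * f (fun k => conjc (ser0 k z0)) k U w).
  rewrite (csm_lin (summing_Om s0)) // -fN -mulrDl.
  by rewrite [X in X * _](_ : _ = 1) ?mul1r //; field.
rewrite vpE ReD fE fA opprD; congr (_ + _).
  rewrite (cask_gJ hM) // om_darboux /bracket; set B := \sum_r _.
  have -> : Re (- ((2 * pi)^-1)%:C * B) = - (2 * pi)^-1 * Re B by rewrite !ReImE /=; ring.
  have -> : Re B = 2 * pi * \sum_r (ev2 (om i x0) (base U) (a r x0) * ev2 (om i x0) v (b r x0)
        - ev2 (om i x0) (base U) (b r x0) * ev2 (om i x0) v (a r x0)).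
    rewrite /B mulr_sumr; apply: (big_ind2 (fun p q => Re p = q)) => // [? ? ? ? <- <-|r _].
      exact: ReD.
    rewrite /wedge !(dzc_vert _ bw) !dth_vertv !lsec_ka !lsec_kb !ReImE /= /drez lsec_ka lsec_kb.
    by ring.
  rewrite mulrA mulNr mulVf ?mulN1r // mulf_neq0 ?lt0r_neq0 ?pi_gt0 //.
rewrite /csm /= /Qform.
transitivity (rsum S (fun k => - (vcoef k * (al k (base U *m J i x0) * al k v)))).
  apply: rsum_ext => k Sk; rewrite /f /vcoef.
  have -> : (oc k) = ((Om i x0 (ls k x0))%:~R)%:C by rewrite (rmorph_int (real_complex R)).
  have -> : wedge (fun u => (dth k z0 u)%:C) (fun u => dzc k z0 u) U w
      = - ((2 * pi * al k v)%:C * dzc k z0 U).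
    by rewrite /wedge (dzc_vert k bw) mulr0 sub0r dth_vertv.
  have p0 : (2 * pi : R) != 0 by rewrite mulf_neq0 ?lt0r_neq0 ?pi_gt0.
  by rewrite re_average //= /dimz opprK.
exact: rsumN.
Qed.

Lemma om_unit : om i x0 \in unitmx.
Proof.
have JJ : J i x0 *m J i x0 = - 1%:M.
  apply/row_matrixP => r; rewrite rowE (mulmxA (delta_mx 0 r)) (cask_JJ hM) //.
  by rewrite rowE mulmxN mulmx1.
have Ju : J i x0 \in unitmx.
  by have /mulmx1_unit[] : J i x0 *m - J i x0 = 1%:M by rewrite mulmxN JJ opprK.
have -> : om i x0 = J i x0 *m g i x0.
  apply/matrixP => r s; have := cask_gJ hM (delta_mx 0 r) (delta_mx 0 s) ix0.
  have e (B : 'M[R]_(n + n)) : ev2 B (delta_mx 0 r) (delta_mx 0 s) = B r s.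
    by rewrite /ev2 trmx_delta -rowE -colE !mxE.
  by rewrite e => <-; rewrite -[RHS]e /ev2 !mulmxA.
by rewrite unitmx_mul Ju (cask_gunit hM).
Qed.

Lemma Qform_sym u v : Qform u v = Qform v u.
Proof. by apply: rsum_ext => k _; rewrite [al k u * _]mulrC. Qed.

Lemma rsum0 (I : choiceType) (T : set I) : rsum T (fun _ => 0 : R) = 0.
Proof. 
have h := rsumN T (fun _ => 0 : R); have := rsum_ext (T := T) (f := fun _ => 0 : R) (h := fun _ => - 0 : R).
rewrite h => /(_ (fun k _ => esym (oppr0 R))) e; lra.
Qed.

Lemma mul_rotate (T : comNzRingType) (m x y p c : T) :
  c * (m * (x * y) * p) = m * (p * c) * (x * y).
Proof. ring. Qed.

Lemma Re_csum (I : choiceType) (T : set I) (f : I -> C) :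
  Re (csum T f) = rsum T (fun k => Re (f k)).
Proof. by []. Qed.

Hypothesis hcomp : compatible g om J nab xi Lam Om.

(** If u is in the kernel, then g (u, gamma_k) = - Q (u, gamma_k) = 0 for active k,
by mutual locality.  So om (J u, gamma_k) = 0, hence dZ_k (u) is real and the form
T agrees with g + Q on u; but T is non-degenerate. *)
Lemma gQ_nondeg u : (forall v, ev2 (g i x0) u v + Qform u v = 0) -> u = 0.
Proof.
move=> hu; have aJ k : S k -> al k (u *m J i x0) = 0.
  move=> Sk; rewrite -(cask_gJ hM) // (cask_JJ hM) // ev2Nl; apply/eqP; rewrite oppr_eq0; apply/eqP.
  have := hu (ls k x0); rewrite {1}/Qform (rsum_ext (h := fun _ => 0)) ?rsum0 ?addr0 // => l Sl.
  by rewrite (active_local hOm df Wz Sk Sl) !mulr0.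
apply/eqP; apply: contraT => u0.
pose U : TE := row_mx u 0; have bU : base U = u by rewrite /base row_mxKl.
have [w] := hcomp df Wz (u := U) (ltac:(by rewrite bU)).
suff -> : Tform g om J xi Om i a b z0 U w = 0 by rewrite eqxx.
rewrite -(hu (base w)) /Tform bU; congr (_ + _).
rewrite Re_csum /Qform; apply: rsum_ext => k Sk.
rewrite VinstE /dZbar !dZE //.
have -> : Re (dzc k z0 U * conjc (dzc k z0 w)) = al k u * al k (base w).
  have h2 : dzi k z0 U = 0 by rewrite /dimz bU aJ ?oppr0.
  by rewrite h2 /drez bU /= mul0r subr0.
rewrite /OmC (_ : _%:~R = ((Om i x0 (ls k x0))%:~R)%:C :> C); last first.
  by rewrite (rmorph_int (real_complex R)).
rewrite /vcoef; move: (_%:~R) (al k u) (al k (base w)) (2 * pi) (ser0 k z0) => m x y c [p q].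
rewrite mulrAC -rmorphM mulrCA !RerC /=; exact: mul_rotate.
Qed.

Lemma vp_vert_nondeg U : (forall v, Re (vp U (vertv v)) = 0) -> base U = 0.
Proof.
move=> h; have hJ : base U *m J i x0 = 0.
  apply: gQ_nondeg => v; have := h v; rewrite vp_vertv => /eqP; rewrite oppr_eq0 => /eqP.
  by [].
by apply: oppr_inj; rewrite -(cask_JJ hM _ ix0) hJ mul0mx oppr0.
Qed.

(** Pairing with vertical vectors shows that U is vertical, and then pairing with
arbitrary vectors shows that it vanishes, both times by gQ_nondeg. *)
Lemma omega1_nondeg U : (forall w, Re (vp U w) = 0) -> U = 0.
Proof.
move=> h; have bU : base U = 0 by apply: vp_vert_nondeg => v; exact: h.
pose v := fibre U *m invmx (om i x0).
have UE : U = vertv v.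
  by rewrite -[LHS]hsubmxK /vertv /v mulmxKV ?om_unit // -[lsubmx U]/(base U) bU.
have v0 : v = 0.
  apply: gQ_nondeg => w; rewrite (cask_gsym hM) // Qform_sym.
  have := vp_vertv (row_mx (- (w *m J i x0)) 0) v.
  rewrite /base row_mxKl mulNmx (cask_JJ hM) // opprK -UE vp_anti ReN h oppr0 => /esym/eqP.
  by rewrite oppr_eq0 => /eqP.
by rewrite UE v0 /vertv mul0mx row_mx0.
Qed.

Local Notation G1 := (gram (omega1 om J xi Om i a b z0)).
Local Notation G2 := (gram (omega2 om J xi Om i a b z0)).

Lemma gramE N (B : 'rV[R]_N -> 'rV[R]_N -> R) :
  (forall (c : R) u v w, B (c *: u + v) w = c * B u w + B v w) ->
  (forall (c : R) u v w, B w (c *: u + v) = c * B w u + B w v) ->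
  forall u w, B u w = ((u *m (\matrix_(r, s) B (delta_mx 0 r) (delta_mx 0 s))) *m w^T) 0 0.
Proof.
move=> hl hr u w.
rewrite (linear_row_sum (fun c p q => hr c p q u)) mxE; apply: eq_bigr => s _.
rewrite !mxE mulrC (linear_row_sum (fun c p q => hl c p q (delta_mx 0 s))); congr (_ * _).
by apply: eq_bigr => r _; rewrite !mxE.
Qed.

Lemma vp_bilin_r (c : R) u v w : vp w (c *: u + v) = c%:C * vp w u + vp w v.
Proof.
rewrite [vp w (_ + _)]vp_anti [vp w u]vp_anti [vp w v]vp_anti vp_bilin opprD mulrN //.
Qed.

Lemma w3_bilin_r (c : R) u v w : w3 w (c *: u + v) = c%:C * w3 w u + w3 w v.
Proof.
rewrite [w3 w (_ + _)]w3_anti [w3 w u]w3_anti [w3 w v]w3_anti w3_bilin opprD mulrN //.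
Qed.

Lemma omega1E u w : Re (vp u w) = (u *m G1 *m w^T) 0 0.
Proof.
by apply: (gramE (B := fun u w => Re (vp u w))) => *; rewrite (vp_bilin, vp_bilin_r) ReD RerC.
Qed.
Lemma omega2E u w : Im (vp u w) = (u *m G2 *m w^T) 0 0.
Proof.
by apply: (gramE (B := fun u w => Im (vp u w))) => *; rewrite (vp_bilin, vp_bilin_r) ImD ImrC.
Qed.
Lemma omega3E u w : omega3 om J xi Om i a b z0 u w
  = (u *m gram (omega3 om J xi Om i a b z0) *m w^T) 0 0.
Proof.
by apply: (gramE (B := omega3 om J xi Om i a b z0)) => *;
  rewrite /omega3 (w3_bilin, w3_bilin_r) ReD RerC.
Qed.

Lemma row_pair_eq0 N (v : 'rV[R]_N) : (forall w : 'rV[R]_N, (v *m w^T) 0 0 = 0) -> v = 0.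
Proof.
move=> h; apply/rowP => r; have := h (delta_mx 0 r).
by rewrite trmx_delta -colE !mxE.
Qed.

Lemma G1_unit : G1 \in unitmx.
Proof.
rewrite -row_free_unit -kermx_eq0; apply/eqP/row_matrixP => r; rewrite row0.
apply: omega1_nondeg => w; rewrite omega1E -row_mul mulmx_ker row0 mul0mx mxE //.
Qed.

Local Notation P := (G2 *m invmx G1).

(** The vector u' with omega_1 (u', .) = - omega_2 (u, .) lifts J of the base
part of u, by comparison with vertical vectors.  By vp_type the imaginary 1-form
(omega_1 + i omega_2) (u' - i u, .) is multiplied by i under lifts of J, so it
vanishes, and omega_2 (u', .) = omega_1 (u, .); thus I_3 (u') = - u. *)
Lemma I3_square : P *m P = - 1%:M.
Proof.
apply/row_matrixP => r; rewrite !rowE mulmxN mulmx1 mulmxA; move: (delta_mx 0 r) => u.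
pose u' := - (u *m P).
have h1 w : Re (vp u' w) = - Im (vp u w).
  by rewrite omega1E omega2E /u' mulNmx mulmxA mulmxKV ?G1_unit // mulNmx mxE.
pose u2 : TE := row_mx (base u *m J i x0) 0.
have b2 : base u2 = base u *m J i x0 by rewrite /base row_mxKl.
have b' : base u' = base u *m J i x0.
  apply/eqP; rewrite -subr_eq0 -b2; apply/eqP.
  have -> : base u' - base u2 = base ((-1) *: u2 + u').
    by rewrite baseD baseZ scaleN1r addrC.
  apply: vp_vert_nondeg => v; move: (vp_bilin (-1) u2 u' (vertv v)) (h1 (vertv v)) (vp_vert_J (base_vertv v) b2).
  move: (vp _ _) (vp u2 _) (vp u' _) (vp u _) => p q r' s -> hr ->.
  by rewrite ReD RerC Re_ii hr mulN1r opprK subrr.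
have h2 w : Im (vp u' w) = Re (vp u w).
  pose w' : TE := row_mx (base w *m J i x0) 0.
  have bw' : base w' = base w *m J i x0 by rewrite /base row_mxKl.
  move: (vp_type b' bw') (h1 w').
  move: (vp u' w') (vp u w') (vp u' w) (vp u w) => p q r' s /(congr1 (fun z : C => Re z)).
  by rewrite ReD ReN [in RHS]ReD !Re_ii => + h; rewrite h subrr => /esym/eqP; rewrite addrC subr_eq0 => /eqP.
suff : u' *m G2 = u *m G1.
  move=> e; have : u' *m G2 *m invmx G1 = u by rewrite e mulmxK ?G1_unit.
  by move=> e1; rewrite -[u *m P]opprK -/u' mulNmx mulmxA e1.
apply/eqP; rewrite -subr_eq0; apply/eqP; apply: row_pair_eq0 => w.
by rewrite mulmxBl mxE [X in _ + X]mxE -omega2E -omega1E h2 subrr.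
Qed.
End AtPoint.

(** * Invariance of the metric *)
Section MatrixCalculus.
Variables (R : realType) (U : normedModType R) (x : U).

Lemma differentiable_bigsum (I : finType) (f : I -> U -> R) :
  (forall l, differentiable (f l) x) -> differentiable (fun z => \sum_l f l z) x.
Proof.
move=> h; have [] // := is_der_sum (s := index_enum I) (f := f)
  (fun l _ => differentiable_der (h l)).
Qed.

Lemma differentiable_bigprod (I : finType) (f : I -> U -> R) :
  (forall l, differentiable (f l) x) -> differentiable (fun z => \prod_l f l z) x.
Proof.
move=> h; elim: (index_enum I) => [|l s IH].
  under eq_fun do rewrite big_nil; exact: differentiable_cst.
under eq_fun do rewrite big_cons; exact: differentiableM.
Qed.

Lemma differentiable_det N (A : U -> 'M[R]_N) :
  (forall r s, differentiable (fun z => A z r s) x) ->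
  differentiable (fun z => \det (A z)) x.
Proof.
move=> h; rewrite /determinant; apply: differentiable_bigsum => s.
apply: differentiableM; first exact: differentiable_cst.
exact: differentiable_bigprod.
Qed.

(** By Cramer's rule, the entries of the inverse being rational in those of A. *)
Lemma differentiable_invmx N (A : U -> 'M[R]_N) dA :
  is_der A x dA -> (\forall y \near x, A y \in unitmx) ->
  exists dB, is_der (fun z => invmx (A z)) x dB.
Proof.
move=> hA Au.
have e r s : differentiable (fun z => A z r s) x by case: (is_der_entry r s hA).
pose B z := \matrix_(r, s) ((\det (A z))^-1 * cofactor (A z) s r).
have hB r s : differentiable (fun z => B z r s) x.
  rewrite /B; under eq_fun do rewrite mxE.
  apply: differentiableM.
    have Ax : \det (A x) != 0 by have := nbhs_singleton Au; rewrite unitmxE unitfE.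
    by case: (is_derV (differentiable_der (differentiable_det e)) Ax).
  apply: differentiableM; first exact: differentiable_cst.
  by apply: differentiable_det => p q; under eq_fun do rewrite !mxE; exact: e.
exists (fun v => \matrix_(r, s) 'D_v (fun z => B z r s) x).
apply: (is_der_near (f := B)).
  near=> y; apply/matrixP => r s; rewrite /invmx ifT; last by near: y.
  by rewrite /B !mxE.
apply: is_der_mx => r s; apply: is_der_eqd (differentiable_der (hB r s)) _ => v.
by rewrite mxE.
Unshelve. all: by end_near. Qed.

End MatrixCalculus.

Section LieMatrices.
Variables (R : realType) (N : nat).
Local Notation T := 'rV[R]_N.
Local Notation e_ r := (delta_mx 0 r : T).
Variables (V : T -> T) (z : T).
Hypothesis dV : differentiable V z.

Local Notation A := (\matrix_(r < N, s < N) ('D_(e_ r) V z) 0 s).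
Local Notation mat B := (\matrix_(r < N, s < N) B (e_ r) (e_ s)).

Lemma jacobianE u : 'D_u V z = u *m A.
Proof.
have [hD hZ _] := is_der_linear (differentiable_der dV).
have h0 : 'D_0 V z = 0 by have := hZ 0 0; rewrite !scale0r.
rewrite {1}[u]row_sum_delta mulmx_sum_row.
apply: (big_ind2 (fun p q => 'D_p V z = q)) => // [p p' q q' <- <-|r _]; first exact: hD.
by rewrite hZ; congr (_ *: _); apply/rowP => s; rewrite !mxE.
Qed.

Lemma is_lie_mat (B : T -> T -> T -> R) B' :
  (forall u w, B z u w = (u *m mat (B z) *m w^T) 0 0) -> is_lie V B z B' ->
  exists2 dG, is_der (fun y => mat (B y)) z dG
    & dG (V z) = mat B' - A *m mat (B z) - mat (B z) *m A^T.
Proof.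
move=> hB [_ h]; exists (fun v => mat (fun u w => 'D_v (fun y => B y u w) z)).
  apply: is_der_mx => r s; have [d _] := h (e_ r) (e_ s).
  by apply: (is_der_near (f := fun y => B y (e_ r) (e_ s)));
    [near=> y; rewrite mxE | apply: is_der_eqd (differentiable_der d) _ => v; rewrite mxE].
apply/matrixP => r s; have [_] := h (e_ r) (e_ s); rewrite !hB !jacobianE -!rowE.
have -> : (row r A *m mat (B z) *m (e_ s)^T) 0 0 = (A *m mat (B z)) r s.
  by rewrite trmx_delta -colE -row_mul mxE [LHS]mxE.
have -> : (row r (mat (B z)) *m (row s A)^T) 0 0 = (mat (B z) *m A^T) r s.
  by rewrite tr_row colE mulmxA -row_mul -colE mxE [LHS]mxE.
move: (A *m _) (_ *m A^T) => p q e; rewrite !mxE -e; ring.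
Unshelve. all: by end_near. Qed.

Lemma mat_is_lie (B : T -> T -> T -> R) (G : T -> 'M[R]_N) dG :
  (\forall y \near z, forall u w, B y u w = (u *m G y *m w^T) 0 0) ->
  is_der G z dG -> dG (V z) = - (A *m G z) - G z *m A^T ->
  is_lie V B z (fun _ _ => 0).
Proof.
move=> hB hG e; split=> // u w.
have h : is_der (fun y => B y u w) z (fun v => (u *m dG v *m w^T) 0 0).
  apply: (is_der_near (f := fun y => (u *m G y *m w^T) 0 0)); first by near=> y; rewrite (near hB y).
  apply: (is_der_entry (f := fun y => u *m G y *m w^T) (df := fun v => u *m dG v *m w^T)).
  apply: is_der_eqd (is_der_mul (is_der_mul (is_der_cst u z) hG) (is_der_cst w^T z)) _ => v.
  by rewrite mul0mx add0r mulmx0 addr0.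
have Bz := nbhs_singleton hB.
case: h => h1 h2; split=> //.
rewrite h2 !Bz !jacobianE e trmx_mul !mulmxDr !mulmxDl !mulmxN !mulNmx !mulmxA !mxE; ring.
Unshelve. all: by end_near. Qed.

(** Here B is the Jacobian matrix of V and dP, the derivative of P = G2 / G1
along V, is eliminated.  The hypothesis is the product rule for P G1 = G2 with
L_V G1 = - G2 and L_V G2 = G1, which yields dP = P B - B P since - P G2 = G1
occurs on both sides. *)
Lemma deriv_twist (B G1 G2 G3 P dP : 'M[R]_N) :
  G1 \in unitmx -> P *m G1 = G2 -> P *m P = - 1%:M ->
  dP *m G1 + P *m (- G2 - B *m G1 - G1 *m B^T) = G1 - B *m G2 - G2 *m B^T ->
  dP *m G3 + P *m (- (B *m G3) - G3 *m B^T) = - (B *m (P *m G3)) - P *m G3 *m B^T.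
Proof.
move=> u1 PG PP e.
have PG2 : P *m G2 = - G1 by rewrite -PG mulmxA PP mulNmx mul1mx.
have -> : dP = P *m B - B *m P.
  apply: (can_inj (mulmxK u1)); apply: (addIr (P *m (- G2 - B *m G1 - G1 *m B^T))).
  rewrite e mulmxBl !mulmxBr mulmxN PG2 opprK !mulmxA PG -(mulmxA B) PG.
  move: (P *m B *m G1) (B *m G2) (G2 *m B^T) => p q r.
  by rewrite addrACA [p + _]addrC subrK addrA.
rewrite mulmxBl mulmxBr mulmxN !mulmxA.
by rewrite addrACA subrr add0r.
Qed.

(** Here B is - B3 (I ., .), where B1 (I u, .) = - B2 (u, .).  The endomorphism I
is differentiable by differentiable_invmx and invariant by deriv_twist. *)
Lemma is_lie_twist (B1 B2 B3 B : T -> T -> T -> R) :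
  (\forall y \near z, forall u w, B1 y u w = (u *m mat (B1 y) *m w^T) 0 0) ->
  (\forall y \near z, forall u w, B2 y u w = (u *m mat (B2 y) *m w^T) 0 0) ->
  (\forall y \near z, forall u w, B3 y u w = (u *m mat (B3 y) *m w^T) 0 0) ->
  (\forall y \near z, mat (B1 y) \in unitmx) ->
  mat (B2 z) *m invmx (mat (B1 z)) *m (mat (B2 z) *m invmx (mat (B1 z))) = - 1%:M ->
  (\forall y \near z, forall u w,
     B y u w = (u *m (mat (B2 y) *m invmx (mat (B1 y)) *m mat (B3 y)) *m w^T) 0 0) ->
  is_lie V B1 z (fun u w => - B2 z u w) -> is_lie V B2 z (B1 z) ->
  is_lie V B3 z (fun _ _ => 0) -> is_lie V B z (fun _ _ => 0).
Proof.
move=> n1 n2 n3 nu sq nB l1 l2 l3.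
have [d1 D1 e1] := is_lie_mat (nbhs_singleton n1) l1.
have [d2 D2 e2] := is_lie_mat (nbhs_singleton n2) l2.
have [d3 D3 e3] := is_lie_mat (nbhs_singleton n3) l3.
have [dI DI] := differentiable_invmx D1 nu.
pose P y := mat (B2 y) *m invmx (mat (B1 y)).
have DP := is_der_mul D2 DI; set dP := (X in is_der _ _ X) in DP.
have e : dP (V z) *m mat (B1 z) + P z *m d1 (V z) = d2 (V z).
  have h1 : is_der (fun y => P y *m mat (B1 y)) z d2.
    apply: (is_der_near _ D2); near=> y; rewrite /P mulmxKV //; near: y; exact: nu.
  by rewrite (is_der_unique h1 (is_der_mul DP D1)).
have U1 := nbhs_singleton nu.
have PG : P z *m mat (B1 z) = mat (B2 z) by rewrite /P mulmxKV.
have N1 : mat (fun u w => - B2 z u w) = - mat (B2 z) by apply/matrixP => r s; rewrite !mxE.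
have N3 : mat (fun _ _ => 0 : R) = 0 by apply/matrixP => r s; rewrite !mxE.
apply: (mat_is_lie nB (is_der_mul DP D3)).
have t := deriv_twist (B := A) (mat (B3 z)) U1 PG sq (dP := dP (V z)).
by rewrite e3 N3 sub0r t // -e2 -e e1 N1.
Unshelve. all: by end_near. Qed.

End LieMatrices.

Theorem proposition3p20 (R : realType) (n : nat) (M : manifold R (n + n))
    (g om : form2 M) (J : endo M) (D nab : connection M) (xi : vfield M)
    (Lam : idx M -> 'rV[R]_(n + n) -> set 'rV[R]_(n + n))
    (Om : idx M -> 'rV[R]_(n + n) -> 'rV[R]_(n + n) -> int)
    (hM : cask g om J D nab xi)
    (hLam : integral_structure om nab Lam)
    (hOm : bps_structure om J nab xi Lam Om)
    (hcomp : compatible g om J nab xi Lam Om) :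
  infinitesimal_rotating_action om J nab xi Lam Om.
Proof.
move=> i W a b df z0 Wz.
have hv := varpi_clie hM hOm df Wz; have h3 := omega3_lie hM hOm df Wz.
split=> //; have [[dV l1] [_ l2]] := hv.
have nW := near_W df Wz.
apply: (@is_lie_twist _ _ _ _ dV (omega1 om J xi Om i a b) (omega2 om J xi Om i a b)
  (omega3 om J xi Om i a b)) => //.
- by near=> y => u w; apply: (omega1E hM hOm df); near: y.
- by near=> y => u w; apply: (omega2E hM hOm df); near: y.
- by near=> y => u w; apply: (omega3E hM hOm df); near: y.
- by near=> y; apply: (G1_unit hM hOm df _ hcomp); near: y.
- exact: (I3_square hM hOm df Wz hcomp).
- near=> y => u w; have Wy : W (base y) by near: y.
  by rewrite /gN (omega3E hM hOm df Wy) /I3 !mulNmx mxE opprK !mulmxA.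
- by split=> // u w; have [h1 ->] := l1 u w; rewrite Re_ii.
- by split=> // u w; have [h1 ->] := l2 u w; rewrite Im_ii.
Unshelve. all: by end_near. Qed.
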